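(* Let $\rho:B\twoheadrightarrow\Gamma$ be a Fell bundle over an étale groupoid $\Gamma$. Then $$\mathcal{C}^\rho_{\mathsf b}=\{a\in\mathcal{S}^\rho:a\text{ is continuous everywhere on }\Gamma\text{ and }\|a\|_{\mathsf b}<\infty\}$$ is a Banach *-bimodule over the reduced C*-algebra $\mathcal{C}^\rho_{\mathsf r}$ (with norm $\|\cdot\|_{\mathsf b}$, involution $a^*(\gamma)=a(\gamma^{-1})^*$ and actions given by convolution).
   Context: Groupoids. For a groupoid $\Gamma$, $\mathsf{s}(\gamma)=\gamma^{-1}\gamma$, $\mathsf{r}(\gamma)=\gamma\gamma^{-1}$, $\Gamma^0\subseteq\Gamma$ is the set of units, and $\Gamma^2$ is the set of composable pairs ($(\alpha,\beta)\in\Gamma^2$ iff $\mathsf{s}(\alpha)=\mathsf{r}(\beta)$). For $x\in\Gamma^0$, $\Gamma x=\{\gamma:\mathsf{s}(\gamma)=x\}$. An étale groupoid is a groupoid with a topology making product and inverse continuous and such that $\mathsf{s}$ is an open map. No Hausdorff, local compactness or countability assumption is made, even on $\Gamma^0$. A slice is a subset on which $\mathsf{s}$ and $\mathsf{r}$ are injective. A subset $K\subseteq\Gamma$ is biclosed if $\mathsf{s}[K]$ and $\mathsf{r}[K]$ are closed in $\Gamma^0$; it is bicompact if it is a biclosed compact subset of an open slice. Fell bundles. A semigroupoid is a set with a partial binary operation such that $(ab)c$ is defined iff $a(bc)$ is, in which case they are equal; a *-semigroupoid also has an involution with $a^{**}=a$ and $(ab)^*=b^*a^*$ whenever $ab$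 is defined. A Banach bundle is an open continuous surjection $\rho:B\twoheadrightarrow X$ of topological spaces such that each fibre $B_x=\rho^{-1}\{x\}$ is a complex Banach space (zero $0_x$); for each $\lambda\in\mathbb{C}$, $b\mapsto\lambda b$ is continuous on $B$; addition is continuous on $\{(a,b):\rho(a)=\rho(b)\}$; the norm is upper semicontinuous on $B$; and $\rho(b_\lambda)\to x$, $\|b_\lambda\|\to0$ imply $b_\lambda\to0_x$ for nets. A Fell bundle is a Banach bundle $\rho:B\twoheadrightarrow\Gamma$ such that: (1) $B$ is a *-semigroupoid with continuous product and involution, products are bilinear and $*$ is antilinear; (2) the norm is submultiplicative, $\Gamma$ is an étale groupoid, $ab$ is defined iff $(\rho(a),\rho(b))\in\Gamma^2$, in which case $\rho(ab)=\rho(a)\rho(b)$, and $\rho(a^* )=\rho(a)^{-1}$; (3) for all $b\in B$, $\|b^*b\|=\|b\|^2$ and there is $a\in B_{\rho(b^*b)}$ with $a^*a=b^*b$. Sections. $\mathcal{S}^\rho$ is the vector space (pointwise operations) of all, possibly discontinuous, sections $a:\Gamma\to B$, $\rho\circ a=\mathrm{id}_\Gamma$. Put $\mathrm{supp}(a)=\{\gamma:a(\gamma)\ne0_\gamma\}$ and $a^*(\gamma)=a(\gamma^{-1})^*$. The convolution $ab(\gamma)=\sum_{\gamma=\alpha\beta}a(\alpha)b(\beta)$ is ''defined'' if for every $\gamma\in\Gamma$ the net of finite partial sums converges in norm in $B_\gamma$. $\mathcal{F}^\rho$ denotes the finitely supported sections. Define $[0,\infty]$-valued norms by $$\|a\|_2=\sup_{x\in\Gamma^0}\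 \sup_{F\subseteq\Gamma x\text{ finite}}\Big\|\sum_{\gamma\in F}a(\gamma)^*a(\gamma)\Big\|^{1/2},\qquad \|a\|_{\mathsf b}=\sup_{f\in\mathcal{F}^\rho}\frac{\|af\|_2}{\|f\|_2}\quad(0/0=0).$$ Let $\mathcal{S}^\rho_{\mathsf b}=\{a:\|a\|_{\mathsf b}<\infty\}$. The big C*-algebra is $\mathcal{B}^\rho=\{a\in\mathcal{S}^\rho_{\mathsf b}:a^*a\text{ and }aa^*\text{ are defined}\}$, with convolution, $*$ and norm $\|\cdot\|_{\mathsf b}$. For $Y\subseteq\Gamma$, $\mathcal{C}^\rho(Y)$ is the set of $a\in\mathcal{S}^\rho$ with $\mathrm{supp}(a)\subseteq Y$ that are, as functions on $\Gamma$, continuous at every point of $Y$. $\mathcal{C}^\rho_{\mathsf c}=\mathrm{span}\{a\in\mathcal{C}^\rho(K):K\subseteq\Gamma\text{ bicompact}\}$, and $\mathcal{C}^\rho_{\mathsf r}=\mathrm{cl}_{\mathsf b}(\mathcal{C}^\rho_{\mathsf c})$ is its $\|\cdot\|_{\mathsf b}$-closure, a C*-subalgebra of $\mathcal{B}^\rho$, called the reduced C*-algebra. Bimodules. A bimodule $M$ over an algebra $A$ is a Banach bimodule if $M$ and $A$ are Banach spaces with $\|ab\|\le\|a\|\|b\|$ whenever $a$ and/or $b$ are in $A$ (and the other, if not in $A$, is in $M$). It is a Banach *-bimodule if moreover $M$ and $A$ carry involutions with $\|a^*\|=\|a\|$ and $(ab)^*=b^*a^*$ whenever $a$ and/or $b$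 are in $A$. *)

(* Defs.v *)
From HB Require Import structures.
From mathcomp Require Import all_boot all_order all_algebra.
From mathcomp Require Import complex finmap.
From mathcomp Require Import all_classical all_reals ereal topology normedtype.
From mathcomp Require analysis.showcase.summability.

Set Implicit Arguments.
Unset Strict Implicit.
Unset Printing Implicit Defensive.

Import Order.TTheory GRing.Theory Num.Theory.
Import numFieldNormedType.Exports.

Local Open Scope classical_set_scope.
Local Open Scope ring_scope.

(* The product is a total function, constrained only on composable pairs;
   its values elsewhere are junk. *)
Record groupoid_ops (T : Type) := GroupoidOps {
  gmul : T -> T -> T;
  ginv : T -> T
}.

Section Groupoid.
Variables (T : Type) (G : groupoid_ops T).

Definition src (g : T) : T := gmul G (ginv G g) g.
Definition rng (g : T) : T := gmul G g (ginv G g).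
Definition composable (a b : T) : Prop := src a = rng b.
Definition units : set T := range src.

Record is_groupoid : Prop := {
  ginvK : involutive (ginv G);
  src_gmul : forall a b, composable a b -> src (gmul G a b) = src b;
  rng_gmul : forall a b, composable a b -> rng (gmul G a b) = rng a;
  gmulA : forall a b c, composable a b -> composable b c ->
    gmul G (gmul G a b) c = gmul G a (gmul G b c);
  gmul_src : forall a, gmul G a (src a) = a;
  gmul_rng : forall a, gmul G (rng a) a = a
}.

End Groupoid.

(* The source map is open as a map from the groupoid to itself, so that the
   unit space is an open subset. *)
Record etale_groupoid := EtaleGroupoid {
  gcarrier :> topologicalType;
  gops :> groupoid_ops gcarrier;
  etale_is_groupoid : is_groupoid gops;
  gmul_continuous :
    {within [set p | composable gops p.1 p.2],
      continuous (fun p : gcarrier * gcarrier => gmul gops p.1 p.2)};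
  ginv_continuous : continuous (ginv gops);
  src_open : forall U, open U -> open (src gops @` U)
}.

Section Bicompact.
Variable G : etale_groupoid.

Definition slice (Y : set G) : Prop := set_inj Y (src G) /\ set_inj Y (rng G).

Definition biclosed (K : set G) : Prop :=
  closed (src G @` K : set (subspace (units G))) /\
  closed (rng G @` K : set (subspace (units G))).

Definition bicompact (K : set G) : Prop :=
  [/\ biclosed K, compact K & exists O, [/\ open O, slice O & K `<=` O]].

End Bicompact.

(* Library norms of complex normed spaces take values in [R[i]]. *)
Definition rnorm (R : realType) (E : normedModType R[i]) (v : E) : R :=
  complex.Re `|v|.

(* [emb x] identifies the Banach space [fibre x] with the subset
   [proj @^-1` [set x]] of the total space. *)
Record bundle_data (R : realType) (X : topologicalType) := BundleData {
  fibre : X -> completeNormedModType R[i];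
  total_space : topologicalType;
  proj : total_space -> X;
  emb : forall x, fibre x -> total_space
}.

Section BanachBundle.
Variables (R : realType) (X : topologicalType) (E : bundle_data R X).

(* Inverse of [emb x]; 0 outside the fibre over [x]. *)
Definition coord (x : X) (b : total_space E) : fibre E x :=
  xget 0 [set v | emb v = b].

Definition vec (b : total_space E) : fibre E (proj b) := coord (proj b) b.

Record is_banach_bundle : Prop := {
  emb_inj : forall x, injective (@emb R X E x);
  emb_range : forall x, range (@emb R X E x) = @proj R X E @^-1` [set x];
  proj_surj : set_surj setT setT (@proj R X E);
  proj_continuous : continuous (@proj R X E);
  proj_open : forall U, open U -> open (@proj R X E @` U);
  scale_continuous : forall k : R[i], continuous (fun b => emb (k *: vec b));
  add_continuous : {within [set p | proj p.1 = proj p.2],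
    continuous (fun p : total_space E * total_space E =>
      emb (vec p.1 + coord (proj p.1) p.2))};
  norm_usc : forall r : R, open [set b | rnorm (vec b) < r];
  (* proper filters on the total space stand for nets *)
  small_cvg : forall (F : set_system (total_space E)) (x : X), ProperFilter F ->
    @proj R X E @ F --> x ->
    (fun b => rnorm (vec b)) @ F --> (0 : R) ->
    F --> emb (0 : fibre E x)
}.

End BanachBundle.

(* [fmul a b] is meaningful when [proj a] and [proj b] are composable. *)
Record fell_data (R : realType) (G : etale_groupoid) := FellData {
  fdata :> bundle_data R G;
  fmul : total_space fdata -> total_space fdata -> total_space fdata;
  fstar : total_space fdata -> total_space fdata
}.

Section FellBundle.
Variables (R : realType) (G : etale_groupoid) (B : fell_data R G).

Definition fcomposable (a b : total_space B) : Prop := composable G (proj a) (proj b).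

Record is_fell_bundle : Prop := {
  fell_is_banach : is_banach_bundle B;
  proj_fmul : forall a b : total_space B, fcomposable a b ->
    proj (fmul a b) = gmul G (proj a) (proj b);
  proj_fstar : forall a : total_space B, proj (fstar a) = ginv G (proj a);
  fmulA : forall a b c : total_space B, fcomposable a b -> fcomposable b c ->
    fmul (fmul a b) c = fmul a (fmul b c);
  fstarK : forall a : total_space B, fstar (fstar a) = a;
  fstarM : forall a b : total_space B, fcomposable a b ->
    fstar (fmul a b) = fmul (fstar b) (fstar a);
  fmul_continuous : {within [set p | fcomposable p.1 p.2],
    continuous (fun p : total_space B * total_space B => fmul p.1 p.2)};
  fstar_continuous : continuous (@fstar R G B);
  fmul_bilinear : forall x y : G, composable G x y ->
    bilinear_for *:%R *:%R (fun (u : fibre B x) (v : fibre B y) =>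
      coord (gmul G x y) (fmul (emb u) (emb v)));
  fstar_antilinear : forall (x : G) (k : R[i]) (u v : fibre B x),
    coord (ginv G x) (fstar (emb (k *: u + v))) =
    k^* *: coord (ginv G x) (fstar (emb u)) + coord (ginv G x) (fstar (emb v));
  norm_fmul : forall a b : total_space B, fcomposable a b ->
    rnorm (vec (fmul a b)) <= rnorm (vec a) * rnorm (vec b);
  norm_fstar_fmul : forall b : total_space B,
    rnorm (vec (fmul (fstar b) b)) = rnorm (vec b) ^+ 2;
  fstar_fmul_positive : forall b : total_space B, exists a : total_space B,
    proj a = proj (fmul (fstar b) b) /\ fmul (fstar a) a = fmul (fstar b) b
}.

End FellBundle.

Record fell_bundle (R : realType) (G : etale_groupoid) := FellBundle {
  fell :> fell_data R G;
  fellP : is_fell_bundle fell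
}.

Definition dfunction (X : Type) (V : X -> Type) : Type := forall x, V x.

Section PointwiseModule.
Variables (K : pzRingType) (X : Type) (V : X -> lmodType K).
Implicit Types a b c : dfunction V.

HB.instance Definition _ := Choice.copy (dfunction V) (forall x, V x).

Let add a b : dfunction V := fun x => a x + b x.
Let opp a : dfunction V := fun x => - a x.
Let zero : dfunction V := fun=> 0.
Let scale (k : K) a : dfunction V := fun x => k *: a x.

Fact dfunction_addA : associative add.
Proof. by move=> a b c; apply: functional_extensionality_dep => x; exact: addrA. Qed.
Fact dfunction_addC : commutative add.
Proof. by move=> a b; apply: functional_extensionality_dep => x; exact: addrC. Qed.
Fact dfunction_add0 : left_id zero add.
Proof. by move=> a; apply: functional_extensionality_dep => x; exact: add0r. Qed.
Fact dfunction_addN : left_inverse zero opp add.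
Proof. by move=> a; apply: functional_extensionality_dep => x; exact: addNr. Qed.

HB.instance Definition _ := GRing.isZmodule.Build (dfunction V)
  dfunction_addA dfunction_addC dfunction_add0 dfunction_addN.

Fact dfunction_scaleA k l a : scale k (scale l a) = scale (k * l) a.
Proof. by apply: functional_extensionality_dep => x; exact: scalerA. Qed.
Fact dfunction_scale1 : left_id 1 scale.
Proof. by move=> a; apply: functional_extensionality_dep => x; exact: scale1r. Qed.
Fact dfunction_scaleDr : right_distributive scale +%R.
Proof. by move=> k a b; apply: functional_extensionality_dep => x; exact: scalerDr. Qed.
Fact dfunction_scaleDl a : {morph scale^~ a : k l / k + l}.
Proof. by move=> k l; apply: functional_extensionality_dep => x; exact: scalerDl. Qed.

HB.instance Definition _ := GRing.Zmodule_isLmodule.Build K (dfunction V)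
  dfunction_scaleA dfunction_scale1 dfunction_scaleDr dfunction_scaleDl.

End PointwiseModule.

Section Sections.
Variables (R : realType) (G : etale_groupoid) (B : fell_bundle R G).

Definition sect : lmodType R[i] := dfunction (fibre B).

Implicit Types a b c f : sect.

Definition sect_val a : G -> total_space B := fun g => emb (a g).

Definition supp a : set G := [set g | a g != 0].

Definition finitely_supported : set sect := [set f | finite_set (supp f)].

Definition sstar a : sect := fun g => coord g (fstar (sect_val a (ginv G g))).

Definition factors (g : G) : set (G * G) :=
  [set p | composable G p.1 p.2 /\ gmul G p.1 p.2 = g].

Definition conv_term a b (g : G) (p : factors g) : fibre B g :=
  coord g (fmul (sect_val a (val p).1) (sect_val b (val p).2)).

Definition conv_defined a b : Prop := forall g : G,
  cvg (summability.partial_sum (@conv_term a b g) @ summability.totally).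

Definition conv a b : sect := fun g => summability.sum (@conv_term a b g).

Local Open Scope ereal_scope.

(* The maximum with 0 only matters for the empty groupoid, where [ereal_sup]
   is taken over the empty set. *)
Definition norm2 a : \bar R :=
  maxe 0 (ereal_sup [set ereal_sup
    [set (Num.sqrt (rnorm
           (\sum_(g <- F) coord x (fmul (fstar (sect_val a g)) (sect_val a g)))%R))%:E
    | F in [set F : {fset G} | forall g, g \in F -> src G g = x]]
  | x in units G]).

(* In [\bar R], [0 / 0 = 0 * +oo = 0]. *)
Definition normb a : \bar R :=
  ereal_sup [set norm2 (conv a f) / norm2 f | f in finitely_supported].

(* Sections supported in Y and continuous at every point of Y. *)
Definition continuous_on (Y : set G) : set sect :=
  [set a | supp a `<=` Y /\ forall y, Y y -> {for y, continuous (sect_val a)}].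

Definition compact_sections : set sect :=
  [set a | exists (n : nat) (k : 'I_n -> R[i]) (c : 'I_n -> sect),
     (forall i, exists2 K, bicompact K & continuous_on K (c i)) /\
     a = (\sum_(i < n) k i *: c i)%R].

Definition reduced_algebra : set sect :=
  [set a | forall e : R, (0 < e)%R ->
     exists2 c, compact_sections c & normb (a - c)%R < e%:E].

Definition bounded_continuous_sections : set sect :=
  [set a | continuous (sect_val a) /\ normb a < +oo].

Definition convolves a b c : Prop := conv_defined a b /\ conv a b = c.

End Sections.

Arguments finitely_supported {R G} B.
Arguments compact_sections {R G} B.
Arguments reduced_algebra {R G} B.
Arguments bounded_continuous_sections {R G} B.

Record banach_bimodule (R : realType) := BanachBimodule {
  balg : completeNormedModType R[i];
  bmod : completeNormedModType R[i];
  amul : balg -> balg -> balg;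
  lact : balg -> bmod -> bmod;
  ract : bmod -> balg -> bmod;
  amul_bilinear : bilinear_for *:%R *:%R amul;
  lact_bilinear : bilinear_for *:%R *:%R lact;
  ract_bilinear : bilinear_for *:%R *:%R ract;
  amulA : associative amul;
  lactA : forall a b m, lact (amul a b) m = lact a (lact b m);
  lractA : forall a m b, ract (lact a m) b = lact a (ract m b);
  ractA : forall m a b, ract m (amul a b) = ract (ract m a) b;
  norm_amul : forall a b, `|amul a b| <= `|a| * `|b|;
  norm_lact : forall a m, `|lact a m| <= `|a| * `|m|;
  norm_ract : forall m a, `|ract m a| <= `|m| * `|a|
}.

Definition is_involution (R : realType) (E : lmodType R[i]) (s : E -> E) : Prop :=
  involutive s /\ forall k u v, s (k *: u + v) = k^* *: s u + s v.

Record banach_star_bimodule (R : realType) := BanachStarBimodule {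
  bbimod :> banach_bimodule R;
  astar : balg bbimod -> balg bbimod;
  mstar : bmod bbimod -> bmod bbimod;
  astar_involution : is_involution astar;
  mstar_involution : is_involution mstar;
  norm_astar : forall a, `|astar a| = `|a|;
  norm_mstar : forall m, `|mstar m| = `|m|;
  astarM : forall a b, astar (amul a b) = amul (astar b) (astar a);
  mstar_lact : forall a m, mstar (lact a m) = ract (mstar m) (astar a);
  mstar_ract : forall m a, mstar (ract m a) = lact (astar a) (mstar m)
}.

(* [j] identifies the Banach space [E] with the set [V] normed by [N]. *)
Definition realises (R : realType) (S : lmodType R[i]) (N : S -> \bar R)
    (V : set S) (E : completeNormedModType R[i]) (j : {linear E -> S}) : Prop :=
  [/\ injective j, range j = V & forall v, N (j v) = (rnorm v)%:E].

(* [M], with norm [normb], involution [sstar] and convolution as actions, is a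
   Banach *-bimodule over [A], with the same norm, involution and product. *)
Definition is_banach_star_bimodule_over (R : realType) (G : etale_groupoid)
    (B : fell_bundle R G) (A M : set (sect B)) : Prop :=
  exists (D : banach_star_bimodule R)
    (iA : {linear balg D -> sect B}) (iM : {linear bmod D -> sect B}),
  [/\ realises (@normb R G B) A iA,
      realises (@normb R G B) M iM,
      [/\ forall a b, convolves (iA a) (iA b) (iA (amul a b)),
          forall a m, convolves (iA a) (iM m) (iM (lact a m)) &
          forall m a, convolves (iM m) (iA a) (iM (ract m a))] &
      (forall a, iA (astar a) = sstar (iA a)) /\
      (forall m, iM (mstar m) = sstar (iM m))].

(* Main.v *)
(* For a unit x, the sections over the arrows with source x form a pre-Hilbert
   module over the C*-algebra B_x, with <h,k> the sum of the h(g)* k(g); a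
   section a is bounded by M in the b-norm exactly when all finite blocks
   (a(g b^-1))_(g,b) of its convolution operator satisfy
   |<h, a f>| <= M |h| |f|.  This form is symmetric under the involution, is
   additive in a, and passes to pointwise limits, which gives the norm, the
   isometry of the involution, submultiplicativity and completeness.  It rests
   on the Cauchy-Schwarz inequality, hence on the theorem of Fukamiya and
   Kaplansky that sums of elements b* b have monotone norm, proved here for
   adjointable operators on a fibre by means of square roots.

   An element of the reduced algebra is a b-norm limit of sections c that have
   finite support on each source and range fibre.  Convolution by such a c is a
   finite sum, so convolutions by elements of the reduced algebra converge and
   associativity extends by density.  If c is supported in a compact subset of
   an open slice, (c m)(g) = c(k) m(k^-1 g) for the unique k of the slice with
   the range of g, which depends continuously on g; hence c m is continuous when
   m is, and uniform limits of continuous sections are continuous. *)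
From HB Require Import structures.
From mathcomp Require Import all_boot all_order all_algebra.
From mathcomp Require Import complex finmap ring lra.
From mathcomp Require Import all_classical all_reals.
From mathcomp Require Import ereal topology normedtype.
From mathcomp Require analysis.showcase.summability.
Require Import Defs.

Set Implicit Arguments.
Unset Strict Implicit.
Unset Printing Implicit Defensive.

Import Order.TTheory GRing.Theory Num.Theory.
Import numFieldNormedType.Exports.

Local Open Scope classical_set_scope.
Local Open Scope complex_scope.
Local Open Scope ring_scope.

(** * Square roots and positive elements in unital C*-algebras *)

(** The fibre over a unit is a C*-algebra that may lack a unit, and fibres may be zero. Square roots
    are therefore taken in the unital algebra of adjointable operators on a nonzero fibre, [posf]
    carries positivity back to the fibre over the unit, and zero fibres are split off by hand. An
    element b over an arbitrary arrow multiplies one fibre into another and is no operator on a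
    single fibre; the axiom b* b = a* a with a over the unit replaces it by one that is, which
    brings b* b within reach of Fukamiya and Kaplansky.

    No separation is assumed on the groupoid, and a section supported in K is continuous only at the
    points of K. Where the range of g lies outside r[K], the product c m is continuous at g because
    r[K] is closed in the units, so that c m vanishes near g.

    A bounded continuous section need not be a limit of sections with finite rows or columns, so
    convergence of a product always comes from a factor in the reduced algebra. Associativity is
    drawn from such a factor on the far left; the law with both algebra factors on the right follows
    by the involution. *)

Section RealScalars.
Variable R : realType.

Lemma cconj_real (r : R) : (r%:C)^* = r%:C.
Proof. by rewrite conj_Creal// complex_real. Qed.

Lemma cnorm_real (r : R) : `|r%:C| = `|r|%:C.
Proof. by rewrite normc_def /= expr0n addr0 sqrtr_sqr. Qed.

End RealScalars.

(* Bounds the error of the square-root iteration [scalar_iter]. *)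
Definition rate (R : realType) (n : nat) : R := 2 / n.+2%:R.

Section Rate.
Variable R : realType.
Local Notation rate := (@rate R).

Lemma rate_gt0 n : 0 < rate n.
Proof. by rewrite /rate divr_gt0// ltr0n. Qed.

Lemma rate_le m n : (n <= m)%N -> rate m <= rate n.
Proof.
move=> nm; rewrite /rate ler_pM2l ?ltr0n// lef_pV2 ?posrE ?ltr0n//.
by rewrite ler_nat !ltnS.
Qed.

Lemma rate_small (e : R) : 0 < e -> exists n, rate n < e.
Proof.
move=> e0; exists (Num.bound (2 / e)).
have h := archi_boundP (ltW (divr_gt0 (ltr0n R 2) e0)).
rewrite /rate ltr_pdivrMr ?ltr0n// mulrC -ltr_pdivrMr//.
by apply: lt_trans h _; rewrite ltr_nat.
Qed.

Lemma le0_rate (a c : R) : (forall n, a <= c * rate n) -> a <= 0.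
Proof.
move=> h; rewrite leNgt; apply/negP => a0.
have [c0|c0] := leP c 0.
  by have := h 0%N; rewrite leNgt (le_lt_trans _ a0)// mulr_le0_ge0// ltW// rate_gt0.
have [n] := rate_small (divr_gt0 a0 c0).
by rewrite ltr_pdivlMr// mulrC ltNge h.
Qed.

End Rate.

(** Completeness is asked only for sequences converging at the fixed speed [rate], which is the
    speed of the square-root iteration. *)
Record cstar_algebra_axioms (R : realType) (U : algType R[i])
    (st : U -> U) (nrm : U -> R) : Prop := {
  cst_lin : forall (k : R[i]) (u v : U), st (k *: u + v) = k^* *: st u + st v;
  cstM : forall u v : U, st (u * v) = st v * st u;
  cstK : involutive st;
  cnrmD : forall u v : U, nrm (u + v) <= nrm u + nrm v;
  cnrmZ : forall (k : R[i]) (u : U), nrm (k *: u) = complex.Re `|k| * nrm u;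
  cnrmM : forall u v : U, nrm (u * v) <= nrm u * nrm v;
  cnrm_st : forall u : U, nrm (st u * u) = nrm u ^+ 2;
  cnrm_eq0 : forall u : U, nrm u = 0 -> u = 0;
  cnrm_complete : forall w : nat -> U,
    (forall m n, (n <= m)%N -> nrm (w m - w n) <= rate R n) ->
    exists l, forall n, nrm (w n - l) <= rate R n
}.

Section CstarAlgebra.
Variables (R : realType) (U : algType R[i]) (st : U -> U) (nrm : U -> R).
Hypothesis HU : cstar_algebra_axioms st nrm.
Local Notation rate := (@rate R).

Let nD := cnrmD HU.
Let nM := cnrmM HU.
Let stM := cstM HU.
Let stK := cstK HU.

Local Notation "r *~: u" := (r%:C *: u) (at level 40).

Lemma cst0 : st 0 = 0.
Proof.
have := cst_lin HU 1 0 0; rewrite scale1r addr0 conjC1 scale1r => /eqP.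
by rewrite -subr_eq0 opprD addNKr oppr_eq0 => /eqP.
Qed.

Lemma cstZ k u : st (k *: u) = k^* *: st u.
Proof. by have := cst_lin HU k u 0; rewrite addr0 cst0 addr0. Qed.

Lemma cstD u v : st (u + v) = st u + st v.
Proof. by have := cst_lin HU 1 u v; rewrite conjC1 !scale1r. Qed.

Lemma cstN u : st (- u) = - st u.
Proof. by rewrite -scaleN1r cstZ rmorphN1 scaleN1r. Qed.

Lemma cstB u v : st (u - v) = st u - st v.
Proof. by rewrite cstD cstN. Qed.

Lemma cstZr (r : R) u : st (r *~: u) = r *~: st u.
Proof. by rewrite cstZ cconj_real. Qed.

Lemma cst1 : st 1 = 1.
Proof. by have := stM (st 1) 1; rewrite mulr1 stK mulr1. Qed.

Lemma cnrmZr (r : R) u : nrm (r *~: u) = `|r| * nrm u.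
Proof. by rewrite (cnrmZ HU) cnorm_real. Qed.

Lemma cnrm0 : nrm 0 = 0.
Proof. by rewrite -(scale0r 0) (cnrmZ HU) normr0 mul0r. Qed.

Lemma cnrmN u : nrm (- u) = nrm u.
Proof. by rewrite -scaleN1r (cnrmZ HU) normrN1 mul1r. Qed.

Lemma cnrmB u v : nrm (u - v) <= nrm u + nrm v.
Proof. by rewrite -(cnrmN v); exact: nD. Qed.

Lemma cnrm_ge0 u : 0 <= nrm u.
Proof. by have := cnrmB u u; rewrite subrr cnrm0; lra. Qed.

(** As |v|^2 = |v* v| <= |v*| |v|, each of v and v* dominates the other. *)
Lemma cnrm_stE u : nrm (st u) = nrm u.
Proof.
have le v : nrm v <= nrm (st v).
  have [/eqP v0|v0] := eqVneq (nrm v) 0; first by rewrite (eqP v0) cnrm_ge0.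
  have vp : 0 < nrm v by rewrite lt_def v0 cnrm_ge0.
  by rewrite -(ler_pM2r vp) -expr2 -(cnrm_st HU) nM.
by apply/eqP; rewrite eq_le le -{2}(stK u) le.
Qed.

Lemma cnrm1 : nrm 1 <= 1.
Proof.
have := cnrm_st HU 1; rewrite cst1 mulr1 expr2 => /eqP.
rewrite eq_sym -subr_eq0 -{3}(mulr1 (nrm 1)) -mulrBr mulf_eq0.
by case/orP => /eqP; lra.
Qed.

Lemma cnrm_sq u : st u = u -> nrm (u * u) = nrm u ^+ 2.
Proof. by move=> su; rewrite -(cnrm_st HU) su. Qed.

(* The square root of [1 - x] is [1 - y] with [y] the limit of
   [y (n+1) = (x + y n ^ 2) / 2]; the norm of [y n] and of its increments are
   dominated by the same iteration on the scalar [1]. *)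
Let half : R := 2^-1.
Fixpoint cauchy_iter (x : U) n : U :=
  if n is m.+1 then half *~: (x + cauchy_iter x m * cauchy_iter x m) else 0.
Fixpoint scalar_iter n : R :=
  if n is m.+1 then half * (1 + scalar_iter m * scalar_iter m) else 0.

Lemma scalar_iter_bnd n : 0 <= scalar_iter n <= scalar_iter n.+1.
Proof.
have h0 : 0 <= half by rewrite invr_ge0 ler0n.
elim: n => [|n /andP[a b]]; first by rewrite /= lexx mul0r addr0 mulr1 h0.
have b0 := le_trans a b; rewrite b0 /=.
by rewrite ler_wpM2l// lerD2l ler_pM.
Qed.

(** The errors satisfy e (n+1) = e n - (e n)^2 / 2, and t - t^2 / 2 increases on [0,1]. At t =
    2/(n+2) it equals 2(n+1)/(n+2)^2 <= 2/(n+3), because (n+1)(n+3) <= (n+2)^2; [rate] is chosen for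
    this recursion. *)
Lemma scalar_iter_rate n : 0 <= 1 - scalar_iter n <= rate n.
Proof.
elim: n => [|n /andP[a b]]; first by rewrite /= subr0 /rate ler01 divff ?pnatr_eq0 //=.
have -> : 1 - scalar_iter n.+1 =
    (1 - scalar_iter n) - (1 - scalar_iter n) ^+ 2 / 2.
  by rewrite /= /half; field.
have [s0 _] := andP (scalar_iter_bnd n).
move: a b; set e := 1 - _ => a b.
have e1 : e <= 1 by rewrite /e; lra.
have q1 : rate n <= 1.
  by rewrite /rate ler_pdivrMr ?ltr0n// mul1r ler_nat.
apply/andP; split; first by nra.
apply: (@le_trans _ _ (rate n - rate n ^+ 2 / 2)); first by nra.
rewrite /rate; have n2 : (n.+2%:R : R) = n%:R + 2 by rewrite -addn2 natrD.
have n3 : (n.+3%:R : R) = n%:R + 3 by rewrite -addn3 natrD.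
rewrite n2 n3; have : 0 <= n%:R :> R by rewrite ler0n.
move: n%:R => z z0.
have -> : 2 / (z + 2) - (2 / (z + 2)) ^+ 2 / 2 = 2 * (z + 1) / (z + 2) ^+ 2.
  by field; lra.
rewrite ler_pdivrMr; last by nra.
rewrite mulrAC ler_pdivlMr; last by lra.
by nra.
Qed.

Lemma cauchy_iter_comm x z n : z * x = x * z ->
  z * cauchy_iter x n = cauchy_iter x n * z.
Proof.
move=> zx; elim: n => [|n IH] /=; first by rewrite mulr0 mul0r.
by rewrite -scalerAr -scalerAl mulrDr mulrDl zx mulrA IH -mulrA IH mulrA.
Qed.

Lemma cauchy_iter_st x n : st x = x -> st (cauchy_iter x n) = cauchy_iter x n.
Proof. by move=> sx; elim: n => [|n IH] /=; rewrite ?cst0// cstZr cstD stM IH sx. Qed.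

Lemma cauchy_iter_bnd x n : nrm x <= 1 -> nrm (cauchy_iter x n) <= scalar_iter n.
Proof.
move=> x1; elim: n => [|n IH] /=; first by rewrite cnrm0.
rewrite cnrmZr ger0_norm ?invr_ge0// ler_wpM2l ?invr_ge0//.
apply: le_trans (nD _ _) _; rewrite lerD//.
by apply: le_trans (nM _ _) _; rewrite ler_pM// cnrm_ge0.
Qed.

(** All iterates commute, so a difference of two squares factors; the scalar iteration satisfies the
    same identity. *)
Lemma cauchy_iter_incr x n : nrm x <= 1 ->
  nrm (cauchy_iter x n.+1 - cauchy_iter x n) <= scalar_iter n.+1 - scalar_iter n.
Proof.
move=> x1; elim: n => [|n IH].
  rewrite /= !mulr0 !addr0 !subr0 cnrmZr ger0_norm ?invr_ge0//.
  by rewrite ler_wpM2l ?invr_ge0.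
set y := cauchy_iter x in IH *; set s := scalar_iter in IH *.
have -> : y n.+2 - y n.+1 = half *~: ((y n.+1 + y n) * (y n.+1 - y n)).
  have yc : y n.+1 * y n = y n * y n.+1.
    by rewrite /y; apply: cauchy_iter_comm; rewrite cauchy_iter_comm.
  rewrite [in LHS]/y /= -/(cauchy_iter x n.+1) -/y -scalerBr; congr (_ *: _).
  rewrite -[y n.+1]/(cauchy_iter x n.+1) -/(y n.+1) opprD addrACA subrr add0r.
  by rewrite mulrBr !mulrDl yc addrKA.
have -> : s n.+2 - s n.+1 = half * ((s n.+1 + s n) * (s n.+1 - s n)).
  by rewrite /s /=; ring.
rewrite cnrmZr ger0_norm ?invr_ge0// ler_wpM2l ?invr_ge0//.
apply: le_trans (nM _ _) _; apply: ler_pM; rewrite ?cnrm_ge0//.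
by apply: le_trans (nD _ _) _; rewrite lerD// cauchy_iter_bnd.
Qed.

Lemma cauchy_iter_cauchy x m n : nrm x <= 1 -> (n <= m)%N ->
  nrm (cauchy_iter x m - cauchy_iter x n) <= rate n.
Proof.
move=> x1 nm.
apply: (@le_trans _ _ (scalar_iter m - scalar_iter n)).
  elim: m nm => [|m IH]; first by rewrite leqn0 => /eqP->; rewrite !subrr cnrm0.
  rewrite leq_eqVlt => /predU1P[->|]; first by rewrite !subrr cnrm0.
  rewrite ltnS => /IH h.
  rewrite -(subrK (cauchy_iter x m) (cauchy_iter x m.+1)) -addrA.
  apply: le_trans (nD _ _) _.
  have := cauchy_iter_incr m x1; lra.
have /andP[_ ?] := scalar_iter_rate n; have /andP[? _] := scalar_iter_rate m; lra.
Qed.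

(** The third clause says (1 - y)^2 = 1 - x. The bound on y makes 1 - y positive in the sense of
    [cpos], and the last clause lets the root commute with whatever commutes with x. *)
Lemma sqrt1B x : st x = x -> nrm x <= 1 ->
  exists y, [/\ st y = y, nrm y <= 1, y + y - y * y = x &
    forall z, z * x = x * z -> z * y = y * z].
Proof.
move=> sx x1; pose w := cauchy_iter x.
have [y hy] : exists y, forall n, nrm (w n - y) <= rate n.
  by apply: (cnrm_complete HU) => m n; exact: cauchy_iter_cauchy.
have hy' n : nrm (y - w n) <= rate n by rewrite -opprB cnrmN.
have eq0 u (c : R) : (forall n, nrm u <= c * rate n) -> u = 0.
  by move=> h; apply: (cnrm_eq0 HU); apply/eqP; rewrite eq_le cnrm_ge0 (le0_rate h).
have w1 n : nrm (w n) <= 1.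
  apply: le_trans (cauchy_iter_bnd n x1) _.
  by have := scalar_iter_rate n; lra.
have y1 : nrm y <= 1.
  rewrite -subr_le0; apply: (@le0_rate _ _ 1) => n; rewrite mul1r.
  rewrite lerBlDr -(subrK (w n) y); apply: le_trans (nD _ _) _.
  by rewrite lerD.
exists y; split=> //.
- apply/subr0_eq; apply: (eq0 _ 2) => n; rewrite mulr2n mulrDl mul1r.
  have -> : st y - y = st (y - w n) - (y - w n).
    by rewrite cstB (cauchy_iter_st n sx) opprB addrA subrK.
  by apply: le_trans (cnrmB _ _) _; rewrite cnrm_stE lerD.
(* The limit of the recursion 2 y (n+1) = x + (y n)^2 is taken with four error terms, each at most
   [rate n]. *)
- apply/subr0_eq; apply: (eq0 _ 4) => n.
  have hw : w n.+1 + w n.+1 = x + w n * w n.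
    by rewrite /w /= -scalerDl -rmorphD /= /half (_ : 2^-1 + 2^-1 = 1) ?scale1r//; field.
  have -> : y + y - y * y - x =
      (y - w n.+1) + (y - w n.+1) + (w n * (w n - y) + (w n - y) * y).
    rewrite [y - _ + (y - _)]addrACA -opprD hw mulrBr mulrBl subrKA.
    rewrite opprD [_ + (- x - _)]addrA subrKA; exact: addrAC.
  have := hy' n.+1; have := rate_le R (leqnSn n) => r1 r2.
  have a1 : nrm (w n * (w n - y)) <= rate n.
    apply: le_trans (nM _ _) _; rewrite -[leRHS]mul1r.
    by apply: ler_pM; rewrite ?cnrm_ge0.
  have a2 : nrm ((w n - y) * y) <= rate n.
    apply: le_trans (nM _ _) _; rewrite -[leRHS]mulr1.
    by apply: ler_pM; rewrite ?cnrm_ge0.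
  have := nD (y - w n.+1 + (y - w n.+1)) (w n * (w n - y) + (w n - y) * y).
  have := nD (y - w n.+1) (y - w n.+1).
  have := nD (w n * (w n - y)) ((w n - y) * y).
  lra.
- move=> z zx; apply/subr0_eq; apply: (eq0 _ (2 * nrm z)) => n.
  have zw : z * w n = w n * z by exact: cauchy_iter_comm.
  have -> : z * y - y * z = z * (y - w n) - (y - w n) * z.
    by rewrite mulrBr mulrBl zw opprB addrA subrK.
  apply: le_trans (cnrmB _ _) _.
  have := nM z (y - w n); have := nM (y - w n) z; have := hy' n.
  by have := cnrm_ge0 z; nra.
Qed.

(** For u = h + i k one has u* u = h^2 + k^2 by commutation, while h is the real part of u, so |h|
    <= |u|. *)
Lemma cnrm_sq_addsq h k : st h = h -> st k = k -> h * k = k * h ->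
  nrm (h * h) <= nrm (h * h + k * k).
Proof.
move=> sh sk hk; pose i : R[i] := 'i%R.
have ci : i^* = - i by rewrite /i conjCi.
have ii : i * i = -1 by rewrite -expr2 sqrCi.
pose u := h + i *: k.
have su : st u = h - i *: k by rewrite cstD sh cstZ sk ci scaleNr.
have uu : st u * u = h * h + k * k.
  rewrite su /u mulrDr !mulrBl -!scalerAr -!scalerAl scalerA ii scaleN1r hk opprK.
  by rewrite subrKA.
have hE : h = half *~: (u + st u).
  rewrite su /u addrACA subrr addr0 -mulr2n -scaler_nat scalerA.
  rewrite -[2%:R in RHS](rmorph_nat (real_complex R)) -rmorphM /= /half.
  by rewrite mulVf ?pnatr_eq0// scale1r.
have : nrm h <= nrm u.
  rewrite hE cnrmZr ger0_norm ?invr_ge0//.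
  have := nD u (st u); rewrite cnrm_stE /half.
  by have := cnrm_ge0 u; lra.
rewrite cnrm_sq// -uu (cnrm_st HU) => hu.
by rewrite ler_pXn2r// nnegrE cnrm_ge0.
Qed.

(* Positivity without spectra: [h] is self-adjoint and close to a scalar. *)
Definition cpos (h : U) : Prop :=
  st h = h /\ exists2 t : R, 0 <= t & nrm (t *~: 1 - h) <= t.

Lemma cposW h s t : s <= t -> nrm (s *~: 1 - h) <= s -> nrm (t *~: 1 - h) <= t.
Proof.
move=> st_ hs; have -> : t *~: 1 - h = (t - s) *~: 1 + (s *~: 1 - h).
  by rewrite rmorphB /= scalerBl addrA subrK.
apply: le_trans (nD _ _) _; rewrite cnrmZr ger0_norm ?subr_ge0//.
have := cnrm1; have := cnrm_ge0 1; nra.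
Qed.

Lemma cposD h k : cpos h -> cpos k -> cpos (h + k).
Proof.
move=> [sh [s s0 hs]] [sk [t t0 ht]]; split; first by rewrite cstD sh sk.
exists (s + t); first exact: addr_ge0.
rewrite rmorphD /= scalerDl opprD addrACA.
by apply: le_trans (nD _ _) _; exact: lerD.
Qed.

Lemma cposZ (r : R) h : 0 <= r -> cpos h -> cpos (r *~: h).
Proof.
move=> r0 [sh [s s0 hs]]; split; first by rewrite cstZr sh.
exists (r * s); first exact: mulr_ge0.
by rewrite rmorphM /= -scalerA -scalerBr cnrmZr ger0_norm// ler_wpM2l.
Qed.

Lemma cpos_sqrt h : cpos h -> exists k, [/\ cpos k, k * k = h &
  forall z, z * h = h * z -> z * k = k * z].
Proof.
(* The radius is enlarged to be nonzero. Then h = t (1 - x) with |x| <= 1, and the root of h is the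
   square root of t times the root of 1 - x. *)
move=> [sh [s s0 hs]]; pose t := s + 1.
have t0 : 0 < t by rewrite /t; lra.
have {hs} ht : nrm (t *~: 1 - h) <= t by apply: cposW hs; rewrite /t; lra.
pose x := 1 - t^-1 *~: h.
have xE : x = t^-1 *~: (t *~: 1 - h).
  by rewrite scalerBr scalerA -rmorphM mulVf ?gt_eqF//= scale1r.
have [||y [sy y1 yy cy]] := @sqrt1B x.
- by rewrite cstB cst1 cstZr sh.
- by rewrite xE cnrmZr gtr0_norm ?invr_gt0// mulrC ler_pdivrMr// mul1r.
have rr : Num.sqrt t * Num.sqrt t = t by rewrite -expr2 sqr_sqrtr ?ltW.
exists (Num.sqrt t *~: (1 - y)); split.
- split; first by rewrite cstZr cstB cst1 sy.
  exists (Num.sqrt t); first exact: sqrtr_ge0.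
  by rewrite -scalerBr subKr cnrmZr ger0_norm ?sqrtr_ge0// ler_piMr ?sqrtr_ge0.
- rewrite -scalerAr -scalerAl scalerA -rmorphM rr.
  rewrite mulrBr !mulrBl !mulr1 !mul1r.
  rewrite (_ : 1 - y - (y - y * y) = 1 - (y + y - y * y)); last first.
    by rewrite !opprD !opprK !addrA.
  rewrite yy /x subKr scalerA -rmorphM divff ?gt_eqF//=.
  by rewrite scale1r.
- move=> z zh; rewrite -scalerAr -scalerAl; congr (_ *: _).
  rewrite mulrBr mulrBl mulr1 mul1r cy// /x mulrBr mulrBl mulr1 mul1r.
  by rewrite -scalerAr -scalerAl zh.
Qed.

(** For x = k^2 / t the root l of 1 - x commutes with k, and l^2 + x = 1; [cnrm_sq_addsq] then gives
    |1 - x| <= |1|. *)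
Lemma cpos_sq_bound k (t : R) : st k = k -> 0 <= t -> nrm (k * k) <= t ->
  nrm (t *~: 1 - k * k) <= t.
Proof.
move=> sk t0 kt; have [t_0|t_n0] := eqVneq t 0.
  move: kt; rewrite t_0 => kt; have /(cnrm_eq0 HU)-> : nrm (k * k) = 0.
    by apply/eqP; rewrite eq_le kt cnrm_ge0.
  by rewrite scale0r subr0 cnrm0.
have {t0}t_n0 : 0 < t by rewrite lt_def t_n0.
have t_0 := gt_eqF t_n0.
pose x := t^-1 *~: (k * k).
have [||y [sy y1 yy cy]] := @sqrt1B x.
- by rewrite cstZr stM sk.
- by rewrite cnrmZr gtr0_norm ?invr_gt0// mulrC ler_pdivrMr// mul1r.
pose l := 1 - y; have sl : st l = l by rewrite cstB cst1 sy.
have ll : l * l = 1 - x.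
  by rewrite /l mulrBr !mulrBl !mulr1 !mul1r -yy !opprD !opprK !addrA.
pose k' := (Num.sqrt t)^-1 *~: k.
have kk : k' * k' = x.
  rewrite /k' -scalerAr -scalerAl scalerA -rmorphM /=.
  by rewrite -invfM -expr2 sqr_sqrtr ?ltW.
have kl : l * k' = k' * l.
  rewrite /k' -scalerAr -scalerAl; congr (_ *: _).
  rewrite /l mulrBr mulrBl mulr1 mul1r cy// /x -scalerAr -scalerAl.
  by rewrite mulrA.
have : nrm (l * l) <= nrm 1.
  rewrite -(subrK x 1) -ll -kk; apply: cnrm_sq_addsq => //.
  by rewrite /k' cstZr sk.
have -> : t *~: 1 - k * k = t *~: (1 - x).
  by rewrite /x scalerBr scalerA -rmorphM divff ?t_0//= scale1r.
rewrite cnrmZr gtr0_norm// ll => h.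
by rewrite ler_piMr ?(ltW t_n0)//; apply: le_trans h cnrm1.
Qed.

Lemma cpos_sq k : st k = k -> cpos (k * k).
Proof.
move=> sk; split; first by rewrite stM sk.
by exists (nrm (k * k)); [exact: cnrm_ge0 | exact: cpos_sq_bound (cnrm_ge0 _) _].
Qed.

(** The existential radius in [cpos] may thus be any bound of the norm, since a positive element is
    a square. *)
Lemma cpos_bound h (t : R) : cpos h -> nrm h <= t -> nrm (t *~: 1 - h) <= t.
Proof.
move=> /cpos_sqrt[k [[sk _] <- _]] kt.
by apply: cpos_sq_bound => //; apply: le_trans kt; exact: cnrm_ge0.
Qed.

(** The square roots commute as well, so the product is the square of their product. *)
Lemma cposM h k : cpos h -> cpos k -> h * k = k * h -> cpos (h * k).
Proof.
move=> /cpos_sqrt[p [[sp _] ph cp]] /cpos_sqrt[q [[sq _] qk cq]] hk.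
have pk : p * k = k * p by rewrite cp.
have pq : p * q = q * p by rewrite cq.
have -> : h * k = (p * q) * (p * q) by rewrite -ph -qk -!mulrA; congr (p * _); rewrite !mulrA pq.
by apply: cpos_sq; rewrite stM sp sq.
Qed.

(** For commuting elements this is [cnrm_sq_addsq] applied to the roots. In general put r = |h + k|:
    then r - h = (r - (h + k)) + k is positive and commutes with h, so |h| <= |h + (r - h)| <= r. *)
Lemma cnrm_posD h k : cpos h -> cpos k -> nrm h <= nrm (h + k).
Proof.
have comm h' k' : cpos h' -> cpos k' -> h' * k' = k' * h' ->
    nrm h' <= nrm (h' + k').
  move=> /cpos_sqrt[p [[sp _] ph cp]] /cpos_sqrt[q [[sq _] qk cq]] hk.
  by rewrite -ph -qk; apply: cnrm_sq_addsq => //; rewrite cq// cp.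
move=> ph pk; set r := nrm (h + k).
have r0 : 0 <= r by exact: cnrm_ge0.
have [shk _] := cposD ph pk.
have prhk : cpos (r *~: 1 - (h + k)).
  by split; [rewrite cstB shk cstZr cst1 | exists r; rewrite ?subKr].
have prh : cpos (r *~: 1 - h).
  have -> : r *~: 1 - h = r *~: 1 - (h + k) + k by rewrite opprD addrA subrK.
  exact: cposD.
apply: le_trans (comm _ _ ph prh _) _.
  by rewrite mulrBr mulrBl -scalerAr -scalerAl mulr1 mul1r.
rewrite addrC subrK cnrmZr ger0_norm// ler_piMr//.
exact: cnrm1.
Qed.

(* Fukamiya and Kaplansky: with [h = a* a], [m = |h|] and [n = m - h] one has
   [h n = - m n], so that [x = a n] satisfies [x* x = - s s]; since
   [x* x + x x*] is positive so is [x x*], which forces [x = 0]. *)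
Lemma cpos_st_mul a : cpos (st a * a).
Proof.
set h := st a * a; have sh : st h = h by rewrite /h stM stK.
have [m [pm mm cm]] := cpos_sqrt (cpos_sq sh).
have mh : m * h = h * m by rewrite cm// mulrA.
have sm := pm.1.
pose n := m - h; have sn : st n = n by rewrite cstB sm sh.
have hn : h * n = - (m * n) by rewrite /n !mulrBr mm mh opprB.
have [p [[sp _] pp cp]] := cpos_sqrt pm.
have hp : h * p = p * h by apply: cp.
have np : n * p = p * n.
  by rewrite /n mulrBl mulrBr -pp mulrA hp.
pose s := p * n; have ss : st s = s by rewrite stM sp sn.
pose x := a * n.
have xx : st x * x = - (s * s).
  rewrite /x stM sn mulrA -[n * st a * a]mulrA -/h -mulrA hn mulrN -pp /s.
  by rewrite !mulrA np.
have px : cpos (x * st x).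
  have sxx : st (st x * x) = st x * x by rewrite stM stK.
  pose i : R[i] := 'i%R.
  have ci : i^* = - i by rewrite /i conjCi.
  have ii : i * i = -1 by rewrite -expr2 sqrCi.
  (* The squares of these self-adjoint elements add up to 2 (x x* + x* x); adding s^2 = - x* x to
     half of that leaves x x*. *)
  pose re := x + st x; pose im := i *: (x - st x).
  have sre : st re = re by rewrite cstD stK addrC.
  have sim : st im = im by rewrite cstZ ci cstB stK scaleNr -scalerN opprB.
  have e : re * re + im * im = 2 *~: (x * st x + st x * x).
    rewrite /im -scalerAr -scalerAl scalerA ii scaleN1r /re.
    rewrite !(mulrDl, mulrDr) !(mulNr, mulrN) opprK !opprD !opprK.
    rewrite addrACA [X in X + _]addrACA [X in _ + X]addrACA !subrr add0r addr0.
    by rewrite addrACA -mulr2n -scaler_nat -(rmorph_nat (real_complex R)).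
  have : cpos (2^-1 *~: (re * re + im * im) + s * s).
    apply: cposD; last exact: cpos_sq.
    by apply: cposZ; [rewrite invr_ge0 | apply: cposD; exact: cpos_sq].
  by rewrite e scalerA -rmorphM mulVf ?pnatr_eq0//= scale1r xx subrK.
set z := x * st x in px; pose c := nrm z.
have cE : c = nrm (s * s).
  by rewrite /c /z -{1}(stK x) (cnrm_st HU) cnrm_stE -(cnrm_st HU) xx cnrmN.
have c0 : 0 <= c by exact: cnrm_ge0.
have ps2 : cpos (s * s) by exact: cpos_sq.
have key : nrm (s * s * (s * s) + (s * s * (s * s) + s * s * (c *~: 1 - s * s)))
    <= c * c.
  have -> : s * s * (s * s) + (s * s * (s * s) + s * s * (c *~: 1 - s * s)) =
      - (st x * (c *~: 1 - z) * x).
    rewrite mulrBr [X in _ + X]addrC subrK -scalerAr mulr1.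
    rewrite /z mulrBr mulrBl -scalerAr -scalerAl mulr1.
    have -> : st x * (x * st x) * x = (st x * x) * (st x * x) by rewrite !mulrA.
    by rewrite xx mulrNN scalerN opprD !opprK addrC.
  rewrite cnrmN; have hz := cpos_bound px (lexx c).
  have xc : nrm (st x) * nrm x = c.
    by rewrite cnrm_stE -expr2 -(cnrm_st HU) xx cnrmN cE.
  apply: le_trans (nM _ _) _.
  apply: le_trans (ler_wpM2r (cnrm_ge0 _) (nM _ _)) _.
  by rewrite mulrAC xc ler_wpM2l.
have c2 : nrm (s * s * (s * s)) = c * c.
  by rewrite cnrm_sq -?expr2 -?cE// stM ss.
have pc : cpos (s * s * (c *~: 1 - s * s)).
  apply: cposM => //; last by rewrite mulrBr mulrBl -scalerAr -scalerAl mulr1 mul1r.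
  split; first by rewrite cstB cstZr cst1 stM ss.
  by exists c => //; rewrite subKr cE.
have p4 : cpos (s * s * (s * s)) by apply: cpos_sq; rewrite stM ss.
have {key pc p4} cc : 2 * (c * c) <= c * c.
  apply: le_trans key; rewrite addrA.
  apply: le_trans (cnrm_posD (cposD p4 p4) pc).
  rewrite (_ : _ + _ = 2 *~: (s * s * (s * s))); last first.
    by rewrite -mulr2n -scaler_nat -(rmorph_nat (real_complex R)).
  by rewrite cnrmZr c2 normr_nat.
have {cc} cz : c = 0 by nra.
have x0 : x = 0.
  apply: (cnrm_eq0 HU); apply/eqP; rewrite -sqrf_eq0 -(cnrm_st HU) xx cnrmN -cE.
  by rewrite cz.
have hn0 : h * n = 0 by rewrite /h -mulrA -/x x0 mulr0.
have mn0 : m * n = 0 by apply/eqP; rewrite -oppr_eq0 -hn hn0.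
(* n is self-adjoint with n^2 = m n - h n = 0; then h = m, which is positive as a square root. *)
have : n = 0.
  apply: (cnrm_eq0 HU); apply/eqP; rewrite -sqrf_eq0 -cnrm_sq//.
  by rewrite {1}/n mulrBl mn0 hn0 subr0 cnrm0.
by move/subr0_eq <-.
Qed.

End CstarAlgebra.

(** * Adjointable operators on a Banach space with a pairing *)

Section Rnorm.
Variables (R : realType) (E : normedModType R[i]).
Implicit Types u v : E.

Lemma rnormE v : `|v| = (rnorm v)%:C.
Proof. by rewrite /rnorm RRe_real// ger0_real. Qed.

Lemma rnorm_ge0 v : 0 <= rnorm v.
Proof. by have := normr_ge0 v; rewrite rnormE lecR. Qed.

Lemma rnormD u v : rnorm (u + v) <= rnorm u + rnorm v.
Proof. by have := ler_normD u v; rewrite !rnormE -rmorphD lecR. Qed.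

Lemma rnormZ (k : R[i]) v : rnorm (k *: v) = complex.Re `|k| * rnorm v.
Proof.
have := normrZ k v; rewrite !rnormE => h.
suff: (rnorm (k *: v))%:C = (complex.Re `|k| * rnorm v)%:C by move/complexI.
by rewrite h rmorphM /= RRe_real// ger0_real.
Qed.

Lemma rnorm0 : rnorm (0 : E) = 0.
Proof. by rewrite /rnorm normr0. Qed.

Lemma rnorm_eq0 v : (rnorm v == 0) = (v == 0).
Proof. by rewrite -[RHS]normr_eq0 rnormE (inj_eq (@complexI R)). Qed.

Lemma rnormN v : rnorm (- v) = rnorm v.
Proof. by rewrite /rnorm normrN. Qed.

Lemma rnormB u v : rnorm (u - v) <= rnorm u + rnorm v.
Proof. by rewrite -(rnormN v) rnormD. Qed.

Lemma rnorm_distC u v : rnorm (u - v) = rnorm (v - u).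
Proof. by rewrite /rnorm distrC. Qed.

Lemma rnormZr (r : R) v : rnorm (r%:C *: v) = `|r| * rnorm v.
Proof. by rewrite rnormZ cnorm_real. Qed.

Lemma cabs_ge0 (k : R[i]) : 0 <= complex.Re `|k|.
Proof. by have := normr_ge0 k; rewrite -{1}[ `|k| ]RRe_real ?ger0_real// lecR. Qed.

Lemma cabsM (k l : R[i]) :
  complex.Re `|k * l| = complex.Re `|k| * complex.Re `|l|.
Proof.
apply: (@complexI R); rewrite rmorphM !RRe_real ?ger0_real//.
exact: normrM.
Qed.

Lemma rnorm_eps v : (forall e : R, 0 < e -> rnorm v <= e) -> v = 0.
Proof.
move=> h; apply/eqP; rewrite -rnorm_eq0 eq_le rnorm_ge0 andbT.
by apply/ler_addgt0Pl => e e0; rewrite addr0 h.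
Qed.

Lemma rnorm_cvgP (T : Type) (F : set_system T) (f : T -> E) v : Filter F ->
  (f @ F --> v) <-> (forall e : R, 0 < e -> \forall t \near F, rnorm (v - f t) < e).
Proof.
move=> FF; rewrite (@cvgrPdist_lt _ _ _ _ FF); split=> h e e0.
  have := h e%:C; rewrite ltcR => /(_ e0).
  by apply: filterS => t; rewrite rnormE ltcR.
(* Radii lie in [R[i]], where a positive element is real. *)
have [re ie] : 0 < complex.Re e /\ complex.Im e = 0.
  by move: e0; rewrite ltcE /= => /andP[/eqP -> ->].
have -> : e = (complex.Re e)%:C by case: (e) ie => a b /= ->.
have := h _ re.
by apply: filterS => t; rewrite rnormE ltcR.
Qed.

End Rnorm.

Lemma rnorm_complete (R : realType) (E : completeNormedModType R[i])
    (F : set_system E) : ProperFilter F ->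
  (forall e : R, 0 < e -> exists v, \forall w \near F, rnorm (v - w) < e) ->
  cvg F.
Proof.
move=> FF h; apply: cauchy_cvg; apply: cauchy_exP => e e0.
have [re ie] : 0 < complex.Re e /\ complex.Im e = 0.
  by move: e0; rewrite ltcE /= => /andP[/eqP -> ->].
have [v hv] := h _ re; exists v.
rewrite -ball_normE; apply: filterS hv => w /=.
rewrite rnormE; have -> : e = (complex.Re e)%:C by case: (e) ie => a b /= ->.
by rewrite ltcR.
Qed.

Lemma rnorm_complete_seq (R : realType) (E : completeNormedModType R[i])
    (u : nat -> E) (c : R) : 0 <= c ->
  (forall m n, (n <= m)%N -> rnorm (u m - u n) <= c * rate R n) ->
  exists l, forall n, rnorm (u n - l) <= c * rate R n.
Proof.
move=> c0 h.
have small e : 0 < e -> exists n, c * rate R n < e.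
  move=> e0; have c1 : 0 < c + 1 by lra.
  have [n hn] := rate_small (divr_gt0 e0 c1); exists n.
  move: hn; rewrite ltr_pdivlMr// mulrC; have := rate_gt0 R n; nra.
have /rnorm_complete cv : ProperFilter (u @ \oo) by apply: fmap_proper_filter.
have [|l hl] := (cvg_ex _).1 (cv _).
  move=> e e0; have [n hn] := small e e0; exists (u n).
  exists n => // m /= nm; rewrite rnorm_distC.
  by apply: le_lt_trans hn; exact: h.
exists l => n; apply/ler_addgt0Pl => e e0.
have [N _ hN] := (rnorm_cvgP _ _ _).1 hl e e0.
have := hN _ (leq_maxl N n); have := h _ _ (leq_maxr N n).
set m := maxn N n; rewrite (rnorm_distC l) => h1 /= h2.
rewrite -(subrK (u m) (u n)) -addrA; apply: le_trans (rnormD _ _) _.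
by rewrite rnorm_distC; lra.
Qed.

(* A Banach space with a sesquilinear pairing satisfying the Cauchy-Schwarz
   inequality; fibres of a Fell bundle, with [u* v] as pairing, are instances. *)
Record pairing (R : realType) := Pairing {
  pE :> completeNormedModType R[i];
  pA : normedModType R[i];
  pst : pA -> pA;
  pr : pE -> pE -> pA;
  prDZr : forall e (k : R[i]) f g, pr e (k *: f + g) = k *: pr e f + pr e g;
  prDZl : forall (k : R[i]) e f g, pr (k *: e + f) g = k^* *: pr e g + pr f g;
  pr_st : forall e f, pr f e = pst (pr e f);
  pr_bnd : forall e f, rnorm (pr e f) <= rnorm e * rnorm f;
  pr_sq : forall e, rnorm (pr e e) = rnorm e ^+ 2;
  (* the library's algebras, hence that of operators on [pE], are nonzero *)
  pr_nz : exists e : pE, e != 0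
}.

Section PairingTheory.
Variables (R : realType) (E : pairing R).
Implicit Types e f g : E.

Lemma pr0l f : pr 0 f = 0.
Proof.
have := prDZl 1 0 0 f; rewrite scale1r addr0 conjC1 scale1r => /eqP.
by rewrite -subr_eq0 opprD addNKr oppr_eq0 => /eqP.
Qed.
Lemma pr0r f : pr f 0 = 0.
Proof.
have := prDZr f 1 0 0; rewrite scale1r addr0 scale1r => /eqP.
by rewrite -subr_eq0 opprD addNKr oppr_eq0 => /eqP.
Qed.
Lemma prDl e f g : pr (e + f) g = pr e g + pr f g.
Proof. by have := prDZl 1 e f g; rewrite conjC1 !scale1r. Qed.
Lemma prDr e f g : pr g (e + f) = pr g e + pr g f.
Proof. by have := prDZr g 1 e f; rewrite !scale1r. Qed.
Lemma prZl k e g : pr (k *: e) g = k^* *: pr e g.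
Proof. by have := prDZl k e 0 g; rewrite addr0 pr0l addr0. Qed.
Lemma prZr k e g : pr g (k *: e) = k *: pr g e.
Proof. by have := prDZr g k e 0; rewrite addr0 pr0r addr0. Qed.
Lemma prNl e g : pr (- e) g = - pr e g.
Proof. by rewrite -scaleN1r prZl rmorphN1 scaleN1r. Qed.
Lemma prNr e g : pr g (- e) = - pr g e.
Proof. by rewrite -scaleN1r prZr scaleN1r. Qed.

Lemma pr_injl e f : (forall g, pr e g = pr f g) -> e = f.
Proof.
move=> h; apply/subr0_eq/eqP; rewrite -rnorm_eq0 -sqrf_eq0 -pr_sq.
by rewrite prDl prNl h subrr rnorm0.
Qed.

Lemma pr_injr e f : (forall g, pr g e = pr g f) -> e = f.
Proof. by move=> h; apply: pr_injl => g; rewrite pr_st h -pr_st. Qed.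

End PairingTheory.

(** The adjoint is stored as data but is determined by the operator ([adjop_eq]), and linearity is
    derived from it ([aop_lin]). *)
Record adjop (R : realType) (E : pairing R) := AdjOp {
  aop :> E -> E;
  aadj : E -> E;
  aadjP : forall e f, pr (aop e) f = pr e (aadj f);
  aop_bnd : exists M : R, forall e, rnorm (aop e) <= M * rnorm e
}.

Section AdjOp.
Variables (R : realType) (E : pairing R).
Implicit Types T S : adjop E.

Lemma adjop_eq T S : aop T =1 aop S -> T = S.
Proof.
case: T S => t t' tP tb [s s' sP sb] /= h.
have e1 : t = s by apply/funext.
subst s; have e2 : t' = s'.
  by apply/funext => f; apply: pr_injr => e; rewrite -tP -sP.
by subst s'; congr AdjOp; exact: Prop_irrelevance.
Qed.

Lemma aadjPl T e f : pr (aadj T e) f = pr e (T f).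
Proof. by rewrite pr_st -aadjP -pr_st. Qed.

Lemma aop_lin T k e f : T (k *: e + f) = k *: T e + T f.
Proof. by apply: pr_injl => g; rewrite aadjP !prDl !prZl !aadjP. Qed.

Lemma aop_zero T : T 0 = 0.
Proof. by apply: pr_injl => g; rewrite aadjP !pr0l. Qed.

Lemma aop_bndP T : exists2 M : R, 0 <= M & forall e, rnorm (T e) <= M * rnorm e.
Proof.
have [M hM] := aop_bnd T; exists `|M| => // e.
by apply: le_trans (hM e) _; rewrite ler_wpM2r ?rnorm_ge0// ler_norm.
Qed.

(** |T* e|^2 = |<e, T T* e>| <= |e| M |T* e|, and one factor |T* e| cancels. *)
Lemma aadj_bnd T M : 0 <= M -> (forall e, rnorm (T e) <= M * rnorm e) ->
  forall e, rnorm (aadj T e) <= M * rnorm e.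
Proof.
move=> M0 hM e; have [z|z] := eqVneq (rnorm (aadj T e)) 0.
  by rewrite z mulr_ge0// rnorm_ge0.
have zp : 0 < rnorm (aadj T e) by rewrite lt_def z rnorm_ge0.
rewrite -(ler_pM2r zp) -expr2 -pr_sq aadjPl pr_st -pr_st.
apply: le_trans (pr_bnd _ _) _; rewrite mulrC -mulrA [_ * rnorm (aadj _ _)]mulrC mulrA.
by rewrite ler_wpM2r// rnorm_ge0.
Qed.

Definition aop0 : adjop E.
refine (@AdjOp _ E (fun=> 0) (fun=> 0) _ _).
- by move=> e f; rewrite pr0l pr0r.
- by exists 0 => e; rewrite mul0r rnorm0.
Defined.

Definition aop1 : adjop E.
refine (@AdjOp _ E id id _ _) => //.
by exists 1 => e; rewrite mul1r.
Defined.

Definition aopZD (k : R[i]) T S : adjop E.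
refine (@AdjOp _ E (fun e => k *: T e + S e) (fun e => k^* *: aadj T e + aadj S e) _ _).
- by move=> e f; rewrite prDl prDr prZl prZr !aadjP.
- have [M M0 hM] := aop_bndP T; have [N N0 hN] := aop_bndP S.
  exists (complex.Re `|k| * M + N) => e.
  apply: le_trans (rnormD _ _) _; rewrite rnormZ mulrDl -mulrA lerD//.
  by rewrite ler_wpM2l// cabs_ge0.
Defined.

Definition aopM T S : adjop E.
refine (@AdjOp _ E (fun e => T (S e)) (fun e => aadj S (aadj T e)) _ _).
- by move=> e f; rewrite !aadjP.
- have [M M0 hM] := aop_bndP T; have [N N0 hN] := aop_bndP S.
  exists (M * N) => e.
  by apply: le_trans (hM _) _; rewrite -mulrA ler_wpM2l.
Defined.

Definition aop_st T : adjop E.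
refine (@AdjOp _ E (aadj T) T _ _).
- exact: aadjPl.
- by have [M M0 hM] := aop_bndP T; exists M; exact: aadj_bnd.
Defined.

End AdjOp.

HB.instance Definition _ (R : realType) (E : pairing R) := gen_eqMixin (adjop E).
HB.instance Definition _ (R : realType) (E : pairing R) := gen_choiceMixin (adjop E).

Section AdjOpRing.
Variables (R : realType) (E : pairing R).
Implicit Types T S : adjop E.

Let add T S := aopZD 1 T S.
Let opp T := aopZD (-1) T (aop0 E).
Let scale k T := aopZD k T (aop0 E).

Fact aop_addA : associative add.
Proof. by move=> *; apply: adjop_eq => e /=; rewrite !scale1r addrA. Qed.
Fact aop_addC : commutative add.
Proof. by move=> *; apply: adjop_eq => e /=; rewrite !scale1r addrC. Qed.
Fact aop_add0 : left_id (aop0 E) add.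
Proof. by move=> *; apply: adjop_eq => e /=; rewrite !scale1r add0r. Qed.
Fact aop_addN : left_inverse (aop0 E) opp add.
Proof. by move=> *; apply: adjop_eq => e /=; rewrite !scale1r addr0 scaleN1r addNr. Qed.

HB.instance Definition _ := GRing.isZmodule.Build (adjop E)
  aop_addA aop_addC aop_add0 aop_addN.

Lemma aopDE T S e : (T + S) e = T e + S e.
Proof. by rewrite -[LHS]/(1 *: T e + S e) scale1r. Qed.

Fact aop_mulA : associative (@aopM R E).
Proof. by move=> *; apply: adjop_eq. Qed.
Fact aop_mul1 : left_id (aop1 E) (@aopM R E).
Proof. by move=> *; apply: adjop_eq. Qed.
Fact aop_mulr1 : right_id (aop1 E) (@aopM R E).
Proof. by move=> *; apply: adjop_eq. Qed.
Fact aop_mulDl : left_distributive (@aopM R E) +%R.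
Proof. by move=> T S V; apply: adjop_eq => e; rewrite /= !scale1r. Qed.
Fact aop_mulDr : right_distributive (@aopM R E) +%R.
Proof.
by move=> T S V; apply: adjop_eq => e; rewrite /= !scale1r -{1}[S e]scale1r aop_lin scale1r.
Qed.

Fact aop_nz : aop1 E != 0.
Proof.
have [e e0] := pr_nz E; apply/eqP => h; move: e0.
by rewrite (_ : e = aop1 E e)// h eqxx.
Qed.

HB.instance Definition _ := GRing.Zmodule_isNzRing.Build (adjop E)
  aop_mulA aop_mul1 aop_mulr1 aop_mulDl aop_mulDr aop_nz.

Fact aop_scaleA k l T : scale k (scale l T) = scale (k * l) T.
Proof. by apply: adjop_eq => e /=; rewrite !addr0 scalerA. Qed.
Fact aop_scale1 : left_id 1 scale.
Proof. by move=> T; apply: adjop_eq => e /=; rewrite addr0 scale1r. Qed.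
Fact aop_scaleDr : right_distributive scale +%R.
Proof.
move=> k T S; apply: adjop_eq => e.
by rewrite /= !addr0 !scale1r scalerDr.
Qed.
Fact aop_scaleDl T : {morph scale^~ T : k l / k + l}.
Proof. by move=> k l; apply: adjop_eq => e /=; rewrite !addr0 !scale1r scalerDl. Qed.

HB.instance Definition _ := GRing.Zmodule_isLmodule.Build R[i] (adjop E)
  aop_scaleA aop_scale1 aop_scaleDr aop_scaleDl.

Lemma aopZE k T e : (k *: T) e = k *: T e.
Proof. by rewrite -[LHS]/(k *: T e + 0) addr0. Qed.

Fact aop_scaleAl k T S : k *: (T * S) = (k *: T) * S.
Proof. by apply: adjop_eq => e; rewrite aopZE -[RHS]/((k *: T) (S e)) aopZE. Qed.
HB.instance Definition _ := GRing.Lmodule_isLalgebra.Build R[i] (adjop E)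
  aop_scaleAl.
Fact aop_scaleAr k T S : k *: (T * S) = T * (k *: S).
Proof.
apply: adjop_eq => e; rewrite aopZE -[RHS]/(T ((k *: S) e)) aopZE.
by rewrite -[k *: S e]addr0 aop_lin aop_zero addr0.
Qed.
HB.instance Definition _ := GRing.Lalgebra_isAlgebra.Build R[i] (adjop E)
  aop_scaleAr.

Lemma aopME T S e : (T * S) e = T (S e). Proof. by []. Qed.
Lemma aop_stE T e : aop_st T e = aadj T e. Proof. by []. Qed.
Lemma aop0E e : (0 : adjop E) e = 0. Proof. by []. Qed.
Lemma aopNE T e : (- T) e = - T e.
Proof. by rewrite -scaleN1r aopZE scaleN1r. Qed.
Lemma aopBE T S e : (T - S) e = T e - S e.
Proof. by rewrite aopDE aopNE. Qed.

Definition anrm T : R := sup [set rnorm (T e) | e in [set e : E | rnorm e <= 1]].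

Lemma anrm_le T M : 0 <= M -> (forall e, rnorm (T e) <= M * rnorm e) -> anrm T <= M.
Proof.
move=> M0 hM; apply: ge_sup; first by exists (rnorm (T 0)), 0 => //=; rewrite rnorm0.
move=> _ [e /= e1 <-]; apply: le_trans (hM e) _.
by rewrite ler_piMr.
Qed.

Lemma anrmP T e : rnorm (T e) <= anrm T * rnorm e.
Proof.
have [/eqP z|z] := eqVneq (rnorm e) 0.
  by move: z; rewrite rnorm_eq0 => /eqP->; rewrite aop_zero rnorm0 mulr0.
have zp : 0 < rnorm e by rewrite lt_def z rnorm_ge0.
rewrite -ler_pdivrMr//.
have -> : rnorm (T e) / rnorm e = rnorm (T ((rnorm e)^-1%:C *: e)).
  rewrite -[_ *: e]addr0 aop_lin aop_zero addr0 rnormZr ger0_norm ?invr_ge0 ?rnorm_ge0//.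
  by rewrite mulrC.
apply: ub_le_sup.
  have [M M0 hM] := aop_bndP T; exists M => _ [f /= f1 <-].
  by apply: le_trans (hM f) _; rewrite ler_piMr.
exists ((rnorm e)^-1%:C *: e) => //=.
by rewrite rnormZr ger0_norm ?invr_ge0 ?rnorm_ge0// mulVf.
Qed.

Lemma anrm_ge0 T : 0 <= anrm T.
Proof.
have h := anrmP T.
have [|nz] := pselect (exists e : E, 0 < rnorm e).
  case=> e e0; have := le_trans (rnorm_ge0 _) (h e).
  by rewrite pmulr_lge0.
rewrite (_ : anrm T = 0)// /anrm.
rewrite (_ : [set _ | _ in _] = [set 0]) ?sup1//.
have z (e : E) : rnorm e = 0.
  by apply/eqP; rewrite eq_le rnorm_ge0 andbT leNgt; apply/negP => e0; apply: nz; exists e.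
apply/seteqP; split=> [_ [e _ <-]|_ ->] /=; first exact: z.
by exists 0; rewrite /= z.
Qed.

(** The C*-identity comes from |T e|^2 = |<e, T* T e>| <= |T* T| |e|^2. For completeness, the
    operators and their adjoints converge on each vector, and continuity of the pairing makes the
    two limits adjoint to each other. *)
Lemma adjop_cstar : cstar_algebra_axioms (@aop_st R E) anrm.
Proof.
split.
- move=> k T S; apply: adjop_eq => e.
  apply: pr_injl => g; rewrite aopDE aopZE !aop_stE.
  by rewrite aadjPl aopDE aopZE prDr prZr prDl prZl conjCK !aadjPl.
- by move=> T S; apply: adjop_eq.
- by move=> T; apply: adjop_eq.
- move=> T S; apply: anrm_le => [|e]; first by rewrite addr_ge0 ?anrm_ge0.
  rewrite aopDE mulrDl; apply: le_trans (rnormD _ _) _.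
  by rewrite lerD// anrmP.
- have le k T : anrm (k *: T) <= complex.Re `|k| * anrm T.
    apply: anrm_le => [|e]; first by rewrite mulr_ge0 ?cabs_ge0 ?anrm_ge0.
    by rewrite aopZE rnormZ -mulrA ler_wpM2l ?cabs_ge0// anrmP.
  move=> k T; apply/eqP; rewrite eq_le le andTb.
  have [->|k0] := eqVneq k 0; first by rewrite normr0 mul0r anrm_ge0.
  have kp : 0 < complex.Re `|k|.
    by have := normr_gt0 k; rewrite k0 -{1}[ `|k| ]RRe_real ?ger0_real// ltcR.
  rewrite -ler_pdivlMl//; apply: le_trans (le_trans (le k^-1 (k *: T)) _).
    by rewrite scalerA mulVf// scale1r.
  rewrite ler_wpM2r ?anrm_ge0// -(ler_pM2r kp) mulVf ?gt_eqF//.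
  by rewrite -cabsM mulVf// normr1.
- move=> T S; apply: anrm_le => [|e]; first by rewrite mulr_ge0 ?anrm_ge0.
  rewrite aopME -mulrA; apply: le_trans (anrmP _ _) _.
  by rewrite ler_wpM2l ?anrm_ge0// anrmP.
- move=> T; apply/eqP; rewrite eq_le; apply/andP; split.
    apply: anrm_le => [|e]; first by rewrite exprn_ge0 ?anrm_ge0.
    rewrite aopME /= expr2 -mulrA; apply: le_trans (aadj_bnd (anrm_ge0 T) (anrmP T) _) _.
    by rewrite ler_wpM2l ?anrm_ge0// anrmP.
  have n0 := anrm_ge0 (aop_st T * T).
  rewrite -[leRHS](sqr_sqrtr n0) ler_pXn2r ?nnegrE ?sqrtr_ge0 ?anrm_ge0//.
  apply: anrm_le => [|e]; first exact: sqrtr_ge0.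
  rewrite -(@ler_pXn2r _ 2)// ?nnegrE ?mulr_ge0 ?sqrtr_ge0 ?rnorm_ge0//.
  rewrite exprMn sqr_sqrtr// -pr_sq aadjP.
  apply: le_trans (pr_bnd _ _) _.
  have := anrmP (aop_st T * T) e; rewrite aopME /=.
  by have := rnorm_ge0 e; nra.
- move=> T T0; apply: adjop_eq => e; rewrite aop0E; apply/eqP.
  by rewrite -rnorm_eq0 eq_le rnorm_ge0 andbT; have := anrmP T e; rewrite T0 mul0r.
- move=> w hw.
  have he e m n : (n <= m)%N -> rnorm (w m e - w n e) <= rnorm e * rate R n.
    move=> nm; rewrite -aopBE mulrC; apply: le_trans (anrmP _ _) _.
    by rewrite ler_wpM2r ?rnorm_ge0// hw.
  have hf e m n : (n <= m)%N -> rnorm (aadj (w m) e - aadj (w n) e) <= rnorm e * rate R n.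
    move=> nm; have -> : aadj (w m) e - aadj (w n) e = aadj (w m - w n) e.
      apply: pr_injl => f; rewrite aadjPl aopBE prDr prNr prDl prNl.
      by rewrite !aadjPl.
    apply: le_trans (aadj_bnd (anrm_ge0 _) (anrmP _) _) _.
    by rewrite mulrC ler_wpM2l ?rnorm_ge0// hw.
  have /choice[l hl] := fun e => rnorm_complete_seq (rnorm_ge0 e) (he e).
  have /choice[l' hl'] := fun e => rnorm_complete_seq (rnorm_ge0 e) (hf e).
  have adj e f : pr (l e) f = pr e (l' f).
    apply/subr0_eq/eqP; rewrite -rnorm_eq0 eq_le rnorm_ge0 andbT.
    (* Each of the two error terms is at most |e| |f| [rate n]. *)
    apply: (@le0_rate _ _ (2 * (rnorm e * rnorm f))) => n.
    have -> : pr (l e) f - pr e (l' f) =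
        pr e (aadj (w n) f - l' f) - pr (w n e - l e) f.
      by rewrite prDr prDl prNr prNl -aadjP opprB [RHS]addrC subrKA.
    apply: le_trans (rnormB _ _) _.
    have h1 := pr_bnd e (aadj (w n) f - l' f).
    have h2 := pr_bnd (w n e - l e) f.
    have := hl e n; have := hl' f n; have := rnorm_ge0 e; have := rnorm_ge0 f.
    nra.
  have bnd : exists M, forall e, rnorm (l e) <= M * rnorm e.
    exists (rate R 0 + anrm (w 0%N)) => e.
    have := hl e 0%N; have := anrmP (w 0%N) e; rewrite rnorm_distC.
    have := rnormD (l e - w 0%N e) (w 0%N e); rewrite subrK; lra.
  exists (AdjOp adj bnd) => n; apply: anrm_le => [|e]; first exact: ltW (rate_gt0 _ _).
  by rewrite aopBE mulrC; exact: hl.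
Qed.

End AdjOpRing.

(** * Etale groupoids and fibres of a Fell bundle *)

Section GroupoidTheory.
Variable G : etale_groupoid.
Let HG := etale_is_groupoid G.
Local Notation s := (src G).
Local Notation r := (rng G).
Local Notation inv := (ginv G).
Local Notation mul := (gmul G).
Implicit Types a b g x : G.

Lemma invgK g : inv (inv g) = g. Proof. exact: ginvK HG g. Qed.
Lemma src_inv g : s (inv g) = r g. Proof. by rewrite /src invgK. Qed.
Lemma rng_inv g : r (inv g) = s g. Proof. by rewrite /rng invgK. Qed.
Lemma comp_invl g : composable G (inv g) g. Proof. exact: src_inv. Qed.
Lemma comp_invr g : composable G g (inv g). Proof. by rewrite /composable rng_inv. Qed.
Lemma src_src g : s (s g) = s g. Proof. exact (src_gmul HG (comp_invl g)). Qed.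
Lemma rng_src g : r (s g) = s g.
Proof. by rewrite -[RHS]rng_inv; exact (rng_gmul HG (comp_invl g)). Qed.
Lemma src_rng g : s (r g) = r g. Proof. by rewrite -src_inv src_src. Qed.
Lemma unitsP x : units G x <-> s x = x.
Proof. by split=> [[g _ <-]|<-]; [exact: src_src | exists x]. Qed.

Lemma unit_rng x : s x = x -> r x = x. Proof. by move=> <-; exact: rng_src. Qed.
Lemma unit_inv x : s x = x -> inv x = x.
Proof.
by move=> sx; rewrite -[LHS](gmul_src HG) src_inv unit_rng//.
Qed.

Lemma mulKg a b : r a = r b -> mul a (mul (inv a) b) = b.
Proof.
move=> h; have c : composable G (inv a) b by rewrite /composable src_inv.
by rewrite -(gmulA HG (comp_invr a) c) -/(rng G a) h (gmul_rng HG).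
Qed.

Lemma mulVKg a b : composable G a b -> mul (inv a) (mul a b) = b.
Proof. by move=> h; rewrite -{2}[a]invgK mulKg// rng_inv. Qed.

Lemma mulgK a b : composable G a b -> mul (mul a b) (inv b) = a.
Proof.
move=> h; rewrite (gmulA HG h (comp_invr b)) -/(rng G b) -h.
exact: (gmul_src HG a).
Qed.

Lemma mulgVK a b : s a = s b -> mul (mul a (inv b)) b = a.
Proof. by move=> h; rewrite -{2}[b]invgK mulgK// /composable rng_inv. Qed.

(** The unit on the left of (a b)^-1 is s b, which factors as (b^-1 a^-1)(a b); then a b cancels
    against its inverse. *)
Lemma inv_mul a b : composable G a b -> inv (mul a b) = mul (inv b) (inv a).
Proof.
move=> h; have ca : composable G (inv b) (inv a) by rewrite /composable src_inv rng_inv.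
have sab := src_gmul HG h; have rab := rng_gmul HG h.
rewrite -[LHS](gmul_rng HG) rng_inv sab.
have -> : s b = mul (mul (inv b) (inv a)) (mul a b).
  by rewrite (gmulA HG)// ?mulVKg// /composable src_inv rab.
by rewrite mulgK// /composable (src_gmul HG)// src_inv rab.
Qed.

Lemma src_div a b : s a = s b -> s (mul a (inv b)) = r b.
Proof. by move=> h; rewrite (src_gmul HG) ?src_inv// /composable rng_inv. Qed.
Lemma rng_div a b : s a = s b -> r (mul a (inv b)) = r a.
Proof. by move=> h; rewrite (rng_gmul HG)// /composable rng_inv. Qed.
Lemma comp_div a b : s a = s b -> composable G (mul a (inv b)) b.
Proof. exact: src_div. Qed.
Lemma inv_div a b : s a = s b -> inv (mul a (inv b)) = mul b (inv a).
Proof. by move=> h; rewrite inv_mul ?invgK// /composable rng_inv. Qed.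

Lemma src_ldiv a b : r a = r b -> s (mul (inv a) b) = s b.
Proof. by move=> h; rewrite (src_gmul HG)// /composable src_inv. Qed.
Lemma rng_ldiv a b : r a = r b -> r (mul (inv a) b) = s a.
Proof. by move=> h; rewrite (rng_gmul HG) ?rng_inv// /composable src_inv. Qed.

End GroupoidTheory.

(** * Fibrewise product, involution and positivity *)

Section Fibres.
Variables (R : realType) (G : etale_groupoid) (B : fell_bundle R G).
Local Notation s := (src G).
Local Notation r := (rng G).
Local Notation inv := (ginv G).
Local Notation mul := (gmul G).
Local Notation fib := (fibre B).
Implicit Types (g h l k x y : G).

Let HG := etale_is_groupoid G.
Let HB := fellP B.
Let HBB := fell_is_banach HB.

Lemma proj_emb x (v : fib x) : proj (emb v) = x.
Proof. by have /seteqP[h _] := emb_range HBB x; apply: h; exists v. Qed.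

Lemma embK x (v : fib x) : coord x (emb v) = v.
Proof.
rewrite /coord; case: xgetP => [w _ /(emb_inj HBB)//|] /(_ v) h.
by case: h.
Qed.

Lemma coordK x (b : total_space B) : proj b = x -> emb (coord x b) = b.
Proof.
move=> pb; have /seteqP[_ h] := emb_range HBB x.
by have [v _ <-] := h b pb; rewrite embK.
Qed.

Lemma emb_eq x (u v : fib x) : emb u = emb v -> u = v.
Proof. by move/(emb_inj HBB). Qed.

Definition tnorm (b : total_space B) : R := rnorm (vec b).

Lemma tnormE x (b : total_space B) : proj b = x -> tnorm b = rnorm (coord x b).
Proof. by move=> <-. Qed.

Lemma tnorm_emb x (v : fib x) : tnorm (emb v) = rnorm v.
Proof. by rewrite (tnormE (proj_emb v)) embK. Qed.

(* Products and adjoints of fibre elements, with the fibre [k] of the result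
   given explicitly so that its index is only propositionally determined. *)
Definition mulf k g h (u : fib g) (v : fib h) : fib k :=
  coord k (fmul (emb u) (emb v)).
Definition starf k g (u : fib g) : fib k := coord k (fstar (emb u)).

Section Mulf.
Variables (k g h : G).
Hypotheses (cgh : composable G g h) (kE : k = mul g h).
Implicit Types (u : fib g) (v : fib h).

Lemma comp_emb u v : fcomposable (emb u) (emb v).
Proof. by rewrite /fcomposable !proj_emb. Qed.

Lemma emb_mulf u v : emb (mulf k u v) = fmul (emb u) (emb v).
Proof.
by rewrite /mulf coordK// (proj_fmul HB (comp_emb u v)) !proj_emb.
Qed.

Let bil := fmul_bilinear HB cgh.

Lemma mulfZDr (c : R[i]) u v w : mulf k u (c *: v + w) = c *: mulf k u v + mulf k u w.
Proof. by subst k; have [_] := bil; move/(_ u c v w). Qed.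
Lemma mulfZDl (c : R[i]) u w v : mulf k (c *: u + w) v = c *: mulf k u v + mulf k w v.
Proof. by subst k; have [b _] := bil; have := b v c u w. Qed.

Lemma mulf0r u : mulf k u (0 : fib h) = 0.
Proof.
have := mulfZDr 1 u 0 0; rewrite !scale1r addr0 => /eqP.
by rewrite -subr_eq0 opprD addNKr oppr_eq0 => /eqP.
Qed.
Lemma mulf0l v : mulf k (0 : fib g) v = 0.
Proof.
have := mulfZDl 1 0 0 v; rewrite !scale1r addr0 => /eqP.
by rewrite -subr_eq0 opprD addNKr oppr_eq0 => /eqP.
Qed.
Lemma mulfDr u v w : mulf k u (v + w) = mulf k u v + mulf k u w.
Proof. by have := mulfZDr 1 u v w; rewrite !scale1r. Qed.
Lemma mulfDl u w v : mulf k (u + w) v = mulf k u v + mulf k w v.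
Proof. by have := mulfZDl 1 u w v; rewrite !scale1r. Qed.
Lemma mulfZr (c : R[i]) u v : mulf k u (c *: v) = c *: mulf k u v.
Proof. by have := mulfZDr c u v 0; rewrite mulf0r !addr0. Qed.
Lemma mulfZl (c : R[i]) u v : mulf k (c *: u) v = c *: mulf k u v.
Proof. by have := mulfZDl c u 0 v; rewrite mulf0l !addr0. Qed.
Lemma mulfNr u v : mulf k u (- v) = - mulf k u v.
Proof. by rewrite -scaleN1r mulfZr scaleN1r. Qed.
Lemma mulfNl u v : mulf k (- u) v = - mulf k u v.
Proof. by rewrite -scaleN1r mulfZl scaleN1r. Qed.
Lemma mulf_suml (I : Type) (F : seq I) (u : I -> fib g) v :
  mulf k (\sum_(i <- F) u i) v = \sum_(i <- F) mulf k (u i) v.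
Proof.
elim: F => [|i F IH]; first by rewrite !big_nil mulf0l.
by rewrite !big_cons mulfDl IH.
Qed.
Lemma mulf_sumr (I : Type) (F : seq I) u (v : I -> fib h) :
  mulf k u (\sum_(i <- F) v i) = \sum_(i <- F) mulf k u (v i).
Proof.
elim: F => [|i F IH]; first by rewrite !big_nil mulf0r.
by rewrite !big_cons mulfDr IH.
Qed.

Lemma rnorm_mulf u v : rnorm (mulf k u v) <= rnorm u * rnorm v.
Proof. by rewrite -!tnorm_emb emb_mulf; exact (norm_fmul HB (comp_emb u v)). Qed.

End Mulf.

Section Starf.
Variables (k g : G).
Hypothesis kE : k = inv g.
Implicit Types u v : fib g.

Lemma emb_starf u : emb (starf k u) = fstar (emb u).
Proof. by rewrite /starf coordK// (proj_fstar HB) proj_emb. Qed.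

Lemma starfZD (c : R[i]) u v : starf k (c *: u + v) = c^* *: starf k u + starf k v.
Proof. by rewrite /starf kE (fstar_antilinear HB). Qed.
Lemma starf0 : starf k (0 : fib g) = 0.
Proof.
have := starfZD 1 0 0; rewrite scale1r addr0 conjC1 scale1r => /eqP.
by rewrite -subr_eq0 opprD addNKr oppr_eq0 => /eqP.
Qed.
Lemma starfD u v : starf k (u + v) = starf k u + starf k v.
Proof. by have := starfZD 1 u v; rewrite conjC1 !scale1r. Qed.
Lemma starfZ c u : starf k (c *: u) = c^* *: starf k u.
Proof. by have := starfZD c u 0; rewrite starf0 !addr0. Qed.
Lemma starfN u : starf k (- u) = - starf k u.
Proof. by rewrite -scaleN1r starfZ rmorphN1 scaleN1r. Qed.
Lemma starf_sum (I : Type) (F : seq I) (u : I -> fib g) :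
  starf k (\sum_(i <- F) u i) = \sum_(i <- F) starf k (u i).
Proof.
elim: F => [|i F IH]; first by rewrite !big_nil starf0.
by rewrite !big_cons starfD IH.
Qed.

End Starf.

Lemma starfK k g (u : fib g) : k = inv g -> starf g (starf k u) = u.
Proof.
move=> kE; apply: emb_eq; rewrite emb_starf; last by rewrite kE invgK.
by rewrite emb_starf// (fstarK HB).
Qed.

Lemma mulfA g h l gh hl k (u : fib g) (v : fib h) (w : fib l) :
  composable G g h -> composable G h l -> gh = mul g h -> hl = mul h l ->
  k = mul gh l -> mulf k (mulf gh u v) w = mulf k u (mulf hl v w).
Proof.
move=> c1 c2 e1 e2 ek; apply: emb_eq.
have c1' : composable G gh l by rewrite /composable e1 (src_gmul HG).
have c2' : composable G g hl by rewrite /composable e2 (rng_gmul HG).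
have ek' : k = mul g hl by rewrite ek e1 e2 (gmulA HG).
rewrite !emb_mulf//; apply: (fmulA HB); exact: comp_emb.
Qed.

Lemma starf_mulf g h g' h' gh k (u : fib g) (v : fib h) :
  composable G g h -> g' = inv g -> h' = inv h -> gh = mul g h -> k = inv gh ->
  starf k (mulf gh u v) = mulf k (starf h' v) (starf g' u).
Proof.
move=> c eg eh egh ek; apply: emb_eq.
have c' : composable G h' g' by rewrite /composable eg eh src_inv rng_inv.
have ek' : k = mul h' g' by rewrite ek egh eg eh (inv_mul).
by rewrite emb_starf// !emb_mulf// !emb_starf// (fstarM HB)//; exact: comp_emb.
Qed.

Definition prf x g (u v : fib g) : fib x := mulf x (starf (inv g) u) v.

Section Prf.
Variables (x g : G).
Hypothesis xE : s g = x.
Implicit Types u v w : fib g.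

Let c1 : composable G (inv g) g := comp_invl g.
Let xE' : x = mul (inv g) g := esym xE.

Lemma prf_emb u v : prf x u v = coord x (fmul (fstar (emb u)) (emb v)).
Proof. by rewrite /prf /mulf emb_starf. Qed.

Lemma prfZDr u (c : R[i]) v w : prf x u (c *: v + w) = c *: prf x u v + prf x u w.
Proof. exact: mulfZDr. Qed.
Lemma prfZDl (c : R[i]) u w v : prf x (c *: u + w) v = c^* *: prf x u v + prf x w v.
Proof. by rewrite /prf starfZD// mulfZDl. Qed.
Lemma prfDr u v w : prf x u (v + w) = prf x u v + prf x u w.
Proof. exact: mulfDr. Qed.
Lemma prf0l v : prf x (0 : fib g) v = 0.
Proof. by rewrite /prf starf0// mulf0l. Qed.
Lemma prf0r v : prf x v (0 : fib g) = 0.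
Proof. exact: mulf0r. Qed.
Lemma prfZl c u v : prf x (c *: u) v = c^* *: prf x u v.
Proof. by rewrite /prf starfZ// mulfZl. Qed.
Lemma prfZr c u v : prf x u (c *: v) = c *: prf x u v.
Proof. exact: mulfZr. Qed.

Lemma unit_x : s x = x. Proof. by rewrite -xE src_src. Qed.

Lemma prf_st u v : prf x v u = starf x (prf x u v).
Proof.
have ux := unit_x.
rewrite /prf (@starf_mulf (inv g) g g (inv g) x)// ?invgK ?(unit_inv ux)//.
by rewrite starfK.
Qed.

Lemma prf_sq u : rnorm (prf x u u) = rnorm u ^+ 2.
Proof.
rewrite -!tnorm_emb /prf emb_mulf// emb_starf//.
exact: (norm_fstar_fmul HB (emb u)).
Qed.

End Prf.

(** The argument of [cnrm_stE], with u and u* in different fibres. *)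
Lemma rnorm_starf k g (u : fib g) : k = inv g -> rnorm (starf k u) = rnorm u.
Proof.
have le g' k' (v : fib g') : k' = inv g' -> rnorm v <= rnorm (starf k' v).
  move=> ->; have [z|z] := eqVneq (rnorm v) 0; first by rewrite z rnorm_ge0.
  have vp : 0 < rnorm v by rewrite lt_def z rnorm_ge0.
  rewrite -(ler_pM2r vp) -expr2 -(@prf_sq (s g') g')//.
  by apply: rnorm_mulf; [exact: comp_invl | ].
move=> ->; apply/eqP; rewrite eq_le le// andbT.
by rewrite -{2}(@starfK (inv g) g u)// le// invgK.
Qed.

Lemma rnorm_prf x g (u v : fib g) : s g = x -> rnorm (prf x u v) <= rnorm u * rnorm v.
Proof.
move=> xE; rewrite -(rnorm_starf u (erefl (inv g))).
by apply: rnorm_mulf => //; exact: comp_invl.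
Qed.

Lemma prf_mulfl x y g (c : fib y) (u v : fib g) : s g = x -> r g = y ->
  prf x (mulf g c u) v = prf x u (mulf g (starf y c) v).
Proof.
move=> xE yE; have uy : s y = y by rewrite -yE src_rng.
have cyg : composable G y g by rewrite /composable uy.
have gE : g = mul y g by rewrite -yE (gmul_rng HG).
have iy := unit_inv uy.
rewrite /prf (@starf_mulf y g y (inv g) g)//.
have cgy : composable G (inv g) y by rewrite /composable src_inv// yE unit_rng.
have ig : inv g = mul (inv g) y by rewrite -yE -(src_inv) (gmul_src HG).
by rewrite (@mulfA (inv g) y g (inv g) g x).
Qed.

(** The counterpart of [cpos] in a fibre that may have no unit: the identity operator takes the
    place of 1. *)
Definition posf x (h : fib x) : Prop :=
  starf x h = h /\ exists2 t : R, 0 <= t &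
    forall b : fib x, rnorm (t%:C *: b - mulf x h b) <= t * rnorm b.

Section Pairing.
Variables (x g : G).
Hypothesis xE : s g = x.
Hypothesis nz : exists v : fib g, v != 0.

Definition fpairing : pairing R :=
  @Pairing R (fib g) (fib x) (@starf x x) (@prf x g)
    (prfZDr xE) (prfZDl xE) (prf_st xE) (fun u v => rnorm_prf u v xE) (prf_sq xE) nz.

Variable y : G.
Hypothesis yE : r g = y.

Lemma lmul_adj (c : fib y) (u v : fpairing) :
  @pr R fpairing (mulf g c u) v = @pr R fpairing u (mulf g (starf y c) v).
Proof. exact: prf_mulfl. Qed.

Lemma lmul_bnd (c : fib y) : exists M, forall u : fib g,
  rnorm (mulf g c u) <= M * rnorm u.
Proof.
have uy : s y = y by rewrite -yE src_rng.
exists (rnorm c) => u; apply: rnorm_mulf; first by rewrite /composable uy.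
by rewrite -yE (gmul_rng HG).
Qed.

Definition lmul (c : fib y) : adjop fpairing := AdjOp (lmul_adj c) (lmul_bnd c).

End Pairing.

Lemma unit_nz_posf x (ux : s x = x) (nz : exists v : fib x, v != 0) (h : fib x) :
  posf h <-> cpos (@aop_st R _) (@anrm R _) (lmul ux nz (unit_rng ux) h).
Proof.
have cxx : composable G x x by rewrite /composable ux unit_rng.
have xx : x = mul x x by rewrite -{3}ux (gmul_src HG).
split=> -[sh [t t0 ht]]; split.
- by apply: adjop_eq => e; rewrite aop_stE /= sh.
- exists t => //; apply: anrm_le => // e.
  by rewrite aopBE aopZE; exact: ht.
- suff: forall e : fib x, mulf x (starf x h) e = mulf x h e.
    (* For d = h* - h one has d* d = h d - h* d = 0, and |d|^2 = |d* d|. *)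
    move=> he; have : mulf x (starf x (starf x h - h)) (starf x h - h) = 0.
      have ix := unit_inv ux.
      by rewrite starfD// starfN// starfK// mulfDl// mulfNl// he subrr.
    move=> z; apply/subr0_eq/eqP; rewrite -rnorm_eq0 -sqrf_eq0.
    rewrite -(prf_sq ux) /prf (unit_inv ux)// z rnorm0//.
  by move=> e; have := congr1 (fun T : adjop (fpairing ux nz) => aop T e) sh.
- exists t => // b.
  have := anrmP (t%:C *: 1 - lmul ux nz (unit_rng ux) h) b.
  rewrite aopBE aopZE /= => /le_trans; apply.
  by rewrite ler_wpM2r ?rnorm_ge0.
Qed.

Lemma posfD x (h k : fib x) : s x = x -> posf h -> posf k -> posf (h + k).
Proof.
move=> ux [sh [t t0 ht]] [sk [u u0 hu]].
have cxx : composable G x x by rewrite /composable ux unit_rng.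
have xx : x = mul x x by rewrite -{3}ux (gmul_src HG).
split; first by rewrite starfD ?sh ?sk// unit_inv.
exists (t + u); first exact: addr_ge0.
move=> b; rewrite mulfDl// rmorphD scalerDl opprD addrACA mulrDl.
by apply: le_trans (rnormD _ _) _; exact: lerD.
Qed.

Lemma posf0 x : s x = x -> posf (0 : fib x).
Proof.
move=> ux.
have cxx : composable G x x by rewrite /composable ux unit_rng.
have xx : x = mul x x by rewrite -{3}ux (gmul_src HG).
split; first by rewrite starf0// unit_inv.
by exists 0 => // b; rewrite mulf0l// scale0r subr0 rnorm0 mul0r.
Qed.

Lemma posfZ x (c : R) (h : fib x) : s x = x -> 0 <= c -> posf h -> posf (c%:C *: h).
Proof.
move=> ux c0 [sh [t t0 ht]].
have cxx : composable G x x by rewrite /composable ux unit_rng.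
have xx : x = mul x x by rewrite -{3}ux (gmul_src HG).
split; first by rewrite starfZ ?sh ?(unit_inv ux)// cconj_real.
exists (c * t) => [|b]; first exact: mulr_ge0.
rewrite mulfZl// rmorphM -scalerA -scalerBr rnormZr ger0_norm// -mulrA.
by rewrite ler_wpM2l.
Qed.

Lemma fib_trivial x : ~ (exists v : fib x, v != 0) -> forall v : fib x, v = 0.
Proof. by move=> nz v; apply/eqP; apply: contrapT => v0; apply: nz; exists v; apply/negP. Qed.

(** [cnrm_posD] transported along left multiplication L, which is additive and isometric: testing
    [L c] on c* gives |c c*| = |c|^2. A zero fibre has no operator algebra, whose unit must be
    nonzero, and is treated apart. *)
Lemma rnorm_posfD x (h k : fib x) : s x = x -> posf h -> posf k ->
  rnorm h <= rnorm (h + k).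
Proof.
move=> ux ph pk.
have [nz|/fib_trivial z] := pselect (exists v : fib x, v != 0); last first.
  by rewrite (z h) rnorm0 rnorm_ge0.
have cxx : composable G x x by rewrite /composable ux unit_rng.
have xx : x = mul x x by rewrite -{3}ux (gmul_src HG).
have ix := unit_inv ux.
pose L := lmul ux nz (unit_rng ux).
have nL c : anrm (L c) = rnorm c.
  apply/eqP; rewrite eq_le; apply/andP; split.
    by apply: anrm_le => [|e]; [exact: rnorm_ge0 | exact: rnorm_mulf].
  have [zc|zc] := eqVneq (rnorm c) 0; first by rewrite zc anrm_ge0.
  have cp : 0 < rnorm c by rewrite lt_def zc rnorm_ge0.
  have := anrmP (L c) (starf x c); rewrite rnorm_starf//= => h1.
  rewrite -(ler_pM2r cp); apply: le_trans h1.
  rewrite -expr2 -(rnorm_starf c (esym ix)) -(prf_sq ux) /prf ix starfK//.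
have LD : L (h + k) = L h + L k.
  by apply: adjop_eq => e; rewrite aopDE /=; exact: mulfDl.
rewrite -!nL LD; apply: (cnrm_posD (adjop_cstar _)); exact/unit_nz_posf.
Qed.

(** The positivity axiom of the bundle rewrites u* u as a* a with a over the unit; left
    multiplication by it is then T* T for an operator T on one fibre, and [cpos_st_mul] applies. *)
Lemma posf_prf x g (u : fib g) : s g = x -> posf (prf x u u).
Proof.
move=> xE; have ux : s x = x := unit_x xE.
have [nz|/fib_trivial z] := pselect (exists v : fib x, v != 0); last first.
  by rewrite (z (prf x u u)); exact: posf0.
have cxx : composable G x x by rewrite /composable ux unit_rng.
have xx : x = mul x x by rewrite -{3}ux (gmul_src HG).
have ix := unit_inv ux.
have [a [pa ea]] := fstar_fmul_positive HB (emb u).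
have pu : proj (fmul (fstar (emb u)) (emb u)) = x.
  rewrite (proj_fmul HB) ?(proj_fstar HB) ?proj_emb//.
  by rewrite /fcomposable (proj_fstar HB) proj_emb; exact: comp_invl.
rewrite pu in pa; pose a' := coord x a.
have aE : emb a' = a by rewrite coordK.
have -> : prf x u u = mulf x (starf x a') a'.
  by rewrite prf_emb// -ea /mulf emb_starf// aE.
apply/(unit_nz_posf ux nz); set L := lmul _ _ _.
have -> : L (mulf x (starf x a') a') = aop_st (L a') * L a'.
  by apply: adjop_eq => e; rewrite aopME aop_stE /=; exact: mulfA.
exact: cpos_st_mul (adjop_cstar _) _.
Qed.

(* [K] is the square root of [1 - c] acting on the fibre over [g]. *)
Lemma lmul_sqrt x y g (c : fib y) : s g = x -> r g = y -> starf y c = c ->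
  rnorm c <= 1 -> exists K : fib g -> fib g,
    forall v, prf x v v = prf x v (mulf g c v) + prf x (K v) (K v).
Proof.
move=> xE yE sc c1.
have uy : s y = y by rewrite -yE src_rng.
have cyg : composable G y g by rewrite /composable uy.
have gE : g = mul y g by rewrite -yE (gmul_rng HG).
have [nz|/fib_trivial z] := pselect (exists v : fib g, v != 0); last first.
  by exists id => v; rewrite (z v) mulf0r// !prf0r// addr0.
pose L := lmul xE nz yE c.
have [||Y [sY _ YY _]] := sqrt1B (adjop_cstar (fpairing xE nz)) (x := L).
- by apply: adjop_eq => e; rewrite aop_stE /= sc.
- apply: anrm_le => // e; rewrite mul1r.
  apply: le_trans (rnorm_mulf cyg gE _ _) _.
  by rewrite ler_piMl ?rnorm_ge0.
exists (1 - Y : adjop _) => v.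
have adj e f : @pr R (fpairing xE nz) ((1 - Y) e) f = @pr R (fpairing xE nz) e ((1 - Y) f).
  by rewrite !aopBE !prDl !prDr !prNl !prNr -{1}sY aop_stE aadjPl.
have e : prf x ((1 - Y : adjop _) v) ((1 - Y : adjop _) v) =
  prf x v ((1 - Y : adjop (fpairing xE nz)) ((1 - Y : adjop _) v)) := adj v ((1 - Y) v).
rewrite e.
have -> : (1 - Y) ((1 - Y) v) = v - L v.
  rewrite -aopME (_ : (1 - Y) * (1 - Y) = 1 - L) ?aopBE//.
  by rewrite -YY mulrBr !mulrBl !mulr1 !mul1r !opprD !opprK !addrA.
by rewrite -prfDr// /= addrC subrK.
Qed.

(** After scaling to |c| <= 1, [lmul_sqrt] for c* c gives v* v - (c v)* (c v) = (K v)* (K v). A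
    positive remainder is recorded instead of a norm inequality because such relations are summed in
    [Ble_slice]. *)
Lemma prf_mulf_le x a g ag (c : fib a) (v : fib g) (M : R) :
  s g = x -> composable G a g -> ag = mul a g -> rnorm c <= M ->
  exists2 h : fib x, posf h &
    (M ^+ 2)%:C *: prf x v v = prf x (mulf ag c v) (mulf ag c v) + h.
Proof.
move=> xE cag eag cM; have M0 := le_trans (rnorm_ge0 c) cM.
have ux : s x = x := unit_x xE.
have sag : s ag = x by rewrite eag (src_gmul HG).
have [M_0|M_n0] := eqVneq M 0.
  have c0 : c = 0 by apply/eqP; rewrite -rnorm_eq0 eq_le rnorm_ge0 -M_0 cM.
  exists 0; first exact: posf0.
  by rewrite M_0 expr0n scale0r c0 mulf0l// prf0l// addr0.
pose c' := M^-1%:C *: c; pose y := s a.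
pose H := prf y c' c'.
have rg : r g = y by rewrite -cag.
have Mp : 0 < M by rewrite lt_def M_n0.
have c'1 : rnorm c' <= 1.
  by rewrite rnormZr ger0_norm ?invr_ge0// mulrC ler_pdivrMr// mul1r.
have [||K hK] := @lmul_sqrt x y g H xE rg.
- by rewrite -prf_st.
- by rewrite prf_sq// expr_le1// rnorm_ge0.
exists ((M ^+ 2)%:C *: prf x (K v) (K v)).
  by apply: posfZ => //; [exact: exprn_ge0 | exact: posf_prf].
rewrite {1}(hK v) scalerDr; congr (_ + _).
have -> : prf x v (mulf g H v) = prf x (mulf ag c' v) (mulf ag c' v).
  rewrite /prf (@starf_mulf a g (inv a) (inv g) ag)//.
  have cia : composable G (inv a) ag by rewrite /composable src_inv// eag (rng_gmul HG).
  have cig : composable G (inv g) (inv a) by rewrite /composable src_inv// rng_inv// cag.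
  have giag : g = mul (inv a) ag by rewrite eag mulVKg.
  rewrite (@mulfA (inv g) (inv a) ag (inv ag) g x)//; try by [rewrite eag inv_mul | rewrite -sag].
  congr (mulf x _ _); rewrite /H /prf (@mulfA (inv a) a g y ag g)//.
  - exact: comp_invl.
  - by rewrite -{1}(gmul_rng HG g) rg.
rewrite /c' mulfZl// prfZl// prfZr// scalerA cconj_real scalerA -!rmorphM /=.
by rewrite expr2 (_ : _ * _ = 1) ?scale1r//; field.
Qed.

End Fibres.

(** * Pre-Hilbert norms and bounded sections *)

Section SectionNorms.
Variables (R : realType) (G : etale_groupoid) (B : fell_bundle R G).
Local Notation s := (src G).
Local Notation r := (rng G).
Local Notation inv := (ginv G).
Local Notation mul := (gmul G).
Local Notation fib := (fibre B).
Implicit Types (x g b : G) (a h k f : sect B) (F S : {fset G}).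

Let HG := etale_is_groupoid G.

Definition over x (F : seq G) : Prop := {in F, forall g, s g = x}.

Definition ip x (F : seq G) h k : fib x := \sum_(g <- F) prf x (h g) (k g).

Definition n2 x (F : seq G) h : R := Num.sqrt (rnorm (ip x F h h)).

Definition rmul x h (v : fib x) : sect B := fun g => mulf g (h g) v.

Section Ip.
Variables (x : G) (F : seq G).
Hypotheses (ux : s x = x) (oF : over x F).

Lemma ip_eq h h' k k' : (forall g, g \in F -> h g = h' g) ->
  (forall g, g \in F -> k g = k' g) -> ip x F h k = ip x F h' k'.
Proof. by move=> e1 e2; apply: eq_big_seq => g gF; rewrite e1// e2. Qed.

Lemma ip_st h k : ip x F k h = starf x (ip x F h k).
Proof.
rewrite starf_sum ?(unit_inv ux)//; apply: eq_big_seq => g /oF gx.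
exact: prf_st.
Qed.

Lemma posf_ip h : posf (ip x F h h).
Proof.
rewrite /ip; move: oF; elim: (F) => [|g F' IH] oF'; first by rewrite big_nil; exact: posf0.
rewrite big_cons; apply: posfD => //.
  by apply: posf_prf; apply: oF'; rewrite mem_head.
by apply: IH => g' gF; apply: oF'; rewrite inE gF orbT.
Qed.

Lemma n2_ge0 h : 0 <= n2 x F h. Proof. exact: sqrtr_ge0. Qed.

Lemma n2_sq h : n2 x F h ^+ 2 = rnorm (ip x F h h).
Proof. by rewrite sqr_sqrtr ?rnorm_ge0. Qed.

Lemma ip_DZr (c : R[i]) h k k' :
  ip x F h (fun g => c *: k g + k' g) = c *: ip x F h k + ip x F h k'.
Proof.
rewrite /ip scaler_sumr -big_split /=; apply: eq_big_seq => g /oF gx.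
exact: prfZDr.
Qed.

Lemma ip_DZl (c : R[i]) h k k' :
  ip x F (fun g => c *: k g + k' g) h = c^* *: ip x F k h + ip x F k' h.
Proof.
rewrite /ip scaler_sumr -big_split /=; apply: eq_big_seq => g /oF gx.
exact: prfZDl.
Qed.

Let cgx g : g \in F -> composable G g x.
Proof. by move=> /oF gx; rewrite /composable gx unit_rng. Qed.
Let gxE g : g \in F -> g = mul g x.
Proof. by move=> /oF gx; rewrite -gx (gmul_src HG). Qed.
Let cxx : composable G x x. Proof. by rewrite /composable ux unit_rng. Qed.
Let xx : x = mul x x. Proof. by rewrite -{3}ux (gmul_src HG). Qed.

Lemma ip_rmulr h k (v : fib x) : ip x F h (rmul k v) = mulf x (ip x F h k) v.
Proof.
rewrite /ip mulf_suml//; apply: eq_big_seq => g gF; rewrite /prf.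
rewrite (@mulfA _ _ _ (inv g) g x x g x)//; first exact: comp_invl.
- exact: cgx.
- by rewrite -[LHS](oF gF).
- exact: gxE.
Qed.

Lemma ip_rmull h k (v : fib x) : ip x F (rmul k v) h = mulf x (starf x v) (ip x F k h).
Proof.
rewrite ip_st ip_rmulr (@starf_mulf _ _ _ x x x x x)// ?(unit_inv ux)//.
by rewrite -ip_st.
Qed.

(* [|b|^2 <= 1], so [1 - <b,b> = K^2]; with [X = <b,c>] and [d = c - b X] one
   gets [<c,c> = X* X + (K X)* (K X) + <d,d>], a sum of positive elements. *)
Let cauchy_schwarz1 (b c : sect B) : rnorm (ip x F b b) <= 1 ->
  rnorm (ip x F b c) ^+ 2 <= rnorm (ip x F c c).
Proof.
move=> b1; set X := ip x F b c; set H := ip x F b b.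
have ix := unit_inv ux; have rx := unit_rng ux.
have sH : starf x H = H by have [] := posf_ip b.
have [K hK] := lmul_sqrt ux rx sH b1.
pose bX : sect B := rmul b X.
pose d : sect B := fun g => (-1) *: bX g + c g.
have eX : prf x X X = mulf x (ip x F c b) X by rewrite /prf ix (ip_st b c).
have dd : ip x F d d = prf x X (mulf x H X) - prf x X X - prf x X X + ip x F c c.
  rewrite {1}/d ip_DZl /d !ip_DZr !scaleN1r rmorphN1 scaleN1r.
  rewrite /bX !ip_rmulr !ip_rmull -eX -/X -/H.
  have e : mulf x (starf x X) X = prf x X X by rewrite /prf ix.
  have e' : mulf x (mulf x (starf x X) H) X = prf x X (mulf x H X).
    by rewrite /prf ix; apply: mulfA.
  by rewrite e e' opprD opprK !addrA.
have -> : ip x F c c = prf x X X + (prf x (K X) (K X) + ip x F d d).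
  rewrite dd; have /eqP := hK X; rewrite -subr_eq => /eqP <-.
  move: (prf x X X) (prf x (K X) (K X)) (ip x F c c) => P Q C.
  by rewrite (addrAC P) subrr add0r -opprD [Q + P]addrC addrA addNKr.
rewrite -(prf_sq ux); apply: rnorm_posfD => //; first exact: posf_prf.
by apply: posfD => //; [exact: posf_prf | exact: posf_ip].
Qed.

(** A null vector b can be scaled by any t without leaving the unit ball, so t |<b,c>| stays bounded
    as t grows. *)
Lemma ip_eq0 (b c : sect B) : rnorm (ip x F b b) = 0 -> ip x F b c = 0.
Proof.
move=> b0; apply: rnorm_eps => e e0.
(* If |<b,c>| exceeded e, then t |<b,c>| >= |<c,c>| + 1, whose square exceeds |<c,c>|. *)
pose t := e^-1 * (rnorm (ip x F c c) + 1).
have := @cauchy_schwarz1 (fun g => t%:C *: b g + 0) c.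
rewrite ip_DZl ip_DZr.
have t0 : 0 < t by rewrite mulr_gt0 ?invr_gt0// ltr_wpDl ?rnorm_ge0.
have z h : ip x F h (fun=> 0) = 0.
  by rewrite /ip big_seq big1// => g /oF gx; rewrite prf0r.
have z' h : ip x F (fun=> 0) h = 0.
  by rewrite /ip big_seq big1// => g /oF gx; rewrite prf0l.
rewrite !z !z' !addr0 !rnormZ ip_DZl z' addr0 rnormZ b0 !mulr0 => /(_ ler01).
rewrite cconj_real cnorm_real /= gtr0_norm//.
have := rnorm_ge0 (ip x F b c); have := rnorm_ge0 (ip x F c c).
set u := rnorm (ip x F b c); set w := rnorm _ => w0 u0 hu.
rewrite leNgt; apply/negP => eu.
have : w + 1 <= t * u.
  rewrite /t mulrAC -[leLHS]mul1r ler_wpM2r ?addr_ge0//.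
  by rewrite mulrC ler_pdivlMr// mul1r ltW.
nra.
Qed.

Lemma ip_CS (b c : sect B) : rnorm (ip x F b c) <= n2 x F b * n2 x F c.
Proof.
have [z|nz] := eqVneq (rnorm (ip x F b b)) 0.
  by rewrite (ip_eq0 _ z) rnorm0 mulr_ge0 ?n2_ge0.
have bp : 0 < rnorm (ip x F b b) by rewrite lt_def nz rnorm_ge0.
have np : 0 < n2 x F b by rewrite sqrtr_gt0.
have := @cauchy_schwarz1 (fun g => (n2 x F b)^-1%:C *: b g + 0) c.
have z h : ip x F h (fun=> 0) = 0.
  by rewrite /ip big_seq big1// => g /oF gx; rewrite prf0r.
have z' h : ip x F (fun=> 0) h = 0.
  by rewrite /ip big_seq big1// => g /oF gx; rewrite prf0l.
rewrite !ip_DZl !ip_DZr !z !z' ?scaler0 ?addr0 cconj_real !rnormZr.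
rewrite !(ger0_norm (x := _^-1)) ?invr_ge0 ?n2_ge0// -!n2_sq.
rewrite expr2 mulKf ?gt_eqF// mulVf ?gt_eqF// => /(_ (lexx _)).
rewrite ler_pXn2r// ?nnegrE ?mulr_ge0 ?invr_ge0 ?n2_ge0 ?rnorm_ge0//.
by rewrite ler_pdivrMl.
Qed.

End Ip.

(** <h,h> over S is the sum of the positive elements <h,h> over F and over its complement in S, so
    [rnorm_posfD] applies. *)
Lemma n2_fsubset x F S h : s x = x -> over x S -> (F `<=` S)%fset ->
  n2 x F h <= n2 x S h.
Proof.
move=> ux oS FS; rewrite ler_sqrt ?rnorm_ge0//.
have -> : ip x S h h = ip x F h h + ip x (S `\` F)%fset h h.
  rewrite /ip (big_fsetID _ (mem F)) /=; congr (_ + _).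
    apply: perm_big; apply: uniq_perm; rewrite ?fset_uniq// => g.
    by rewrite !inE /= andbC; apply: andb_idr => /(fsubsetP FS).
  apply: perm_big; apply: uniq_perm; rewrite ?fset_uniq// => g.
  by rewrite !inE /= andbC.
apply: rnorm_posfD => //; apply: posf_ip => // g.
  by move/(fsubsetP FS); exact: oS.
by rewrite inE => /andP[_]; exact: oS.
Qed.

Lemma n2_1 g h : n2 (s g) [fset g]%fset h = rnorm (h g).
Proof.
rewrite /n2 /ip big_seq_fset1 prf_sq// sqrtr_sqr ger0_norm//.
exact: rnorm_ge0.
Qed.

Lemma rnorm_n2 x g F h : s x = x -> over x F -> g \in F -> rnorm (h g) <= n2 x F h.
Proof.
move=> ux oF gF; rewrite -n2_1 (oF _ gF); apply: n2_fsubset => //.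
by apply/fsubsetP => k; rewrite inE => /eqP->.
Qed.

(* [act a f S g] is the value at [g] of [a] convolved with the restriction of
   [f] to [S]. *)
Definition act a f (S : seq G) : sect B :=
  fun g => \sum_(b <- S) mulf g (a (mul g (inv b))) (f b).

Lemma mulf_idx (k l l' m : G) a (v : fib m) : l = l' -> mulf k (a l) v = mulf k (a l') v.
Proof. by move=> ->. Qed.

Lemma sstarE a g g' : g' = inv g -> sstar a g = starf g (a g').
Proof. by move=> ->. Qed.

Lemma sstarK a : sstar (sstar a) = a.
Proof.
apply/functional_extensionality_dep => g.
by rewrite (sstarE _ (erefl _)) (@sstarE a (inv g) g) ?invgK// starfK.
Qed.

Lemma prf_mulf_adj x al b g (c : fib al) (v : fib g) (w : fib b) :
  s b = x -> s g = x -> al = mul g (inv b) ->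
  prf x v (mulf g c w) = prf x (mulf b (starf (inv al) c) v) w.
Proof.
move=> bx gx alE; have gb : s g = s b by rewrite bx gx.
have cab : composable G al b by rewrite alE; exact: comp_div.
have gE : g = mul al b by rewrite alE mulgVK.
have cag : composable G (inv al) g.
  by rewrite alE inv_div//; apply: comp_div.
have bE : b = mul (inv al) g by rewrite alE inv_div// mulgVK.
have cga : composable G (inv g) al.
  by rewrite /composable src_inv alE rng_div.
have ib : inv b = mul (inv g) al.
  by rewrite {1}bE inv_mul// invgK.
rewrite /prf (@starf_mulf _ _ _ (inv al) g al (inv g) b)// ?invgK//.
rewrite starfK// (@mulfA _ _ _ (inv g) al b (inv b) g x)//.
Qed.

(** Two finite sums are exchanged; entrywise, the adjoint of multiplication by a(g b^-1) is
    multiplication by its star, the value of a* at b g^-1. *)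
Lemma ip_act_adj x F S a h f : s x = x -> over x F -> over x S ->
  ip x F h (act a f S) = ip x S (act (sstar a) h F) f.
Proof.
move=> ux oF oS.
transitivity (\sum_(g <- F) \sum_(b <- S)
    prf x (h g) (mulf g (a (mul g (inv b))) (f b))).
  rewrite /ip; apply: eq_big_seq => g /oF gx; rewrite /act /prf mulf_sumr//.
  exact: comp_invl.
transitivity (\sum_(b <- S) \sum_(g <- F)
    prf x (h g) (mulf g (a (mul g (inv b))) (f b))); first exact: exchange_big.
rewrite /ip; apply: eq_big_seq => b /oS bx.
have pst (u : fib b) (w : fib b) : prf x u w = starf x (prf x w u) by exact: prf_st.
rewrite pst /act /prf mulf_sumr//; last exact: comp_invl.
rewrite starf_sum ?(unit_inv ux)//; apply: eq_big_seq => g /oF gx.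
rewrite -/(prf x _ _) -pst.
rewrite (prf_mulf_adj _ _ _ bx gx (erefl _)).
congr (prf x _ (f b)).
rewrite (@sstarE _ _ (mul g (inv b))) ?inv_div ?bx ?gx//.
Qed.

Lemma n2_le x F h (t : R) : 0 <= t ->
  (n2 x F h <= t) = (rnorm (ip x F h h) <= t ^+ 2).
Proof.
by move=> t0; rewrite -n2_sq ler_pXn2r// nnegrE ?n2_ge0.
Qed.

(** The bound [normb a <= M] on finite blocks; [normb_leP] proves the equivalence. Working with real
    bounds keeps extended reals out of the estimates. *)
Definition Ble a (M : R) : Prop :=
  0 <= M /\ forall x F S f, s x = x -> over x F -> over x S ->
    n2 x F (act a f S) <= M * n2 x S f.

(** One direction is Cauchy-Schwarz; for the other take h = a f and cancel one factor |h|. *)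
Lemma BleP a M : 0 <= M -> Ble a M <->
  (forall x F S h f, s x = x -> over x F -> over x S ->
    rnorm (ip x F h (act a f S)) <= M * n2 x F h * n2 x S f).
Proof.
move=> M0; split=> [[_ H] x F S h f ux oF oS|H].
  apply: le_trans (ip_CS ux oF _ _) _; rewrite [M * _]mulrC -mulrA.
  by rewrite ler_wpM2l ?n2_ge0// H.
split=> // x F S f ux oF oS; have := H x F S (act a f S) f ux oF oS.
rewrite -n2_sq expr2; set n := n2 x F _; have := n2_ge0 x F (act a f S).
rewrite -/n le_eqVlt => /predU1P[<-|n0]; first by rewrite mulr_ge0 ?n2_ge0.
by rewrite mulrAC ler_pM2r.
Qed.

Lemma Ble_star a M : Ble a M -> Ble (sstar a) M.
Proof.
move=> aM; have M0 := aM.1; apply/BleP => // x F S h f ux oF oS.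
rewrite ip_act_adj// sstarK (ip_st ux) ?rnorm_starf ?(unit_inv ux)//.
by rewrite mulrAC; apply: (BleP _ M0).1.
Qed.

Lemma BleW a M N : M <= N -> Ble a M -> Ble a N.
Proof.
move=> MN [M0 H]; split=> [|x F S f ux oF oS]; first exact: le_trans MN.
by apply: le_trans (H x F S f ux oF oS) _; rewrite ler_wpM2r ?n2_ge0.
Qed.

Lemma act_lin (c : R[i]) a a' f (S : seq G) g : over (s g) S ->
  act (c *: a + a') f S g = c *: act a f S g + act a' f S g.
Proof.
move=> oS; rewrite /act scaler_sumr -big_split /=; apply: eq_big_seq => b bS.
have sb := oS _ bS; apply: mulfZDl; first by apply: comp_div; rewrite sb.
by rewrite mulgVK.
Qed.

Lemma BleZD (c : R[i]) a a' M N : Ble a M -> Ble a' N ->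
  Ble (c *: a + a') (complex.Re `|c| * M + N).
Proof.
move=> aM aN; have M0 := aM.1; have N0 := aN.1.
have c0 := cabs_ge0 c.
apply/BleP => [|x F S h f ux oF oS]; first by rewrite addr_ge0 ?mulr_ge0.
have -> : ip x F h (act (c *: a + a') f S) =
    ip x F h (fun g => c *: act a f S g + act a' f S g).
  by apply: ip_eq => // g /oF gx; apply: act_lin; rewrite gx.
rewrite ip_DZr// !mulrDl; apply: le_trans (rnormD _ _) _; rewrite lerD//.
  by rewrite rnormZ -!mulrA ler_wpM2l// mulrA; exact: (BleP _ M0).1.
exact: (BleP _ N0).1.
Qed.

Lemma Ble0 : Ble 0 0.
Proof.
split=> // x F S f ux oF oS; rewrite mul0r /n2.
rewrite (_ : ip _ _ _ _ = 0) ?rnorm0 ?sqrtr0// /ip big_seq big1// => g gF.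
rewrite (_ : act 0 f S g = 0) ?prf0l ?(oF _ gF)// /act big_seq big1// => b bS.
have gb : s g = s b by rewrite oF// oS.
by rewrite mulf0l ?mulgVK//; exact: comp_div.
Qed.

Lemma BleD a a' M N : Ble a M -> Ble a' N -> Ble (a + a') (M + N).
Proof. by move=> h /(BleZD 1 h); rewrite scale1r normr1 mul1r. Qed.

Lemma BleZ (c : R[i]) a M : Ble a M -> Ble (c *: a) (complex.Re `|c| * M).
Proof. by move=> h; have := BleZD c h Ble0; rewrite !addr0. Qed.

Lemma BleB a a' M N : Ble a M -> Ble a' N -> Ble (a - a') (M + N).
Proof.
move=> h h'; apply: BleD => //; have := BleZ (-1) h'.
by rewrite scaleN1r normrN1 mul1r.
Qed.

(* Testing [a] on the section supported at [x] with value [H = <a,a>]. *)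
Lemma Ble_n2 a M x F : Ble a M -> s x = x -> over x F -> n2 x F a <= M.
Proof.
move=> [M0 aM] ux oF; set H := ip x F a a.
have sH : starf x H = H by have [] := posf_ip ux oF a.
have ix := unit_inv ux; have rx := unit_rng ux.
have cxx : composable G x x by rewrite /composable ux.
have xx : x = mul x x by rewrite -{3}ux (gmul_src HG).
(* [coord] takes its default value 0 off the fibre of its argument, so f is H at x and 0
   elsewhere. *)
pose f : sect B := fun g => coord g (emb H).
have fx : f x = H by rewrite /f embK.
have ox : over x [fset x]%fset by move=> g; rewrite inE => /eqP->.
have := aM x F [fset x]%fset f ux oF ox.
have -> : n2 x [fset x]%fset f = rnorm H.
  by have := n2_1 x f; rewrite ux fx.
pose HHH := mulf x H (mulf x H H).
rewrite n2_le ?mulr_ge0 ?rnorm_ge0//.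
have -> : ip x F (act a f [fset x]%fset) (act a f [fset x]%fset) = HHH.
  transitivity (ip x F (rmul a H) (rmul a H)).
    have e : forall g, g \in F -> act a f [fset x]%fset g = mulf g (a g) H.
      move=> g gF; rewrite /act big_seq_fset1 fx; apply: mulf_idx.
      by rewrite ix -(oF _ gF) (gmul_src HG).
    exact: ip_eq.
  rewrite ip_rmulr// ip_rmull// sH /HHH.
  exact: mulfA.
have [z|nz] := eqVneq (rnorm H) 0.
  by move=> _; rewrite n2_le// -/H z sqr_ge0.
have Hp : 0 < rnorm H by rewrite lt_def nz rnorm_ge0.
(* |H|^4 = |H^2|^2 = |H^4| <= |H| |H^3|. Together with |H^3| <= M^2 |H|^2 this yields |H| <= M^2. *)
have h3 : rnorm H ^+ 3 <= rnorm HHH.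
  rewrite -(ler_pM2l Hp) -exprS (_ : 4 = 2 * 2)%N// exprM.
  have e1 : rnorm H ^+ 2 = rnorm (mulf x H H) by rewrite -(prf_sq ux) /prf ix sH.
  rewrite e1 -(prf_sq ux) /prf ix (@starf_mulf _ _ _ x x x x x)// ?sH//.
  rewrite (@mulfA _ _ _ x x x x x x)//.
  exact: rnorm_mulf.
move=> h4; rewrite n2_le// -/H.
have := le_trans h3 h4; rewrite exprMn exprS.
by rewrite ler_pM2r// exprn_gt0.
Qed.

Lemma Ble_rnorm a M g : Ble a M -> rnorm (a g) <= M.
Proof.
move=> aM; rewrite -n2_1; apply: Ble_n2 => //; first exact: src_src.
by move=> k; rewrite inE => /eqP->.
Qed.

End SectionNorms.

(** * Convolution *)

Section RnormLimits.
Variables (R : realType) (E : normedModType R[i]).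
Context (T : Type) (F : set_system T) {FF : ProperFilter F}.

Lemma rnorm_cvg_le (f : T -> E) l (M : R) : f @ F --> l ->
  (\forall t \near F, rnorm (f t) <= M) -> rnorm l <= M.
Proof.
move=> fl fM; apply/ler_addgt0Pl => e e0.
have [t [ht1 ht2]] : exists t, rnorm (f t) <= M /\ rnorm (l - f t) < e.
  apply: (@filter_ex _ F); near=> t; split; first by near: t.
  by near: t; exact: (rnorm_cvgP _ _ _).1.
by rewrite -(subrK (f t) l); apply: le_trans (rnormD _ _) _; rewrite lerD// ltW.
Unshelve. all: by end_near. Qed.

End RnormLimits.

Section RnormComplete.
Variables (R : realType) (E : completeNormedModType R[i]).
Context (T : Type) (F : set_system T) {FF : ProperFilter F}.

(** The limit of an approximant within e/3 of f is the centre of a ball of radius e that eventually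
    contains f, so the image filter is Cauchy. *)
Lemma rnorm_cvg_unif (f : T -> E) :
  (forall e : R, 0 < e -> exists2 h : T -> E, cvg (h @ F) &
    \forall t \near F, rnorm (f t - h t) <= e) -> cvg (f @ F).
Proof.
move=> H; apply: rnorm_complete => e e0.
have e3 : 0 < e / 3 by rewrite divr_gt0.
have [h /cvg_ex[l hl] fh] := H _ e3; exists l.
near=> v; near: v.
have : \forall t \near F, rnorm (l - f t) < e.
  near=> t; rewrite -(subrK (h t) l) -addrA; apply: le_lt_trans (rnormD _ _) _.
  have h1 : rnorm (l - h t) < e / 3 by near: t; exact: (rnorm_cvgP _ _ _).1.
  have h2 : rnorm (f t - h t) <= e / 3 by near: t.
  by rewrite (rnorm_distC (h t)); lra.
by [].
Unshelve. all: by end_near. Qed.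

End RnormComplete.

Section FiniteSets.
Variables (G : etale_groupoid).
Implicit Types x : G.

(* Finite subsets of the source fibre of [x], directed by inclusion. *)
Definition fins x : set_system {fset G} :=
  filter_from [set S : {fset G} | over x S]
    (fun S0 => [set S : {fset G} | over x S /\ (S0 `<=` S)%fset]).

Lemma overU x (S T : {fset G}) : over x S -> over x T -> over x (S `|` T)%fset.
Proof. by move=> oS oT g; rewrite inE => /orP[/oS|/oT]. Qed.

Global Instance fins_filter x : ProperFilter (fins x).
Proof.
apply: filter_from_proper; last by move=> S oS; exists S; split.
apply: filter_from_filter; first by exists fset0 => g.
move=> S T oS oT; exists (S `|` T)%fset; first exact: overU.
by move=> U /= [oU]; rewrite fsubUset => /andP[SU TU].
Qed.

Lemma fins_over x : fins x [set S : {fset G} | over x S].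
Proof. by exists fset0 => [g|S [oS _]]. Qed.

Lemma fins_ge x (S0 : {fset G}) : over x S0 ->
  fins x [set S : {fset G} | over x S /\ (S0 `<=` S)%fset].
Proof. by move=> oS; exists S0. Qed.

End FiniteSets.

#[local] Existing Instance summability.totally_filter.

Section Convolution.
Variables (R : realType) (G : etale_groupoid) (B : fell_bundle R G).
Local Notation s := (src G).
Local Notation r := (rng G).
Local Notation inv := (ginv G).
Local Notation mul := (gmul G).
Local Notation fib := (fibre B).
Implicit Types (x g : G) (a f : sect B) (F S : {fset G}).

Let HG := etale_is_groupoid G.

Section FibreLimits.
Context (T : Type) (FT : set_system T) {FF : ProperFilter FT}.

Lemma cvg_mulfl k g h (u : T -> fib g) (l : fib g) (v : fib h) :
  composable G g h -> k = mul g h ->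
  u @ FT --> l -> (fun t => mulf k (u t) v) @ FT --> mulf k l v.
Proof.
move=> c kE ul; apply/rnorm_cvgP => e e0.
have e1 : 0 < e / (rnorm v + 1) by rewrite divr_gt0// ltr_wpDl ?rnorm_ge0.
near=> t; have := rnorm_mulf c kE (l - u t) v.
rewrite mulfDl// mulfNl// => /le_lt_trans; apply.
have : rnorm (l - u t) < e / (rnorm v + 1) by near: t; exact: (rnorm_cvgP _ _ _).1.
rewrite ltr_pdivlMr ?ltr_wpDl ?rnorm_ge0//.
have := rnorm_ge0 v; have := rnorm_ge0 (l - u t); nra.
Unshelve. all: by end_near. Qed.

Lemma cvg_mulfr k g h (u : fib g) (v : T -> fib h) (l : fib h) :
  composable G g h -> k = mul g h ->
  v @ FT --> l -> (fun t => mulf k u (v t)) @ FT --> mulf k u l.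
Proof.
move=> c kE ul; apply/rnorm_cvgP => e e0.
have e1 : 0 < e / (rnorm u + 1) by rewrite divr_gt0// ltr_wpDl ?rnorm_ge0.
near=> t; have := rnorm_mulf c kE u (l - v t).
rewrite mulfDr// mulfNr// => /le_lt_trans; apply.
have : rnorm (l - v t) < e / (rnorm u + 1) by near: t; exact: (rnorm_cvgP _ _ _).1.
rewrite ltr_pdivlMr ?ltr_wpDl ?rnorm_ge0//.
have := rnorm_ge0 u; have := rnorm_ge0 (l - v t); nra.
Unshelve. all: by end_near. Qed.

Lemma cvg_starf k g (u : T -> fib g) (l : fib g) : k = inv g ->
  u @ FT --> l -> (fun t => starf k (u t)) @ FT --> starf k l.
Proof.
move=> kE ul; apply/rnorm_cvgP => e e0; near=> t.
rewrite -(starfN kE) -starfD// rnorm_starf//.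
by near: t; exact: (rnorm_cvgP _ _ _).1.
Unshelve. all: by end_near. Qed.

Lemma cvg_sum_seq k (I : eqType) (r : seq I) (u : I -> T -> fib k) (l : I -> fib k) :
  (forall i, i \in r -> u i @ FT --> l i) ->
  (fun t => \sum_(i <- r) u i t) @ FT --> \sum_(i <- r) l i.
Proof.
elim: r => [|i r' IH] H.
  rewrite big_nil; under eq_fun do rewrite big_nil; exact: cvg_cst.
rewrite big_cons; under eq_fun do rewrite big_cons; apply: cvgD.
  by apply: H; rewrite mem_head.
by apply: IH => j jr; apply: H; rewrite inE jr orbT.
Qed.

End FibreLimits.

Section Factors.
Variable g : G.

Let snd_factor (p : factors g) : G := (val p).2.

Let factorE (p : factors g) : s (snd_factor p) = s g /\ (val p).1 = mul g (inv (snd_factor p)).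
Proof.
have := valP p; rewrite inE => -[c e].
rewrite /snd_factor; move: (val p) c e => [p1 p2] /= c <-.
by rewrite (src_gmul HG)// mulgK.
Qed.

Let snd_inj : injective snd_factor.
Proof.
move=> p q e; apply: val_inj; have [_ p1] := factorE p; have [_ q1] := factorE q.
move: e p1 q1; rewrite /snd_factor; case: (val p) (val q) => [p1 p2] [q1 q2] /=.
by move=> -> -> ->.
Qed.

Let snd_surj b : s b = s g -> exists p, snd_factor p = b.
Proof.
move=> bg; have h : (mul g (inv b), b) \in factors g.
  by rewrite inE; split=> /=; [exact: comp_div | rewrite mulgVK].
by exists (SigSub h).
Qed.

(** Inverse of [snd_factor] on the source fibre of g; elsewhere it takes a fixed factorisation as a
    junk value. *)
Let lift (b : G) : factors g :=
  if pselect (s b = s g) is left e then sval (cid (snd_surj e))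
  else sval (cid (snd_surj (erefl (s g)))).

Let liftK b : s b = s g -> snd_factor (lift b) = b.
Proof. by rewrite /lift; case: pselect => // e _; case: cid. Qed.

Let partial_sumE a f (J : {fset factors g}) :
  summability.partial_sum (@conv_term R G B a f g) J =
  act a f (snd_factor @` J)%fset g.
Proof.
rewrite /summability.partial_sum -(big_seq_fsetE _ J xpredT) /act.
rewrite big_imfset /=; last by move=> p q _ _; exact: snd_inj.
apply: eq_bigr => p _; have [_ e] := factorE p.
rewrite /conv_term -/(mulf g _ _); apply: mulf_idx.
exact: e.
Qed.

(** A factorisation of g is (g b^-1, b) for a unique b with the source of g, so the net over finite
    sets of factorisations and the net over finite subsets of the source fibre are cofinal in each
    other. *)
Lemma conv_cvgP a f (l : fib g) :
  (summability.partial_sum (@conv_term R G B a f g) @ summability.totally --> l) <->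
  ((fun S : {fset G} => act a f S g) @ fins (s g) --> l).
Proof.
split=> /rnorm_cvgP H; apply/rnorm_cvgP => e e0; have := H e e0.
- move=> [A _ hA]; exists (snd_factor @` A)%fset.
    by move=> b /imfsetP[p _ ->]; have [] := factorE p.
  move=> S [oS AS]; have := hA (lift @` S)%fset; rewrite partial_sumE.
  have -> : (snd_factor @` (lift @` S))%fset = S.
    apply/fsetP => b; apply/imfsetP/idP => [[p /imfsetP[c cS ->] ->]|bS].
      by rewrite liftK// oS.
    by exists (lift b); rewrite ?liftK ?oS//; apply/imfsetP; exists b.
  apply; apply/fsubsetP => p pA; apply/imfsetP.
  have pS : snd_factor p \in S by apply: (fsubsetP AS); apply/imfsetP; exists p.
  by exists (snd_factor p) => //; apply: snd_inj; rewrite liftK// oS.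
- move=> [S0 oS0 hS]; exists (lift @` S0)%fset => // J /= SJ.
  rewrite partial_sumE; apply: hS; split.
    by move=> b /imfsetP[p _ ->]; have [] := factorE p.
  apply/fsubsetP => b bS; apply/imfsetP; exists (lift b).
    by apply: (fsubsetP SJ); apply/imfsetP; exists b.
  by rewrite liftK// oS0.
Qed.

End Factors.

Lemma conv_definedP a f : conv_defined a f <->
  (forall g, cvg ((fun S : {fset G} => act a f S g) @ fins (s g))).
Proof.
split=> H g.
  by have /cvg_ex[l] := H g; move/conv_cvgP => hl; apply/cvg_ex; exists l.
by have /cvg_ex[l] := H g; move/conv_cvgP => hl; apply/cvg_ex; exists l.
Qed.

Lemma convE a f g (l : fib g) : (fun S : {fset G} => act a f S g) @ fins (s g) --> l ->
  conv a f g = l.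
Proof. by move/conv_cvgP => h; apply: cvg_lim => //; exact: norm_hausdorff. Qed.

Lemma conv_cvg a f g : conv_defined a f ->
  (fun S : {fset G} => act a f S g) @ fins (s g) --> conv a f g.
Proof.
by move=> /conv_definedP/(_ g)/cvg_ex[l hl]; rewrite (convE hl).
Qed.

Lemma conv_intro a f (c : sect B) :
  (forall g, (fun S : {fset G} => act a f S g) @ fins (s g) --> (c g : fib g)) ->
  conv_defined a f /\ conv a f = c.
Proof.
move=> H; split; first by apply/conv_definedP => g; apply/cvg_ex; exists (c g); exact: H.
by apply/functional_extensionality_dep => g; exact: convE.
Qed.

Lemma conv_lin_l (k : R[i]) a a' f : conv_defined a f -> conv_defined a' f ->
  conv_defined (k *: a + a') f /\ conv (k *: a + a') f = k *: conv a f + conv a' f.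
Proof.
move=> d d'; apply: conv_intro => g.
have : (fun S : {fset G} => k *: act a f S g + act a' f S g) @ fins (s g) -->
    k *: conv a f g + conv a' f g.
  by apply: cvgD; [apply: cvgZr|]; exact: conv_cvg.
apply: cvg_trans; apply: near_eq_cvg.
by apply: filterS (fins_over (s g)) => S oS; rewrite act_lin.
Qed.

Lemma act_linr (k : R[i]) a f f' S g : over (s g) S ->
  act a (k *: f + f') S g = k *: act a f S g + act a f' S g.
Proof.
move=> oS; rewrite /act scaler_sumr -big_split /=; apply: eq_big_seq => b bS.
have sb := oS _ bS; apply: mulfZDr; first by apply: comp_div; rewrite sb.
by rewrite mulgVK.
Qed.

Lemma conv_lin_r (k : R[i]) a f f' : conv_defined a f -> conv_defined a f' ->
  conv_defined a (k *: f + f') /\ conv a (k *: f + f') = k *: conv a f + conv a f'.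
Proof.
move=> d d'; apply: conv_intro => g.
have : (fun S : {fset G} => k *: act a f S g + act a f' S g) @ fins (s g) -->
    k *: conv a f g + conv a f' g.
  by apply: cvgD; [apply: cvgZr|]; exact: conv_cvg.
apply: cvg_trans; apply: near_eq_cvg.
by apply: filterS (fins_over (s g)) => S oS; rewrite act_linr.
Qed.

Lemma conv_subl a a' f : conv_defined a f -> conv_defined a' f ->
  conv_defined (a - a') f /\ conv (a - a') f = conv a f - conv a' f.
Proof.
move=> d d'; have [h e] := conv_lin_l (-1) d' d.
by rewrite !scaleN1r ![- _ + _]addrC in h e.
Qed.

Lemma act_fin a f (S T : {fset G}) g : over (s g) S -> over (s g) T -> (S `<=` T)%fset ->
  (forall b, s b = s g -> b \notin S -> mulf g (a (mul g (inv b))) (f b) = 0) ->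
  act a f T g = act a f S g.
Proof.
move=> oS oT ST z; rewrite /act; apply/esym; apply: big_fset_incl => // b bT bS.
by apply: z => //; exact: oT.
Qed.

Lemma act_cvg_fin a f S g : over (s g) S ->
  (forall b, s b = s g -> b \notin S -> mulf g (a (mul g (inv b))) (f b) = 0) ->
  (fun T : {fset G} => act a f T g) @ fins (s g) --> act a f S g.
Proof.
move=> oS z; apply: cvg_near_cst.
by apply: filterS (fins_ge oS) => T [oT ST]; exact: act_fin.
Qed.

(** Test against k itself: <k,k> is the limit of <k, a f>, which is at most |k| M N in norm, and one
    factor |k| cancels. *)
Lemma n2_lim x F a f (k : sect B) (M N : R) : Ble a M -> 0 <= N -> s x = x -> over x F ->
  (forall S, over x S -> n2 x S f <= N) ->
  (forall g, g \in F -> (fun S : {fset G} => act a f S g) @ fins x --> (k g : fib g)) ->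
  n2 x F k <= M * N.
Proof.
move=> [M0 aM] N0 ux oF fN lim.
have [/eqP z|z] := eqVneq (n2 x F k) 0; first by rewrite (eqP z) mulr_ge0.
have kp : 0 < n2 x F k by rewrite lt_def z n2_ge0.
rewrite -(ler_pM2l kp) -expr2 n2_sq.
apply: (@rnorm_cvg_le _ _ _ (fins x) _ (fun S : {fset G} => ip x F k (act a f S))).
  apply: cvg_sum_seq => g gF; apply: cvg_mulfr; [exact: comp_invl | | exact: lim].
  by rewrite -[LHS](oF g gF).
apply: filterS (fins_over x) => S oS.
apply: le_trans (ip_CS ux oF _ _) _; rewrite ler_wpM2l ?n2_ge0//.
apply: le_trans (aM x F S f ux oF oS) _.
by rewrite ler_wpM2l// fN.
Qed.

(** Finiteness of the columns of the matrix a(g b^-1): for fixed b, the arrow g b^-1 runs over a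
    whole source fibre. Rows correspond in the same way to range fibres. *)
Definition col_finite a : Prop :=
  forall x, s x = x -> exists2 S : {fset G}, over x S &
    forall b, s b = x -> b \notin S -> a b = 0.

Definition row_finite a : Prop := col_finite (sstar a).

Definition approx (P : sect B -> Prop) a : Prop :=
  forall e : R, 0 < e -> exists2 c, P c & Ble (a - c) e.

Lemma row_finite_cvg c f g : row_finite c -> exists2 S, over (s g) S &
  (fun T : {fset G} => act c f T g) @ fins (s g) --> act c f S g.
Proof.
move=> /(_ (r g) (src_rng g)) [F oF hF].
(* A nonzero term at b has g b^-1 in the support of c; its inverse d then lies in F, and b = d g. *)
have oS : over (s g) [fset mul d g | d in F]%fset.
  by move=> b /imfsetP[d /oF dF ->]; rewrite (src_gmul HG).
exists [fset mul d g | d in F]%fset => //.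
apply: act_cvg_fin => // b bg bS.
have cb : composable G (mul g (inv b)) b by exact: comp_div.
rewrite (_ : c _ = 0) ?mulf0l ?mulgVK//.
have hb : inv (mul g (inv b)) \notin F.
  apply: contra bS => bF; apply/imfsetP; exists (inv (mul g (inv b))) => //=.
  by rewrite inv_div// mulgVK.
have := hF (inv (mul g (inv b))); rewrite src_inv rng_div// => /(_ erefl hb).
rewrite (@sstarE _ _ _ c _ (mul g (inv b))) ?invgK// => c0.
by rewrite -[LHS](starfK _ (erefl (inv (mul g (inv b))))) c0 starf0// invgK.
Qed.

(** For a row-finite c near a, the partial sums for a at g are uniformly close to those for c, which
    are eventually constant. *)
Lemma conv_def_l a h : approx row_finite a ->
  (forall x, s x = x -> exists N : R, forall S, over x S -> n2 x S h <= N) ->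
  conv_defined a h.
Proof.
move=> aP hN; apply/conv_definedP => g; apply: rnorm_cvg_unif => e e0.
have [N hS] := hN _ (src_src g).
have N0 : 0 <= N by apply: le_trans (hS fset0 _) => //; exact: n2_ge0.
(* The added 1 keeps the denominator positive when N = 0. *)
have e1 : 0 < e / (N + 1) by rewrite divr_gt0// ltr_wpDl.
have [c rc [_ ac]] := aP _ e1.
have [S0 oS0 hc] := row_finite_cvg h g rc.
exists (fun T : {fset G} => act c h T g); first by apply/cvg_ex; exists (act c h S0 g).
apply: filterS (fins_over (s g)) => S oS.
have -> : act a h S g - act c h S g = act (a - c) h S g.
  by rewrite addrC -[- act _ _ _ _]scaleN1r -act_lin// scaleN1r [- c + a]addrC.
rewrite -n2_1; apply: le_trans (ac _ _ S _ (src_src g) _ oS) _.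
  by move=> k; rewrite inE => /eqP ->.
apply: le_trans (ler_wpM2l (ltW e1) (hS _ oS)) _.
by rewrite mulrAC ler_pdivrMr ?ltr_wpDl// mulrDr mulr1 lerDl ltW.
Qed.

(** As [conv_def_l], with the right factor approximated: each column of h - c has norm at most that
    of h - c. *)
Lemma conv_def_r a h M : Ble a M -> approx col_finite h -> conv_defined a h.
Proof.
move=> [M0 aM] hP; apply/conv_definedP => g; apply: rnorm_cvg_unif => e e0.
have e1 : 0 < e / (M + 1) by rewrite divr_gt0// ltr_wpDl.
have [c rc hc] := hP _ e1.
have [S0 oS0 cS0] := rc _ (src_src g).
exists (fun T : {fset G} => act a c T g).
  apply/cvg_ex; exists (act a c S0 g); apply: act_cvg_fin => // b bg bS.
  by rewrite (cS0 b bg bS) mulf0r ?mulgVK//; exact: comp_div.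
apply: filterS (fins_over (s g)) => S oS.
have -> : act a h S g - act a c S g = act a (h - c) S g.
  by rewrite addrC -[- act _ _ _ _]scaleN1r -act_linr// scaleN1r [- c + h]addrC.
rewrite -n2_1; apply: le_trans (aM _ _ S _ (src_src g) _ oS) _.
  by move=> k; rewrite inE => /eqP ->.
apply: le_trans (ler_wpM2l M0 (Ble_n2 hc (src_src g) oS)) _.
by rewrite mulrCA ler_piMr ?(ltW e0)// ler_pdivrMr ?ltr_wpDl// mul1r lerDl.
Qed.

Lemma Ble_l2 a M x : Ble a M -> s x = x ->
  exists N : R, forall S, over x S -> n2 x S a <= N.
Proof. by move=> aM ux; exists M => S oS; exact: Ble_n2. Qed.

(** Right translation maps the source fibre of s b bijectively onto that of r b; it reindexes the
    inner sum of a double convolution. *)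
Definition rtr b (T : {fset G}) : {fset G} := [fset mul t (inv b) | t in T]%fset.

Lemma rtr_over b (T : {fset G}) : over (s b) T -> over (r b) (rtr b T).
Proof. by move=> oT c /imfsetP[t /oT tb ->]; exact: src_div. Qed.

Lemma rtr_cvg b : rtr b @ fins (s b) --> fins (r b).
Proof.
move=> A [S oS SA]; exists [fset mul c b | c in S]%fset.
  move=> g /imfsetP[c /oS cb ->]; exact (src_gmul HG cb).
move=> T [oT ST]; apply: SA; split; first exact: rtr_over.
apply/fsubsetP => c cS; apply/imfsetP; exists (mul c b).
  by apply: (fsubsetP ST); apply/imfsetP; exists c.
by rewrite mulgK//; exact: oS.
Qed.

Lemma act_rtr a f b (T : {fset G}) g : over (s b) T ->
  act a f (rtr b T) g =
  \sum_(t <- T) mulf g (a (mul g (inv (mul t (inv b))))) (f (mul t (inv b))).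
Proof.
move=> oT; rewrite /act big_imfset //= => t t' /oT tb /oT tb' e.
by rewrite -(mulgVK tb) e mulgVK.
Qed.

(** For finite S and T the sums over c in S and t in T may be exchanged. The sum over t, with f(c)
    factored out on the right, is then a partial sum of (a b)(g c^-1) over the translate of T by
    c^-1, and T grows. *)
Lemma act_act_cvg a b f (S : {fset G}) g : conv_defined a b -> over (s g) S ->
  (fun T : {fset G} => act a (act b f S) T g) @ fins (s g) --> act (conv a b) f S g.
Proof.
move=> dab oS.
have H : (fun T : {fset G} => \sum_(c <- S)
    mulf g (act a b (rtr c T) (mul g (inv c))) (f c)) @ fins (s g) -->
    act (conv a b) f S g.
  apply: cvg_sum_seq => c cS; have cg := oS _ cS.
  have gc := esym cg.
  apply: cvg_mulfl; [exact: comp_div | by rewrite mulgVK |].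
  have := @rtr_cvg c; rewrite cg -(src_div gc) => rc.
  exact: (cvg_comp (rtr c) (fun S : {fset G} => act a b S (mul g (inv c))) rc (conv_cvg dab)).
apply: cvg_trans H; apply: near_eq_cvg.
apply: filterS (fins_over (s g)) => T oT.
rewrite [RHS]/act.
transitivity (\sum_(c <- S) \sum_(t <- T)
   mulf g (a (mul g (inv t))) (mulf t (b (mul t (inv c))) (f c))).
  apply: eq_big_seq => c cS; have cg := oS _ cS.
  have gc := esym cg.
  have c1 : composable G (mul g (inv c)) c by exact: comp_div.
  have e1 : g = mul (mul g (inv c)) c by rewrite mulgVK.
  have oT' : over (s c) T by rewrite cg.
  rewrite act_rtr// mulf_suml//; apply: eq_big_seq => t tT.
  have tg := oT _ tT.
  have e : mul (mul g (inv c)) (inv (mul t (inv c))) = mul g (inv t).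
    have c2 : composable G c (inv t) by rewrite /composable rng_inv tg.
    by rewrite inv_div ?tg ?cg// -(gmulA HG c1 c2) mulgVK.
  rewrite (mulf_idx _ _ _ e).
  apply: mulfA => //.
  - by rewrite /composable rng_div ?tg ?cg// src_div// tg.
  - by apply: comp_div; rewrite tg.
  - by rewrite -e mulgVK// !src_div ?tg ?cg// -?tg.
  - by rewrite mulgVK// tg.
transitivity (\sum_(t <- T) \sum_(c <- S)
   mulf g (a (mul g (inv t))) (mulf t (b (mul t (inv c))) (f c))).
  exact: exchange_big.
apply: eq_big_seq => t tT; have tg := oT _ tT.
rewrite /act mulf_sumr//; [exact: comp_div | by rewrite mulgVK].
Qed.

Lemma Ble_conv a b M N : conv_defined a b -> Ble a M -> Ble b N ->
  Ble (conv a b) (M * N).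
Proof.
move=> dab aM bN; split=> [|x F S f ux oF oS]; first exact: mulr_ge0 aM.1 bN.1.
rewrite -mulrA; apply: (n2_lim (f := act b f S) aM) => //.
- by rewrite mulr_ge0 ?n2_ge0 ?bN.1.
- by move=> S' oS'; exact: bN.2.
- by move=> g gF; rewrite -(oF _ gF); apply: act_act_cvg => //; rewrite oF.
Qed.

Lemma col_finite_act a f x (S : {fset G}) g : s g = x -> over x S ->
  (forall b, s b = x -> b \notin S -> f b = 0) ->
  (fun T : {fset G} => act a f T g) @ fins (s g) --> act a f S g.
Proof.
move=> gx oS fS; apply: act_cvg_fin; rewrite gx// => b bx bS.
by rewrite (fS b bx bS) mulf0r ?mulgVK ?gx ?bx//; apply: comp_div; rewrite gx.
Qed.

Lemma conv_col_finite a f x (S : {fset G}) g : s g = x -> over x S ->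
  (forall b, s b = x -> b \notin S -> f b = 0) -> conv a f g = act a f S g.
Proof. by move=> gx oS fS; apply: convE; apply: col_finite_act gx oS fS. Qed.

Lemma col_finite_defined a f : col_finite f -> conv_defined a f.
Proof.
move=> cf; apply/conv_definedP => g; have [S oS fS] := cf _ (src_src g).
by apply/cvg_ex; exists (act a f S g); exact: col_finite_act (erefl _) oS fS.
Qed.

Lemma conv_assoc_col a b f : conv_defined a b -> col_finite f ->
  conv_defined a (conv b f) /\ conv a (conv b f) = conv (conv a b) f.
Proof.
move=> dab cf; apply: conv_intro => g; have [S oS fS] := cf _ (src_src g).
rewrite (conv_col_finite _ (erefl (s g)) oS fS).
have H := act_act_cvg (f := f) dab oS; apply: cvg_trans H; apply: near_eq_cvg.
apply: filterS (fins_over (s g)) => T oT.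
apply: eq_big_seq => t tT; congr (mulf g _ _).
by rewrite (conv_col_finite _ (oT _ tT) oS fS).
Qed.

Lemma sstar_lin (k : R[i]) a b : sstar (k *: a + b) = k^* *: sstar a + sstar b.
Proof.
apply/functional_extensionality_dep => g.
by rewrite [LHS](sstarE _ (erefl _)) starfZD ?invgK// -!(sstarE _ (erefl (inv g))).
Qed.

Lemma sstarB a b : sstar (a - b) = sstar a - sstar b.
Proof.
have := sstar_lin (-1) b a; rewrite rmorphN1 !scaleN1r.
by rewrite [- b + _]addrC [- sstar b + _]addrC.
Qed.

(** The term b*(g t^-1) a*(t) is the star of a(t^-1) b(t g^-1), so the second factor is translated
    by g^-1. *)
Lemma act_sstar a b g (S : {fset G}) : over (s g) S ->
  act (sstar b) (sstar a) S g = starf g (act a b (rtr g S) (inv g)).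
Proof.
move=> oS; rewrite act_rtr// starf_sum ?invgK//; apply: eq_big_seq => t tS.
have tg := oS _ tS; have gt := esym tg.
have e1 : mul (inv g) (inv (mul t (inv g))) = inv t.
  by rewrite inv_div// mulVKg// /composable rng_inv.
rewrite (mulf_idx _ _ _ e1).
rewrite (@starf_mulf _ _ _ (inv t) (mul t (inv g)) t (mul g (inv t)) (inv g))//.
- by rewrite (@sstarE _ _ _ b _ (mul t (inv g))) ?inv_div.
- by rewrite /composable src_inv rng_div.
- by rewrite invgK.
- by rewrite inv_div.
- by rewrite mulVKg// /composable rng_inv.
- by rewrite invgK.
Qed.

Lemma conv_star a b : conv_defined a b ->
  conv_defined (sstar b) (sstar a) /\ conv (sstar b) (sstar a) = sstar (conv a b).
Proof.
move=> dab; apply: conv_intro => g; rewrite (sstarE _ (erefl _)).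
have H : (fun S : {fset G} => starf g (act a b (rtr g S) (inv g))) @ fins (s g) -->
    starf g (conv a b (inv g)).
  apply: cvg_starf; first by rewrite invgK.
  have := @rtr_cvg g; rewrite -(src_inv g) => rc.
  exact: (cvg_comp (rtr g) (fun S : {fset G} => act a b S (inv g)) rc (conv_cvg dab)).
apply: cvg_trans H; apply: near_eq_cvg.
by apply: filterS (fins_over (s g)) => S oS; rewrite act_sstar.
Qed.

Lemma conv_assoc_row c b m : conv_defined b m -> row_finite c ->
  conv_defined (conv c b) m /\ conv (conv c b) m = conv c (conv b m).
Proof.
move=> dbm rc; have [d1 e1] := conv_star dbm.
have [d2 e2] := conv_assoc_col d1 rc.
have [d3 e3] := conv_star d2.
have dcb : conv_defined (sstar b) (sstar c) := @col_finite_defined (sstar b) _ rc.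
have [d4 e4] := conv_star dcb.
have [d5 e5] := conv_star (@col_finite_defined (conv (sstar m) (sstar b)) _ rc).
rewrite !sstarK in d3 e3 d4 e4 d5 e5.
rewrite -e4 in d3 e3; split=> //.
by rewrite e3 e2 -e5 e1 sstarK.
Qed.

Lemma sect_eps a b : (forall e : R, 0 < e -> exists2 c, c < e & Ble (a - b) c) -> a = b.
Proof.
move=> H; apply/functional_extensionality_dep => g; apply/subr0_eq.
apply: rnorm_eps => e e0; have [c ce ab] := H e e0.
by apply: le_trans (ltW ce); exact: Ble_rnorm ab.
Qed.

Lemma conv_assoc a b m (L M N : R) : approx row_finite a -> Ble a L -> Ble b M ->
  Ble m N -> conv_defined b m -> conv_defined (conv a b) m ->
  conv (conv a b) m = conv a (conv b m).
Proof.
move=> aP aL bM mN dbm dabm; apply: sect_eps => e e0.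
have M0 := bM.1; have N0 := mN.1.
have MN0 : 0 <= M * N by exact: mulr_ge0.
(* Replacing a by c costs d M N on each side of the identity, in total 2 d M N < e. *)
pose d := e / (2 * (M * N) + 1).
have d0 : 0 < d by rewrite divr_gt0//; lra.
have [c rc ac] := aP d d0.
have [dcbm ecbm] := conv_assoc_row dbm rc.
have bmP := Ble_conv dbm bM mN.
have dab : conv_defined a b by apply: conv_def_l => // x; exact: (Ble_l2 bM).
have dcb : conv_defined c b.
  apply: conv_def_l => [e' e'0|x]; last exact: (Ble_l2 bM).
  exists c => //; rewrite subrr; apply: BleW (Ble0 _); exact: ltW.
have dabm' : conv_defined a (conv b m).
  by apply: conv_def_l => // x; exact: (Ble_l2 bmP).
have dcbm' : conv_defined c (conv b m).
  apply: conv_def_l => [e' e'0|x]; last exact: (Ble_l2 bmP).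
  exists c => //; rewrite subrr; apply: BleW (Ble0 _); exact: ltW.
have [h1 e1] := conv_subl dab dcb.
have [h2 e2] := conv_subl dabm dcbm.
have [h3 e3] := conv_subl dabm' dcbm'.
have h4 : conv_defined (conv (a - c) b) m by rewrite e1.
have k1 := Ble_conv h4 (Ble_conv h1 ac bM) mN.
have k2 := Ble_conv h3 ac bmP.
rewrite e1 e2 in k1; rewrite e3 in k2.
exists (d * M * N + d * (M * N)).
  rewrite -mulrA -mulrDr /d mulrAC ltr_pdivrMr; last lra.
  by nra.
have := BleB k1 k2.
by rewrite ecbm opprB addrA subrK.
Qed.

End Convolution.

(** * The norm of bounded sections *)

Section Normb.
Variables (R : realType) (G : etale_groupoid) (B : fell_bundle R G).
Local Notation s := (src G).
Local Notation fib := (fibre B).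
Implicit Types (x g : G) (a f : sect B) (F S : {fset G}).

Let norm2_set x f : set \bar R :=
  [set (Num.sqrt (rnorm
           (\sum_(g <- F) coord x (fmul (fstar (sect_val f g)) (sect_val f g)))%R))%:E
    | F in [set F : {fset G} | forall g, g \in F -> s g = x]].

Let n2E x F f : over x F -> Num.sqrt (rnorm
   (\sum_(g <- F) coord x (fmul (fstar (sect_val f g)) (sect_val f g)))) = n2 x F f.
Proof.
move=> oF; congr (Num.sqrt (rnorm _)); apply: eq_big_seq => g gF.
by rewrite prf_emb.
Qed.

Lemma norm2_ge0 f : (0 <= norm2 f)%E.
Proof. by rewrite /norm2 le_max lexx. Qed.

Lemma n2_le_norm2 f x F : s x = x -> over x F -> ((n2 x F f)%:E <= norm2 f)%E.
Proof.
move=> ux oF; rewrite /norm2 le_max; apply/orP; right.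
apply: (@le_trans _ _ (ereal_sup (norm2_set x f))).
  by apply: ereal_sup_ubound; exists F => //; rewrite n2E.
by apply: ereal_sup_ubound; exists x => //; apply/unitsP.
Qed.

Lemma norm2_le f (t : R) : 0 <= t ->
  (forall x F, s x = x -> over x F -> n2 x F f <= t) -> (norm2 f <= t%:E)%E.
Proof.
move=> t0 H; rewrite /norm2 ge_max lee_fin t0 /=.
apply: ge_ereal_sup => _ [x /unitsP ux <-].
apply: ge_ereal_sup => _ [F oF <-].
by rewrite lee_fin n2E// H.
Qed.

Let restr f S : sect B := fun g => if g \in S then f g else 0.

Let restr_fin f S : finitely_supported B (restr f S).
Proof.
apply: (@sub_finite_set _ _ [set` S]); last exact: finite_fset.
by move=> g; rewrite /supp /restr /=; case: ifP => //; rewrite eqxx.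
Qed.

Let n2_restr x S f x' F : s x' = x' -> over x S -> over x' F -> 
  n2 x' F (restr f S) <= n2 x S f.
Proof.
move=> ux' oS oF.
have [e|ne] := pselect (x' = x); last first.
  rewrite /n2 /ip big_seq big1 ?rnorm0 ?sqrtr0 ?sqrtr_ge0// => g gF.
  rewrite /restr ifN ?prf0l ?(oF _ gF)//; apply/negP => gS; apply: ne.
  by rewrite -(oF _ gF) (oS _ gS).
rewrite e in ux' oF *.
apply: (@le_trans _ _ (n2 x (F `|` S)%fset (restr f S))).
  by apply: n2_fsubset => //; [exact: (overU oF oS) | exact: fsubsetUl].
rewrite /n2 /ip -(@big_fset_incl _ _ _ _ S) ?fsubsetUr//.
  rewrite le_eqVlt; apply/orP; left; apply/eqP; congr (Num.sqrt (rnorm _)).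
  by apply: eq_big_seq => g gS; rewrite /restr gS.
move=> g; rewrite inE => gU gS.
by rewrite /restr (negbTE gS) prf0l//; case/orP: gU => [/oF|/oS].
Qed.

Lemma act_restr a f S g : act a (restr f S) S g = act a f S g.
Proof. by apply: eq_big_seq => b bS; rewrite /restr bS. Qed.

(** A finitely supported f meets each source fibre in a finite set S, where a f is the finite sum
    [act a f S]. Conversely, a block bound for arbitrary f is tested on the restriction of f to
    S. *)
Lemma normb_leP a (M : R) : 0 <= M -> (normb a <= M%:E)%E <-> Ble a M.
Proof.
move=> M0; split=> [H|[_ H]]; last first.
  apply: ge_ereal_sup => _ [f ff <-].
  have fin_x x : s x = x -> exists2 S : {fset G}, over x S &
      forall b, s b = x -> b \notin S -> f b = 0.
    move=> ux; exists [fset g in fset_set (supp f) | s g == x]%fset.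
      by move=> g; rewrite !inE => /andP[_ /eqP].
    move=> b bx; rewrite !inE /= bx eqxx andbT in_fset_set// => bS.
    by apply/eqP; apply: contraNT bS => fb; rewrite inE.
  have bnd (t : R) : 0 <= t -> (norm2 f <= t%:E)%E -> (norm2 (conv a f) <= (M * t)%:E)%E.
    move=> t0 ft; apply: norm2_le => [|x F ux oF]; first exact: mulr_ge0.
    have [S oS fS] := fin_x x ux.
    have -> : n2 x F (conv a f) = n2 x F (act a f S).
      congr (Num.sqrt (rnorm _)).
      by apply: ip_eq => g /oF gx; rewrite (conv_col_finite _ gx oS fS).
    apply: le_trans (H x F S f ux oF oS) _; rewrite ler_wpM2l//.
    by rewrite -lee_fin; apply: le_trans ft; exact: n2_le_norm2.
  have := norm2_ge0 f; case: (norm2 f) bnd => [t||] bnd //.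
  - rewrite lee_fin => tge.
    (* Dividing by zero gives +oo, so for t = 0 the numerator must be shown to vanish for the
       quotient to be 0. *)
    have /predU1P[t0|t0] : (0 == t) || (0 < t) by rewrite -le_eqVlt.
      have c0 : norm2 (conv a f) = 0%E.
        apply/eqP; rewrite eq_le norm2_ge0 andbT.
        by have := bnd 0 (lexx _); rewrite mulr0; apply; rewrite -t0.
      by rewrite c0 mul0e lee_fin.
    by rewrite inver gt_eqF// lee_pdivrMr// -EFinM; apply: bnd; [exact: ltW | exact: lexx].
  (* The inverse of +oo is 0, which makes the quotient 0. *)
  - by rewrite invey mule0 lee_fin.
split=> // x F S f ux oF oS.
pose f' := restr f S.
have nf' : norm2 f' = (n2 x S f)%:E.
  apply/eqP; rewrite eq_le norm2_le ?n2_ge0//=; last first.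
    by move=> x' F' ux' oF'; exact: n2_restr.
  have -> : n2 x S f = n2 x S f'.
    by congr (Num.sqrt (rnorm _)); apply: ip_eq => g gS; rewrite /f' /restr gS.
  exact: n2_le_norm2.
have h : (norm2 (conv a f') / norm2 f' <= M%:E)%E.
  by apply: le_trans H; apply: ereal_sup_ubound; exists f' => //; exact: restr_fin.
have h2 : ((n2 x F (conv a f'))%:E <= norm2 (conv a f'))%E by exact: n2_le_norm2.
have e : n2 x F (conv a f') = n2 x F (act a f S).
  congr (Num.sqrt (rnorm _)); apply: ip_eq => g /oF gx;
  rewrite (@conv_col_finite _ _ _ a f' x S)// ?act_restr// => b _ bS;
  by rewrite /f' /restr (negbTE bS).
(* When f has norm 0 on S the quotient says nothing, but then f vanishes on S and so does its
   image. *)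
have /predU1P[z|p] : (0 == n2 x S f) || (0 < n2 x S f) by rewrite -le_eqVlt n2_ge0.
  have z0 : n2 x F (act a f S) = 0.
    rewrite /n2 (_ : ip _ _ _ _ = 0) ?rnorm0 ?sqrtr0// /ip big_seq big1// => g gF.
    rewrite (_ : act a f S g = 0) ?prf0l ?(oF _ gF)// /act big_seq big1// => b bS.
    have gb : s g = s b by rewrite (oF _ gF) (oS _ bS).
    rewrite (_ : f b = 0) ?mulf0r ?mulgVK//; first exact: comp_div.
    apply/eqP; rewrite -rnorm_eq0 eq_le rnorm_ge0 andbT z.
    exact: rnorm_n2.
  by rewrite z0 -z mulr0.
move: h; rewrite nf' inver gt_eqF// lee_pdivrMr// -EFinM => h.
by rewrite -e -lee_fin; apply: le_trans h2 h.
Qed.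

Lemma normb_ge0 a : (0 <= normb a)%E.
Proof.
apply: (@le_trans _ _ (norm2 (conv a 0) / norm2 (0 : sect B))%E).
  by rewrite mule_ge0 ?inve_ge0 ?norm2_ge0.
apply: ereal_sup_ubound; exists 0 => //.
apply: (@sub_finite_set _ _ set0) => // g; rewrite /supp /=.
by rewrite (_ : (0 : sect B) g = 0) ?eqxx.
Qed.

Definition bnorm a : R := fine (normb a).

Lemma normbE a M : Ble a M -> normb a = (bnorm a)%:E.
Proof.
move=> aM; rewrite /bnorm fineK// ge0_fin_numE ?normb_ge0//.
by apply: le_lt_trans ((normb_leP a aM.1).2 aM) _; exact: ltry.
Qed.

Lemma Ble_bnorm a M : Ble a M -> Ble a (bnorm a).
Proof.
move=> aM; have e := normbE aM.
have b0 : 0 <= bnorm a by rewrite -lee_fin -e normb_ge0.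
by apply/normb_leP => //; rewrite e.
Qed.

Lemma bnorm_le a M : Ble a M -> bnorm a <= M.
Proof.
by move=> aM; rewrite -lee_fin -(normbE aM); exact: (normb_leP a aM.1).2.
Qed.

Lemma normb_fin a : (normb a < +oo)%E -> Ble a (bnorm a).
Proof.
move=> h; have e : normb a = (bnorm a)%:E by rewrite /bnorm fineK// ge0_fin_numE ?normb_ge0.
have b0 : 0 <= bnorm a by rewrite -lee_fin -e normb_ge0.
by apply/normb_leP => //; rewrite e.
Qed.

End Normb.

(** * Slices and continuity of convolutions *)

(** Turns continuity of a partial operation on its domain A into a rule for filters that eventually
    stay in A; applied to composable pairs and to pairs in one fibre. *)
Lemma cvg_within_comp (X Y : topologicalType) (A : set X) (op : X -> Y) (p : X)
    (I : Type) (F : set_system I) (h : I -> X) : Filter F ->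
  {within A, continuous op} -> A p -> h @ F --> p ->
  (\forall i \near F, A (h i)) -> (op \o h) @ F --> op p.
Proof.
move=> FF /subspace_continuousP/(_ p) c Ap hp hA.
apply: cvg_comp (c Ap) => W /hp hW.
by apply: filterS2 hA hW => i Ai; apply.
Qed.

Section EtaleTopology.
Variable G : etale_groupoid.
Local Notation s := (src G).
Local Notation r := (rng G).
Local Notation inv := (ginv G).
Local Notation mul := (gmul G).
Implicit Types (x y g k l : G) (U V O K L : set G).

Let HG := etale_is_groupoid G.

Lemma cvg_gmul (I : Type) (F : set_system I) (u v : I -> G) k l : Filter F ->
  composable G k l -> u @ F --> k -> v @ F --> l ->
  (\forall i \near F, composable G (u i) (v i)) ->
  (fun i => mul (u i) (v i)) @ F --> mul k l.
Proof.
move=> FF c uk vl uv.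
apply: (@cvg_within_comp _ _ _ _ (k, l) _ _ (fun i => (u i, v i)) _ (gmul_continuous (e := G)) c) => //.
exact: cvg_pair.
Qed.

Lemma src_continuous : continuous s.
Proof.
move=> g; apply: cvg_gmul => //; first exact: comp_invl.
  exact: ginv_continuous.
by apply: nearW => i; exact: comp_invl.
Qed.

Lemma rng_continuous : continuous r.
Proof.
move=> g; have -> : r = s \o inv by apply/funext => h /=; rewrite src_inv.
apply: continuous_comp; [exact: ginv_continuous | exact: src_continuous].
Qed.

Lemma inv_image U : inv @` U = inv @^-1` U.
Proof.
apply/seteqP; split=> g /=; first by case=> h Uh <-; rewrite invgK.
by move=> Ug; exists (inv g); rewrite ?invgK.
Qed.

Lemma inv_open U : open U -> open (inv @` U).
Proof.
by rewrite inv_image => oU; apply: open_comp => // g _; exact: ginv_continuous.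
Qed.

Lemma rng_image U : r @` U = s @` (inv @` U).
Proof.
apply/seteqP; split=> _ [g Ug <-].
  by exists (inv g); [exists g | rewrite src_inv].
by case: Ug => h Uh <-; exists h => //; rewrite src_inv.
Qed.

Lemma src_image U : s @` U = r @` (inv @` U).
Proof. by rewrite rng_image !inv_image; congr (_ @` _); apply/seteqP; split=> g /=; rewrite invgK. Qed.

Lemma rng_open U : open U -> open (r @` U).
Proof. by move=> oU; rewrite rng_image; apply: src_open; exact: inv_open. Qed.

Definition closed_units U : Prop := closed (U : set (subspace (units G))).

Lemma closed_unitsP U : closed_units U <->
  (forall x, units G x -> ~ U x -> exists2 V, nbhs x V & V `&` U `<=` ~` units G).
Proof.
split.
  move=> /closed_subspaceP[V cV VU] x ux nUx.
  exists (~` V).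
    apply: open_nbhs_nbhs; split; first exact: closed_openC.
    by move=> Vx; apply: nUx; have [] : (U `&` units G) x by rewrite -VU.
  by move=> y [nVy Uy] uy; apply: nVy; have [] : (V `&` units G) y by rewrite VU.
move=> H; apply/closed_subspaceP; exists (closure (U `&` units G)).
  exact: closed_closure.
apply/seteqP; split=> x [cx ux]; split=> //; last exact: subset_closure.
apply: contrapT => nUx; have [V Vx VU] := H x ux nUx.
by have [y [[Uy uy] Vy]] := cx V Vx; have := VU y (conj Vy Uy).
Qed.

(* The point of the slice [O] with the same range as [g], or [g] if there is none. *)
Definition kap O g : G :=
  if pselect (exists k, O k /\ r k = r g) is left e then sval (cid e) else g.

Lemma kapP O g : (r @` O) (r g) -> O (kap O g) /\ r (kap O g) = r g.
Proof.
move=> [k Ok kg]; rewrite /kap; case: pselect => [e|]; first by case: cid.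
by case; exists k.
Qed.

Lemma kap_uniq O g k : set_inj O r -> O k -> r k = r g -> kap O g = k.
Proof.
move=> iO Ok kg; have [|O' e] := @kapP O g; first by exists k.
by apply: iO; rewrite ?inE// e.
Qed.

Lemma near_rng_image O g : open O -> (r @` O) (r g) ->
  \forall h \near g, (r @` O) (r h).
Proof.
move=> oO Og; apply: (rng_continuous (x := g)).
by apply: open_nbhs_nbhs; split=> //; exact: rng_open.
Qed.

(** r is injective and open on O: if U is a neighbourhood of [kap O g], then every h with range in
    the open set r[U [&] O] has [kap O h] in U. *)
Lemma kap_cvg O g : open O -> set_inj O r -> (r @` O) (r g) ->
  kap O @ g --> kap O g.
Proof.
move=> oO iO Og; have [Ok kg] := kapP Og.
move=> W; rewrite nbhsE => -[U [oU Uk] UW].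
have oUO : open (U `&` O) by exact: openI.
have : \forall h \near g, (r @` (U `&` O)) (r h).
  by apply: near_rng_image => //; exists (kap O g).
apply: filterS => h [k [Uk' Ok'] kh].
by rewrite /= (kap_uniq iO Ok' kh); exact: UW.
Qed.

(* [lam O g] is the other factor of [g = kap O g * lam O g]. *)
Definition lam O g : G := mul (inv (kap O g)) g.

Lemma lam_cvg O g : open O -> set_inj O r -> (r @` O) (r g) -> lam O @ g --> lam O g.
Proof.
move=> oO iO Og; apply: cvg_gmul => //.
- by have [_] := kapP Og; rewrite /composable src_inv.
- by apply: (cvg_comp _ _ (kap_cvg oO iO Og)); exact: ginv_continuous.
- apply: filterS (near_rng_image oO Og) => h /kapP[_ e].
  by rewrite /composable src_inv.
Qed.

Lemma kap_lam O g : (r @` O) (r g) ->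
  composable G (kap O g) (lam O g) /\ g = mul (kap O g) (lam O g).
Proof.
move=> /kapP[_ e]; split; last by rewrite mulKg.
by rewrite /composable rng_ldiv.
Qed.

Definition setM K L : set G :=
  [set g | exists k l, [/\ K k, L l, composable G k l & g = mul k l]].

Lemma setMS K L U V : K `<=` U -> L `<=` V -> setM K L `<=` setM U V.
Proof. by move=> KU LV g [k [l [Kk Ll c e]]]; exists k, l; split; auto. Qed.

Lemma setM_kap O L g : set_inj O r -> setM O L g -> (r @` O) (r g) /\ L (lam O g).
Proof.
move=> iO [k [l [Ok Ll c e]]].
have kg : r k = r g by rewrite e (rng_gmul HG).
split; first by exists k.
by rewrite /lam (kap_uniq iO Ok kg) e mulVKg.
Qed.

(** g lies in O U exactly when r g is in r[O] and [lam O g] is in U, and both conditions are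
    open. *)
Lemma setM_open O U : open O -> set_inj O r -> open U -> open (setM O U).
Proof.
move=> oO iO oU; rewrite openE => g /(setM_kap iO)[Og Ug].
have h1 := near_rng_image oO Og.
have h2 : \forall h \near g, U (lam O h).
  by apply: (lam_cvg oO iO Og); exact: open_nbhs_nbhs.
apply: filterS2 h1 h2 => h Oh Uh; have [Ok _] := kapP Oh.
by have [c e] := kap_lam Oh; exists (kap O h), (lam O h).
Qed.

Lemma setM_slice K L : slice K -> slice L -> slice (setM K L).
Proof.
move=> [sK rK] [sL rL]; split=> g h; rewrite !inE => -[k [l [Kk Ll c ->]]];
    move=> [k' [l' [Kk' Ll' c' ->]]].
  rewrite !(src_gmul HG)// => e.
  have ll : l = l' by apply: sL; rewrite ?inE.
  by congr mul => //; apply: sK; rewrite ?inE// c c' ll.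
rewrite !(rng_gmul HG)// => e.
have kk : k = k' by apply: rK; rewrite ?inE.
by congr mul => //; apply: rL; rewrite ?inE// -c -c' kk.
Qed.

Lemma slice_inv K : slice K -> slice (inv @` K).
Proof.
by move=> [sK rK]; split=> g h; rewrite !inE => -[k Kk <-] [k' Kk' <-];
  rewrite ?src_inv ?rng_inv => e; congr inv; [apply: rK | apply: sK]; rewrite ?inE.
Qed.

Lemma bicompact_inv K : bicompact K -> bicompact (inv @` K).
Proof.
move=> [[cs cr] cK [O [oO sO KO]]]; split.
- by split; [rewrite -rng_image | rewrite -src_image].
- apply: continuous_compact => //; apply: continuous_in_subspaceT => g _.
  exact: ginv_continuous.
- exists (inv @` O); split; [exact: inv_open | exact: slice_inv |].
  by move=> _ [k Kk <-]; exists k => //; exact: KO.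
Qed.

(** Let x be a unit outside s[K L]. If x is outside s[L], closedness of s[L] suffices. Otherwise x =
    s l with l in L and r l outside s[K]; this persists for the arrows of the slice around L near l,
    and injectivity of s there excludes any other candidate. *)
Lemma setM_src_closed K L : bicompact K -> bicompact L -> closed_units (s @` setM K L).
Proof.
move=> [[csK _] _ _] [[csL _] _ [O [oO [sO rO] LO]]].
have /closed_subspaceP[V cV VU] := csK.
have sKP l : V (r l) -> (s @` K) (r l).
  move=> Vl; have [//] : ((s @` K) `&` units G) (r l).
  by rewrite -VU; split=> //; apply/unitsP; exact: src_rng.
have sKV k : K k -> V (s k).
  move=> Kk; have [//] : (V `&` units G) (s k).
  by rewrite VU; split; [exists k | apply/unitsP; exact: src_src].
apply/closed_unitsP => x ux nx.
have [[l Ll lx]|nLx] := pselect ((s @` L) x); last first.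
  have [W Wx WU] := (closed_unitsP _).1 csL x ux nLx; exists W => //.
  move=> y [Wy [_ [k [l [Kk Ll c ->]]] e]]; apply: WU; split=> //.
  by exists l => //; rewrite -e (src_gmul HG).
have nVl : ~ V (r l).
  move=> /sKP[k Kk kl]; apply: nx; exists (mul k l).
    by exists k, l.
  by rewrite (src_gmul HG).
pose U := O `&` r @^-1` (~` V).
have oU : open U.
  apply: openI => //; apply: open_comp; last exact: closed_openC.
  by move=> g _; exact: rng_continuous.
exists (s @` U).
  apply: open_nbhs_nbhs; split; first exact: src_open.
  by exists l => //; split=> //; exact: LO.
move=> _ [[u [Ou nVu] <-] [_ [k [l' [Kk Ll' c ->]]]]].
rewrite (src_gmul HG)// => e; case: nVu.
have -> : u = l' by apply: sO; rewrite ?inE//; exact: LO.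
by rewrite -c; exact: sKV.
Qed.

Lemma setM_inv K L : inv @` setM K L = setM (inv @` L) (inv @` K).
Proof.
apply/seteqP; split=> g.
  case=> _ [k [l [Kk Ll c ->]]] <-; exists (inv l), (inv k); split.
  - by exists l.
  - by exists k.
  - by rewrite /composable src_inv rng_inv.
  - exact: inv_mul.
case=> _ [_ [[l Ll <-] [k Kk <-] c ->]]; exists (mul k l).
  exists k, l; split=> //.
  by move: c; rewrite /composable src_inv rng_inv.
by rewrite inv_mul//; move: c; rewrite /composable src_inv rng_inv.
Qed.

(** K L is the image of those l in L with r l in s[K], a relatively closed and hence compact part of
    L, under the continuous map that multiplies l by the unique composable arrow of the slice around
    K. *)
Lemma setM_compact K L : bicompact K -> bicompact L -> compact (setM K L).
Proof.
move=> [[csK _] _ [O [oO [sO rO] KO]]] [_ cL _].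
have /closed_subspaceP[V cV VU] := csK.
have sKP l : V (r l) -> (s @` K) (r l).
  move=> Vl; have [//] : ((s @` K) `&` units G) (r l).
  by rewrite -VU; split=> //; apply/unitsP; exact: src_rng.
have sKV k : K k -> V (s k).
  move=> Kk; have [//] : (V `&` units G) (s k).
  by rewrite VU; split; [exists k | apply/unitsP; exact: src_src].
pose L' := L `&` r @^-1` V.
have cL' : compact L'.
  apply: compact_closedI => //; apply: closed_comp => // g _.
  exact: rng_continuous.
(* the element of [O] composable with [l] on its left *)
pose q l := inv (kap (inv @` O) l).
have iO : set_inj (inv @` O) r by have [] := slice_inv (conj sO rO).
have oO' : open (inv @` O) by exact: inv_open.
have inO l : V (r l) -> (r @` (inv @` O)) (r l).
  by move=> /sKP[k Kk <-]; rewrite -src_image; exists k => //; exact: KO.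
have qP k l : K k -> composable G k l -> q l = k.
  move=> Kk c; rewrite /q (@kap_uniq _ _ (inv k)) ?invgK//.
    by exists k => //; exact: KO.
  by rewrite rng_inv.
have -> : setM K L = (fun l => mul (q l) l) @` L'.
  apply/seteqP; split=> g.
    move=> [k [l [Kk Ll c ->]]]; exists l; last by rewrite (qP k).
    by split=> //=; rewrite -c; exact: sKV.
  move=> [l [Ll /= /sKP[k Kk c]] <-]; exists k, l; split=> //.
  by rewrite (qP k).
apply: continuous_compact => //; apply: continuous_in_subspaceT => l.
rewrite inE => -[Ll Vl]; have Ol := inO _ Vl.
apply: cvg_gmul => //.
- by have [_ e] := kapP Ol; rewrite /q /composable src_inv.
- by apply: (cvg_comp _ _ (kap_cvg oO' iO Ol)); exact: ginv_continuous.
- apply: filterS (near_rng_image oO' Ol) => h /kapP[_ e].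
  by rewrite /q /composable src_inv.
Qed.

Lemma bicompactM K L : bicompact K -> bicompact L -> bicompact (setM K L).
Proof.
move=> bK bL; split.
- split; first exact: setM_src_closed.
  by rewrite rng_image setM_inv; apply: setM_src_closed; exact: bicompact_inv.
- exact: setM_compact.
- have [_ _ [O [oO sO KO]]] := bK; have [_ _ [U [oU sU LU]]] := bL.
  exists (setM O U); split; [|exact: setM_slice | exact: setMS].
  by apply: setM_open => //; case: sO.
Qed.

End EtaleTopology.

(** * Continuity and boundedness of sections and their convolutions *)

Section ContinuousSections.
Variables (R : realType) (G : etale_groupoid) (B : fell_bundle R G).
Local Notation s := (src G).
Local Notation r := (rng G).
Local Notation inv := (ginv G).
Local Notation mul := (gmul G).
Local Notation fib := (fibre B).
Local Notation prj := (@proj R G B).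
Implicit Types (x y g : G) (a c d f m : sect B) (K L O : set G).

Let HG := etale_is_groupoid G.
Let HB := fellP B.
Let HBB := fell_is_banach HB.

Definition cont_at y a : Prop := sect_val a @ y --> sect_val a y.

(** The filter generated by all such tubes satisfies the hypotheses of [small_cvg], so it converges
    to the zero of the fibre and some tube lies in W. *)
Lemma tube x (W : set (total_space B)) : nbhs (emb (0 : fib x)) W ->
  exists N (e : R), [/\ nbhs x N, 0 < e &
    forall b, N (prj b) -> tnorm b < e -> W b].
Proof.
move=> Wx.
pose F : set_system (total_space B) :=
  filter_from [set p : set G * R | nbhs x p.1 /\ 0 < p.2]
    (fun p => [set b | p.1 (prj b) /\ tnorm b < p.2]).
have FF : ProperFilter F.
  apply: filter_from_proper; last first.
    move=> [N e] /= [Nx e0]; exists (emb (0 : fib x)); split.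
      by rewrite proj_emb; exact: nbhs_singleton.
    by rewrite tnorm_emb rnorm0.
  apply: filter_from_filter; first by exists (setT, 1); split=> //; exact: filterT.
  move=> [N e] [N' e'] /= [Nx e0] [Nx' e0'].
  exists (N `&` N', Num.min e e') => /=.
    by split; [exact: filterI | rewrite lt_min e0].
  by move=> b [[Nb Nb']]; rewrite lt_min => /andP[be be'].
have Fx : F --> emb (0 : fib x).
  apply: (small_cvg HBB) => [N Nx|]; first by exists (N, 1) => //= b [].
  apply/cvgrPdist_lt => e e0; exists (setT, e); first by split=> //; exact: filterT.
  by move=> b /= [_ be]; rewrite sub0r normrN ger0_norm ?rnorm_ge0.
have [[N e] /= [Nx e0] sub] := Fx W Wx.
by exists N, e; split=> // b Nb be; apply: sub.
Qed.

Lemma cont0 y : cont_at y 0.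
Proof.
move=> W Wy; have [N [e [Ny e0 h]]] := tube Wy.
apply: filterS Ny => g Ng; apply: h; first by rewrite /sect_val proj_emb.
by rewrite /sect_val tnorm_emb rnorm0.
Qed.

Lemma tadd g (u v : total_space B) : prj u = g ->
  emb (vec u + coord (prj u) v) = emb (coord g u + coord g v).
Proof. by move=> <-. Qed.

Lemma tadd_cvg (I : Type) (F : set_system I) (u v : I -> total_space B)
    g (u0 v0 : fib g) (w : I -> total_space B) : Filter F ->
  u @ F --> emb u0 -> v @ F --> emb v0 ->
  (\forall i \near F, prj (u i) = prj (v i) /\
     w i = emb (coord (prj (u i)) (u i) + coord (prj (u i)) (v i))) ->
  w @ F --> emb (u0 + v0).
Proof.
move=> FF uu vv uv.
have H : (fun i => emb (vec (u i) + coord (prj (u i)) (v i))) @ F -->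
    emb (vec (emb u0) + coord (prj (emb u0)) (emb v0)).
  apply: (@cvg_within_comp _ _ _ _ (emb u0, emb v0) _ _
    (fun i => (u i, v i)) _ (add_continuous HBB)) => //=.
  - by rewrite !proj_emb.
  - exact: cvg_pair.
  - by apply: filterS uv => i [].
rewrite (@tadd g) ?proj_emb// !embK in H.
apply: cvg_trans H; apply: near_eq_cvg.
by apply: filterS uv => i [_ ->].
Qed.

Lemma contD y a a' : cont_at y a -> cont_at y a' -> cont_at y (a + a').
Proof.
move=> ca cb.
apply: (@tadd_cvg G (nbhs y) (sect_val a) (sect_val a') y (a y) (a' y)) => //.
apply: nearW => g.
rewrite /sect_val !proj_emb; split=> //.
by rewrite !embK.
Qed.

Lemma contZ y (k : R[i]) a : cont_at y a -> cont_at y (k *: a).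
Proof.
move=> ca.
have e g : sect_val (k *: a) g = (fun b => emb (k *: vec b)) (sect_val a g).
  rewrite /sect_val /=; have := proj_emb (a g).
  have : coord g (emb (a g)) = a g by exact: embK.
  move: (emb (a g)) => b ea eb; subst g; congr emb.
  by rewrite /vec ea.
rewrite /cont_at; have -> : sect_val (k *: a) = (fun b => emb (k *: vec b)) \o sect_val a.
  by apply/funext => g; exact: e.
by apply: continuous_comp => //; exact: scale_continuous HBB k _.
Qed.

Lemma cont_star y a : cont_at (inv y) a -> cont_at y (sstar a).
Proof.
move=> ca; rewrite /cont_at.
have -> : sect_val (sstar a) = @fstar R G B \o (sect_val a \o inv).
  by apply/funext => g; rewrite /= {1}/sect_val emb_starf// invgK.
apply: continuous_comp; last exact: (fstar_continuous HB).
by apply: continuous_comp => //; exact: ginv_continuous.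
Qed.

(* Openness of the projection lifts points near [y] to points near [m y],
   which are then compared to [m] through a uniform approximation. *)
Lemma cont_unif y m :
  (forall e : R, 0 < e -> exists2 c, cont_at y c & forall g, rnorm (m g - c g) <= e) ->
  cont_at y m.
Proof.
move=> H W Wy.
(* Addition is continuous at (m y, 0). For g near y, m g will be written as v + (m g - v) with v in
   V over g and m g - v in a tube inside Z. *)
have [V [Z [Vm Z0 VZ]]] : exists V Z, [/\ nbhs (emb (m y)) V, nbhs (emb (0 : fib y)) Z &
    forall v z, V v -> Z z -> prj v = prj z -> W (emb (coord (prj v) v + coord (prj v) z))].
  have Wy' : nbhs (emb (m y + 0)) W by rewrite addr0.
  have h : (fun p : total_space B * total_space B =>
      emb (coord (prj p.1) p.1 + coord (prj p.1) p.2)) @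
      within [set p | prj p.1 = prj p.2] (nbhs (emb (m y), emb (0 : fib y))) -->
      emb (m y + 0).
    apply: (tadd_cvg (u := fst) (v := snd)).
    - by apply: cvg_within_filter; exact: cvg_fst.
    - by apply: cvg_within_filter; exact: cvg_snd.
    - by rewrite near_withinE; apply: nearW => p.
  have [[V Z] /= [Vm Z0] VZ] := h W Wy'.
  by exists V, Z; split=> // v z Vv Zz vz; apply: (VZ (v, z)).
have [N [e [Ny e0 tb]]] := tube Z0.
(* |m g - c g| <= e/3 and |c g - v| < e/2 add up to less than e. At y itself |c y - m y| <= e/3 <
   e/2, and upper semicontinuity of the norm extends the second bound to nearby pairs. *)
have e3 : 0 < e / 3 by rewrite divr_gt0.
have [c cc mc] := H _ e3.
have [P [Q [Pc Qm PQ]]] : exists P Q, [/\ nbhs (emb (c y)) P, nbhs (emb (m y)) Q &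
    forall p q, P p -> Q q -> prj p = prj q ->
      tnorm (emb (coord (prj p) p - coord (prj p) q)) < e / 2].
  have cm : tnorm (emb (c y - m y)) < e / 2.
    by rewrite tnorm_emb rnorm_distC; apply: le_lt_trans (mc y) _; lra.
  have h : (fun p : total_space B * total_space B =>
      emb (coord (prj p.1) p.1 - coord (prj p.1) p.2)) @
      within [set p | prj p.1 = prj p.2] (nbhs (emb (c y), emb (m y))) -->
      emb (c y - m y).
    have sc : (fun p : total_space B * total_space B => emb (-1 *: vec p.2)) @
      within [set p | prj p.1 = prj p.2] (nbhs (emb (c y), emb (m y))) -->
      emb (- m y).
      have e1 : emb (-1 *: vec (emb (m y))) = emb (- m y).
        rewrite scaleN1r; have := proj_emb (m y); have := embK (m y).
        move: (emb (m y)) => b; move: (m y) => v ea eb; subst y.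
        by rewrite -ea.
      have c1 : (fun b => emb (-1 *: vec b)) @ emb (m y) --> emb (- m y).
        by rewrite -e1; exact: (scale_continuous HBB).
      by apply: cvg_comp c1; apply: cvg_within_filter; exact: cvg_snd.
    apply: (tadd_cvg (u := fst) (v := fun p => emb (-1 *: vec p.2))) sc _.
      by apply: cvg_within_filter; exact: cvg_fst.
    rewrite near_withinE; apply: nearW => -[p q] /= pq.
    rewrite proj_emb; split=> //; rewrite pq; congr (emb (_ + _)).
    by rewrite embK scaleN1r.
  have us : nbhs (emb (c y - m y)) [set b : total_space B | tnorm b < e / 2].
    by apply: open_nbhs_nbhs; split=> //; exact: norm_usc HBB _.
  have [[P Q] /= [Pc Qm] PQ] := h _ us.
  by exists P, Q; split=> // p q Pp Qq pq; apply: (PQ (p, q)).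
have [Q' [oQ' Q'm] Q'V] : exists2 Q', open_nbhs (emb (m y)) Q' & Q' `<=` V `&` Q.
  have : nbhs (emb (m y)) (V `&` Q) by exact: filterI.
  by rewrite nbhsE => -[Q' oQ' sQ']; exists Q'.
have lift : \forall g \near y, (prj @` Q') g.
  apply: open_nbhs_nbhs; split; first exact: (proj_open HBB).
  by exists (emb (m y)) => //; exact: proj_emb.
have near_c : \forall g \near y, P (sect_val c g) by exact: cc.
apply: filterS3 lift near_c Ny => g [v Q'v vg] Pg Ng.
have [Vv Qv] := Q'V v Q'v.
pose v' := coord g v; have vE : emb v' = v by rewrite coordK.
have h1 : rnorm (c g - v') < e / 2.
  have := PQ _ _ Pg Qv; rewrite /sect_val proj_emb vg => /(_ erefl).
  by rewrite tnorm_emb embK.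
have h2 : Z (emb (m g - v')).
  apply: tb; rewrite ?proj_emb// tnorm_emb -(subrK (c g) (m g)) -addrA.
  apply: le_lt_trans (rnormD _ _) _; have := mc g; lra.
have := VZ v (emb (m g - v')) Vv h2; rewrite proj_emb vg => /(_ erefl).
by rewrite embK -/v' addrC subrK.
Qed.

Lemma cvg_fmul (I : Type) (F : set_system I) (u v : I -> total_space B) u0 v0 :
  Filter F -> fcomposable u0 v0 -> u @ F --> u0 -> v @ F --> v0 ->
  (\forall i \near F, fcomposable (u i) (v i)) ->
  (fun i => fmul (u i) (v i)) @ F --> fmul u0 v0.
Proof.
move=> FF cc uu vv uv.
apply: (@cvg_within_comp _ _ _ _ (u0, v0) _ _ (fun i => (u i, v i)) _
  (fmul_continuous HB)) => //.
exact: cvg_pair.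
Qed.

Section SliceProduct.
Variables (O : set G) (c m : sect B).
Hypotheses (oO : open O) (iO : set_inj O r) (cO : supp c `<=` O).

Lemma conv_slice_cvg g : (r @` O) (r g) ->
  (fun S : {fset G} => act c m S g) @ fins (s g) -->
  mulf g (c (kap O g)) (m (lam O g)).
Proof.
move=> Og; have [Ok e] := kapP Og; have [cc ge] := kap_lam Og.
have sl : s (lam O g) = s g by rewrite /lam src_ldiv.
have gl : mul g (inv (lam O g)) = kap O g.
  by rewrite {1}ge mulgK.
have -> : mulf g (c (kap O g)) (m (lam O g)) = act c m [fset lam O g]%fset g.
  by rewrite /act big_seq_fset1; apply: mulf_idx.
apply: act_cvg_fin; first by move=> b; rewrite inE => /eqP->.
move=> b bg; rewrite inE => bl.
rewrite (_ : c _ = 0) ?mulf0l ?mulgVK//; first by exact: comp_div.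
apply: contrapT => c0; move/eqP: bl; apply.
have Ob : O (mul g (inv b)) by apply: cO; rewrite /supp /=; exact/eqP.
have eb : r (mul g (inv b)) = r g by rewrite rng_div.
rewrite /lam (kap_uniq iO Ob eb) inv_div// mulgVK//.
Qed.

Lemma conv_slice0 g : ~ (r @` supp c) (r g) ->
  (fun S : {fset G} => act c m S g) @ fins (s g) --> (0 : fib g).
Proof.
move=> Og.
have -> : (0 : fib g) = act c m (fset0 : {fset G}) g by rewrite /act big_seq_fset0.
apply: act_cvg_fin => // b bg _.
rewrite (_ : c _ = 0) ?mulf0l ?mulgVK//; first by exact: comp_div.
apply: contrapT => c0; apply: Og; exists (mul g (inv b)); last by rewrite rng_div.
by rewrite /supp /=; exact/eqP.
Qed.

Lemma conv_slice_cont g : (r @` O) (r g) -> cont_at (kap O g) c ->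
  cont_at (lam O g) m -> cont_at g (conv c m).
Proof.
move=> Og ck ml.
have E h : (r @` O) (r h) -> sect_val (conv c m) h =
    fmul (sect_val c (kap O h)) (sect_val m (lam O h)).
  move=> Oh; rewrite /sect_val (convE (conv_slice_cvg Oh)).
  by have [cc he] := kap_lam Oh; rewrite emb_mulf.
rewrite /cont_at E//.
have H : (fun h => fmul (sect_val c (kap O h)) (sect_val m (lam O h))) @ g -->
    fmul (sect_val c (kap O g)) (sect_val m (lam O g)).
  apply: cvg_fmul => //.
  - by apply: comp_emb; have [] := kap_lam Og.
  - exact: cvg_comp (kap_cvg oO iO Og) ck.
  - exact: cvg_comp (lam_cvg oO iO Og) ml.
  - apply: filterS (near_rng_image oO Og) => h Oh.
    by apply: comp_emb; have [] := kap_lam Oh.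
apply: cvg_trans H; apply: near_eq_cvg.
by apply: filterS (near_rng_image oO Og) => h /E ->.
Qed.

End SliceProduct.

(** If r g is in r[K], the slice formula applies and only continuity of c at a point of K is used.
    Otherwise closedness of r[K] in the units makes the product zero near g. *)
Lemma conv_cont K c m : bicompact K -> continuous_on K c ->
  continuous (sect_val m) -> continuous (sect_val (conv c m)).
Proof.
move=> [[_ crK] cK [O [oO [sO rO] KO]]] [cK' cc] cm g.
have cO : supp c `<=` O by move=> k /cK'; exact: KO.
have [[k Kk kg]|nK] := pselect ((r @` K) (r g)).
  have Og : (r @` O) (r g) by exists k => //; exact: KO.
  apply: (conv_slice_cont oO rO cO Og); last exact: cm.
  by rewrite (kap_uniq rO (KO _ Kk) kg); exact: cc.
have ur : units G (r g) by apply/unitsP; exact: src_rng.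
have [V Vr VK] := (closed_unitsP _).1 crK _ ur nK.
have near0 : \forall h \near g, sect_val (conv c m) h = sect_val (0 : sect B) h.
  have : \forall h \near g, V (r h) by apply: rng_continuous.
  apply: filterS => h Vh; rewrite /sect_val; congr emb; apply: convE.
  apply: conv_slice0 => -[k' /cK' Kk e].
  by apply: (VK (r h)); [split=> //; exists k' | apply/unitsP; exact: src_rng].
have e0 : sect_val (conv c m) g = sect_val (0 : sect B) g := nbhs_singleton near0.
suff: cont_at g (conv c m) by [].
rewrite /cont_at e0; apply: cvg_trans (cont0 (y := g)); apply: near_eq_cvg.
by apply: filterS near0 => h ->.
Qed.

Lemma conv_continuous_on K L c d : bicompact K -> bicompact L ->
  continuous_on K c -> continuous_on L d -> continuous_on (setM K L) (conv c d).
Proof.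
move=> [_ _ [O [oO [sO rO] KO]]] _ [cK cc] [dL cd].
have cO : supp c `<=` O by move=> k /cK; exact: KO.
split=> [g|g KLg].
  rewrite /supp /= => nz.
  have [Og|nO] := pselect ((r @` O) (r g)); last first.
    case/eqP: nz; apply: convE; apply: conv_slice0 => -[k ck kg]; apply: nO.
    by exists k => //; exact: cO.
  move: nz; rewrite (convE (conv_slice_cvg (m := d) rO cO Og)) => nz.
  have [cp ge] := kap_lam Og; exists (kap O g), (lam O g); split=> //.
    by apply: cK; apply: contraNneq nz => ->; rewrite mulf0l.
  by apply: dL; apply: contraNneq nz => ->; rewrite mulf0r.
have [Og Lg] := setM_kap rO (setMS KO (@subset_refl _ L) KLg).
apply: (conv_slice_cont oO rO cO Og); last exact: cd.
have [k [l [Kk _ kl e]]] := KLg; apply: cc.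
by rewrite (kap_uniq rO (KO _ Kk))// e (rng_gmul HG).
Qed.

Lemma star_continuous_on K c : continuous_on K c -> continuous_on (inv @` K) (sstar c).
Proof.
move=> [cK cc]; split=> g.
  rewrite /supp /= => nz; exists (inv g); last by rewrite invgK.
  apply: cK; apply: contraNneq nz => z.
  by rewrite /sstar /sect_val z -/(starf g _) starf0// invgK.
by case=> k Kk <-; apply: cont_star; rewrite invgK; exact: cc.
Qed.

(** The norm is only upper semicontinuous, which still bounds it near each point of K; compactness
    makes the bound uniform. *)
Lemma continuous_on_bounded K c : compact K -> continuous_on K c ->
  exists2 M : R, 0 <= M & forall g, rnorm (c g) <= M.
Proof.
move=> /compact_near_coveringP cK [sc cc].
have loc g : K g ->
    (\forall h \near g & M \near pinfty_nbhs R, rnorm (c h) < M).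
  move=> Kg; pose t := rnorm (c g) + 1.
  have us : nbhs (emb (c g)) [set b : total_space B | tnorm b < t].
    apply: open_nbhs_nbhs; split; first exact: norm_usc HBB _.
    by rewrite /= tnorm_emb /t ltrDl.
  have h1 : \forall h \near g, tnorm (sect_val c h) < t by exact: (cc g Kg _ us).
  exists ([set h | rnorm (c h) < t], [set M | t <= M]) => /=; last first.
    by move=> [h M] /= [ht tM]; exact: lt_le_trans tM.
  split; last by apply: nbhs_pinfty_ge; exact: num_real.
  by apply: filterS h1 => h; rewrite /= /sect_val tnorm_emb.
have [M [_ hM]] := cK R (pinfty_nbhs R) (fun M g => rnorm (c g) < M) _ loc.
(* The bound holds only for numbers strictly above M, and a nonnegative one is wanted. *)
pose M' := `|M| + 1; have M'0 : 0 <= M' by rewrite addr_ge0.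
exists M' => // g.
have [z|nz] := eqVneq (c g) 0; first by rewrite z rnorm0.
have Kg : K g by exact: sc.
by apply: ltW; apply: (hM M') => //; rewrite /M' (le_lt_trans (ler_norm _))// ltrDl.
Qed.

(** The matrix c(g b^-1) has at most one nonzero entry in each row, by injectivity of r, and in each
    column, by injectivity of s. Cross terms of <c f, c f> vanish, and [prf_mulf_le] applied to each
    column sums to M^2 <f,f> = <c f, c f> + P with P positive. *)
Lemma Ble_slice O c (M : R) : slice O -> supp c `<=` O -> 0 <= M ->
  (forall g, rnorm (c g) <= M) -> Ble c M.
Proof.
move=> [sO rO] cO M0 cM; split=> // x F S f ux oF oS.
pose t g b : fib g := mulf g (c (mul g (inv b))) (f b).
have t_uniq g b b' : s g = x -> s b = x -> s b' = x -> t g b != 0 -> t g b' != 0 -> b = b'.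
  move=> gx bx bx' n1 n2.
  have hO b1 : s b1 = x -> t g b1 != 0 -> O (mul g (inv b1)).
    move=> b1x nz; apply: cO; apply: contraNneq nz => z.
    by rewrite /t z mulf0l ?mulgVK ?gx//; apply: comp_div; rewrite gx.
  have := rO _ _ (mem_set (hO b bx n1)) (mem_set (hO b' bx' n2)).
  rewrite !rng_div ?gx// => /(_ erefl) e.
  have ib b1 : s b1 = x -> inv b1 = mul (inv g) (mul g (inv b1)).
    by move=> b1x; rewrite mulVKg// /composable rng_inv gx.
  by rewrite -[b]invgK -[b']invgK (ib b)// e -ib.
have t_uniq' g g' b : s g = x -> s g' = x -> s b = x -> t g b != 0 -> t g' b != 0 -> g = g'.
  move=> gx gx' bx n1 n2.
  have hO g1 : s g1 = x -> t g1 b != 0 -> O (mul g1 (inv b)).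
    move=> b1x nz; apply: cO; apply: contraNneq nz => z.
    by rewrite /t z mulf0l ?mulgVK ?b1x//; apply: comp_div; rewrite b1x.
  have := sO _ _ (mem_set (hO g gx n1)) (mem_set (hO g' gx' n2)).
  rewrite !src_div ?gx ?gx'// => /(_ erefl) e.
  by rewrite -[g](mulgVK (b := b)) ?gx ?bx// e mulgVK ?gx' ?bx.
have e1 : ip x F (act c f S) (act c f S) =
    \sum_(g <- F) \sum_(b <- S) prf x (t g b) (t g b).
  apply: eq_big_seq => g /oF gx.
  have aE : act c f S g = \sum_(b <- S) t g b by [].
  have -> : prf x (act c f S g) (act c f S g) =
      \sum_(b <- S) prf x (act c f S g) (t g b).
    by rewrite [X in prf x _ X]aE; apply: mulf_sumr; [exact: comp_invl | ].
  apply: eq_big_seq => b bS; have bx := oS _ bS.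
  have [z|nz] := eqVneq (t g b) 0; first by rewrite z !prf0r.
  congr (prf x _ _); rewrite aE.
  rewrite (big_fsetD1 b)//= big_seq big1 ?addr0// => b'.
  rewrite !inE => /andP[/eqP nb b'S]; apply/eqP; apply: contrapT => /negP nz'.
  by apply: nb; apply: (t_uniq g) => //; exact: oS.
have [P [pP eP]] : exists P : fib x, posf P /\
    (M ^+ 2)%:C *: ip x S f f = ip x F (act c f S) (act c f S) + P.
  have hb b : b \in S -> exists P : fib x, posf P /\
      (M ^+ 2)%:C *: prf x (f b) (f b) = \sum_(g <- F) prf x (t g b) (t g b) + P.
    move=> /oS bx.
    have [[g [gF nz]]|no] := pselect (exists g, g \in F /\ t g b != 0).
      have gx := oF _ gF.
      have cgb : composable G (mul g (inv b)) b by apply: comp_div; rewrite gx.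
      have ge : g = mul (mul g (inv b)) b by rewrite mulgVK// gx.
      have [P pP e] := prf_mulf_le (f b) bx cgb ge (cM _).
      exists P; split=> //; rewrite e -/(t g b).
      rewrite (big_fsetD1 g)//= [X in _ + X + _]big_seq big1 ?addr0// => g'.
      rewrite !inE => /andP[/eqP ng g'F].
      have [->|nz'] := eqVneq (t g' b) 0; first by rewrite prf0l// (oF _ g'F).
      by case: ng; apply: (t_uniq' _ _ b) => //; exact: oF.
    exists ((M ^+ 2)%:C *: prf x (f b) (f b)); split.
      by apply: posfZ => //; [exact: exprn_ge0 | exact: posf_prf].
    rewrite big_seq big1 ?add0r// => g gF.
    have [->|nz] := eqVneq (t g b) 0; first by rewrite prf0l// (oF _ gF).
    by case: no; exists g.
  have /choice[P hP] : forall b, exists P : fib x, b \in S -> posf P /\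
      (M ^+ 2)%:C *: prf x (f b) (f b) = \sum_(g <- F) prf x (t g b) (t g b) + P.
    move=> b; have [bS|bS] := pselect (b \in S); last by exists 0.
    by have [P hP] := hb b bS; exists P.
  exists (\sum_(b <- S) P b); split.
    rewrite big_seq; apply: (big_ind (@posf _ _ B x)); [exact: posf0 | |].
      by move=> u v; exact: posfD.
    by move=> b bS; have [] := hP b bS.
  rewrite e1 /ip scaler_sumr.
  transitivity (\sum_(b <- S) (\sum_(g <- F) prf x (t g b) (t g b) + P b)).
    by apply: eq_big_seq => b bS; have [] := hP b bS.
  by rewrite big_split /=; congr (_ + _); exact: exchange_big.
have h := rnorm_posfD ux (posf_ip ux oF (act c f S)) pP.
rewrite -eP rnormZr ger0_norm ?exprn_ge0// in h.
by rewrite n2_le ?mulr_ge0 ?n2_ge0// exprMn n2_sq.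
Qed.

Lemma continuous_on_Ble K c : bicompact K -> continuous_on K c -> exists M, Ble c M.
Proof.
move=> [_ cK [O [oO sO KO]]] cc.
have [M M0 cM] := continuous_on_bounded cK cc; exists M.
by apply: (Ble_slice sO) => // g /cc.1; exact: KO.
Qed.

Lemma continuous_on_col_finite K c : bicompact K -> continuous_on K c -> col_finite c.
Proof.
move=> [_ _ [O [_ [sO _] KO]]] [cK _] x ux.
have cO : supp c `<=` O by move=> k /cK; exact: KO.
have [[k [Ok kx]]|no] := pselect (exists k, O k /\ s k = x).
  exists [fset k]%fset; first by move=> b; rewrite inE => /eqP->.
  move=> b bx; rewrite inE => bk; apply/eqP; apply: contraNT bk => nz.
  by apply/eqP; apply: sO; rewrite ?inE ?bx ?kx//; exact: cO.
exists fset0 => // b bx _; apply/eqP; apply: contrapT => /negP nz.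
by apply: no; exists b; split=> //; exact: cO.
Qed.

End ContinuousSections.

(** * The reduced algebra and the bimodule *)

(** Common interface for the reduced algebra and the bimodule. Completeness is phrased on the bare
    sigma type, before it carries any structure. *)
Record normed_subspace (R : realType) (S : lmodType R[i]) := NormedSubspace {
  ns_set : set S;
  ns_norm : S -> R;
  ns0 : ns_set 0;
  ns_lin : forall (k : R[i]) a b, ns_set a -> ns_set b -> ns_set (k *: a + b);
  ns_normD : forall a b, ns_set a -> ns_set b ->
    ns_norm (a + b) <= ns_norm a + ns_norm b;
  ns_normZ : forall (k : R[i]) a, ns_set a ->
    ns_norm (k *: a) = complex.Re `|k| * ns_norm a;
  ns_norm_eq0 : forall a, ns_set a -> ns_norm a = 0 -> a = 0;
  ns_complete : forall F : set_system {a | ns_set a}, ProperFilter F ->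
    (forall e : R, 0 < e ->
      exists v : {a | ns_set a}, \forall w \near F, ns_norm (sval v - sval w) < e) ->
    exists l : {a | ns_set a}, forall e : R, 0 < e ->
      \forall w \near F, ns_norm (sval l - sval w) < e
}.

Definition nspace (R : realType) (S : lmodType R[i]) (V : normed_subspace S) : Type :=
  {a : S | ns_set V a}.

Section NormedSubspaceTheory.
Variables (R : realType) (S : lmodType R[i]) (V : normed_subspace S).
Implicit Types u v w : nspace V.

Definition nval v : S := sval v.

Lemma nvalP v : ns_set V (nval v). Proof. exact: svalP. Qed.

Definition nmk (a : S) (Va : ns_set V a) : nspace V := exist _ a Va.

Lemma nval_inj : injective nval.
Proof.
move=> [a Va] [b Vb]; rewrite /nval /= => e; subst b.
by congr exist; exact: Prop_irrelevance.
Qed.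

HB.instance Definition _ := gen_eqMixin (nspace V).
HB.instance Definition _ := gen_choiceMixin (nspace V).

Let linP (k : R[i]) u v : ns_set V (k *: nval u + nval v).
Proof. by apply: ns_lin; exact: nvalP. Qed.

Let lin k u v : nspace V := nmk (linP k u v).
Let zero : nspace V := nmk (ns0 V).
Let add u v := lin 1 u v.
Let opp u := lin (-1) u zero.
Let scale k u := lin k u zero.

Fact nspace_addA : associative add.
Proof. by move=> u v w; apply: nval_inj; rewrite /nval /= !scale1r addrA. Qed.
Fact nspace_addC : commutative add.
Proof. by move=> u v; apply: nval_inj; rewrite /nval /= !scale1r addrC. Qed.
Fact nspace_add0 : left_id zero add.
Proof. by move=> u; apply: nval_inj; rewrite /nval /= scale1r add0r. Qed.
Fact nspace_addN : left_inverse zero opp add.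
Proof.
by move=> u; apply: nval_inj; rewrite /nval /= scale1r addr0 scaleN1r addNr.
Qed.
HB.instance Definition _ := GRing.isZmodule.Build (nspace V)
  nspace_addA nspace_addC nspace_add0 nspace_addN.

Lemma nvalD u v : nval (u + v) = nval u + nval v.
Proof. by rewrite -[LHS]/(1 *: nval u + nval v) scale1r. Qed.

Fact nspace_scaleA k l u : scale k (scale l u) = scale (k * l) u.
Proof. by apply: nval_inj; rewrite /nval /= !addr0 scalerA. Qed.
Fact nspace_scale1 : left_id 1 scale.
Proof. by move=> u; apply: nval_inj; rewrite /nval /= addr0 scale1r. Qed.
Fact nspace_scaleDr : right_distributive scale +%R.
Proof.
move=> k u v; apply: nval_inj; rewrite nvalD -[LHS]/(k *: nval (u + v) + 0).
by rewrite nvalD -![nval (scale _ _)]/(k *: nval _ + 0) !addr0 scalerDr.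
Qed.
Fact nspace_scaleDl u : {morph scale^~ u : k l / k + l}.
Proof.
move=> k l; apply: nval_inj; rewrite nvalD -[LHS]/((k + l) *: nval u + 0).
by rewrite -[nval (scale k _)]/(k *: nval u + 0) -[nval (scale l _)]/(l *: nval u + 0) !addr0 scalerDl.
Qed.
HB.instance Definition _ := GRing.Zmodule_isLmodule.Build R[i] (nspace V)
  nspace_scaleA nspace_scale1 nspace_scaleDr nspace_scaleDl.

Lemma nvalZ k u : nval (k *: u) = k *: nval u.
Proof. by rewrite -[LHS]/(k *: nval u + 0) addr0. Qed.

Fact nval_linear : linear nval.
Proof. by move=> k u v; rewrite nvalD nvalZ. Qed.
HB.instance Definition _ := GRing.isLinear.Build R[i] (nspace V) S *:%R nval nval_linear.

Lemma nvalB u v : nval (u - v) = nval u - nval v.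
Proof. exact: linearB. Qed.

Let norm u : R[i] := (ns_norm V (nval u))%:C.

Fact nspace_normD u v : norm (u + v) <= norm u + norm v.
Proof. by rewrite /norm -rmorphD lecR nvalD ns_normD//; exact: nvalP. Qed.
Fact nspace_normZ k u : norm (k *: u) = `|k| * norm u.
Proof.
rewrite /norm nvalZ ns_normZ; last exact: nvalP.
rewrite rmorphM; congr (_ * _).
Qed.
Fact nspace_norm_eq0 u : norm u = 0 -> u = 0.
Proof.
move=> /complexI h; apply: nval_inj; rewrite (ns_norm_eq0 _ h) ?linear0//.
exact: nvalP.
Qed.
HB.instance Definition _ := Lmodule_isNormed.Build R[i] (nspace V)
  nspace_normD nspace_normZ nspace_norm_eq0.

Lemma nspace_rnorm u : rnorm u = ns_norm V (nval u). Proof. by []. Qed.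
Lemma nspace_norm u : `|u| = (ns_norm V (nval u))%:C. Proof. by []. Qed.

Fact nspace_complete (F : set_system (nspace V)) : ProperFilter F -> cauchy F -> cvg F.
Proof.
move=> FF cF; have [|l hl] := @ns_complete _ _ V F FF.
  move=> e e0; have e0' : 0 < e%:C by rewrite ltcR.
  have := (cauchyP F).1 cF _ e0' => -[v hv]; exists v.
  apply: filterS hv => w; rewrite -ball_normE /= nspace_norm ltcR.
  by rewrite nvalB.
apply/cvg_ex; exists l.
have H := (@rnorm_cvgP R (nspace V) _ F id l _).2; apply: H => e e0.
apply: filterS (hl e e0) => w; rewrite nspace_rnorm.
by rewrite nvalB.
Qed.
HB.instance Definition _ := Uniform_isComplete.Build (nspace V) nspace_complete.

End NormedSubspaceTheory.

(** * Closure properties of the two spaces of sections and the bimodule operations *)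

Section ReducedAlgebra.
Variables (R : realType) (G : etale_groupoid) (B : fell_bundle R G).
Local Notation s := (src G).
Local Notation inv := (ginv G).
Local Notation mul := (gmul G).
Local Notation fib := (fibre B).
Local Notation CS := (@compact_sections R G B).
Implicit Types (x y g : G) (a b c d f m : sect B).

Lemma compact_sections0 : CS 0.
Proof.
exists 0%N, (fun i => 0), (fun i => 0); split; first by case.
by rewrite big_ord0.
Qed.

Lemma compact_sections_lin (k : R[i]) a b : CS a -> CS b -> CS (k *: a + b).
Proof.
move=> [n [ka [ca [ha ->]]]] [p [kb [cb [hb ->]]]].
exists (n + p)%N, (fun i => match fintype.split i with inl i => k * ka i | inr i => kb i end),
  (fun i => match fintype.split i with inl i => ca i | inr i => cb i end); split.
  by move=> i; case: (fintype.split i) => j.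
rewrite scaler_sumr big_split_ord /=; congr (_ + _); apply: eq_bigr => i _.
  by rewrite (unsplitK (inl i)) scalerA.
by rewrite (unsplitK (inr i)).
Qed.

Lemma compact_sections1 K c : bicompact K -> continuous_on K c -> CS c.
Proof.
move=> bK cK; exists 1%N, (fun=> 1), (fun=> c); split; first by move=> _; exists K.
by rewrite big_ord1 scale1r.
Qed.

Lemma compact_sections_ind (P : sect B -> Prop) :
  P 0 ->
  (forall (k : R[i]) a b, CS a -> P a -> CS b -> P b -> P (k *: a + b)) ->
  (forall K c, bicompact K -> continuous_on K c -> P c) ->
  forall a, CS a -> P a.
Proof.
move=> P0 Plin P1 a [n [k [c [hc ->]]]].
(* Membership in the span is carried along, since the linear step asks for it. *)
suff : CS (\sum_(i < n) k i *: c i) /\ P (\sum_(i < n) k i *: c i) by case.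
elim/big_rec: _ => [|i u _ [Cu Pu]]; first by split=> //; exact: compact_sections0.
have [K bK cK] := hc i; have Ci := compact_sections1 bK cK.
by split; [exact: compact_sections_lin | apply: Plin => //; exact: P1 cK].
Qed.

Lemma compact_sections_Ble a : CS a -> exists M, Ble a M.
Proof.
move: a; apply: (compact_sections_ind (P := fun a => exists M, Ble a M)).
- by exists 0; exact: Ble0.
- move=> k u v _ [M uM] _ [N vN].
  by exists (complex.Re `|k| * M + N); exact: BleZD.
- by move=> K c bK; exact: continuous_on_Ble.
Qed.

Lemma compact_sections_col_finite a : CS a -> col_finite a.
Proof.
move: a; apply: (compact_sections_ind (P := @col_finite R G B)).
- by move=> x ux; exists fset0.
- move=> k u v _ hu _ hv x ux; have [S oS uS] := hu x ux; have [T oT vT] := hv x ux.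
  exists (S `|` T)%fset => [g|b bx].
    by rewrite inE => /orP[/oS|/oT].
  rewrite inE negb_or => /andP[bS bT].
  by rewrite -[LHS]/(k *: u b + v b) (uS b bx bS) (vT b bx bT) scaler0 addr0.
- by move=> K c bK; exact: continuous_on_col_finite.
Qed.

Lemma sstar0 : sstar (0 : sect B) = 0.
Proof. by have := sstarB (0 : sect B) 0; rewrite !subrr. Qed.

Lemma compact_sections_star a : CS a -> CS (sstar a).
Proof.
move: a; apply: (compact_sections_ind (P := fun a => CS (sstar a))).
- by rewrite sstar0; exact: compact_sections0.
- by move=> k u v _ hu _ hv; rewrite sstar_lin; exact: compact_sections_lin.
- move=> K c bK cK; apply: compact_sections1 (star_continuous_on cK).
  exact: bicompact_inv.
Qed.

Lemma compact_sections_row_finite a : CS a -> row_finite a.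
Proof. by move=> /compact_sections_star; exact: compact_sections_col_finite. Qed.

Lemma compact_sections_defined c a : CS a -> conv_defined c a.
Proof. by move=> Ca; apply: col_finite_defined; exact: compact_sections_col_finite. Qed.

Lemma row_finite_defined c m : row_finite c -> conv_defined c m.
Proof.
move=> rc; apply/conv_definedP => g; have [S oS h] := row_finite_cvg m g rc.
by apply/cvg_ex; exists (act c m S g).
Qed.

Lemma conv0l m : conv_defined (0 : sect B) m /\ conv 0 m = 0.
Proof.
apply: conv_intro => g.
have -> : (0 : sect B) g = act 0 m (fset0 : {fset G}) g by rewrite /act big_seq_fset0.
apply: act_cvg_fin => // b bg _.
by rewrite mulf0l ?mulgVK//; exact: comp_div.
Qed.

Lemma conv0r a : conv_defined a (0 : sect B) /\ conv a 0 = 0.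
Proof.
have [d e] := conv_star (conv0l (sstar a)).1.
by rewrite sstarK sstar0 (conv0l _).2 sstar0 in d e.
Qed.

Lemma compact_sections_conv a b : CS a -> CS b -> CS (conv a b).
Proof.
move=> Ca; move: b; apply: (compact_sections_ind (P := fun b => CS (conv a b))).
- by rewrite (conv0r a).2; exact: compact_sections0.
- move=> k u v Cu hu Cv hv.
  rewrite (conv_lin_r k (compact_sections_defined (c := a) Cu) (compact_sections_defined (c := a) Cv)).2.
  exact: compact_sections_lin.
- move=> L d bL dL; have Cd := compact_sections1 bL dL.
  move: a Ca; apply: (compact_sections_ind (P := fun a => CS (conv a d))).
  + by rewrite (conv0l d).2; exact: compact_sections0.
  + move=> k u v Cu hu Cv hv.
    rewrite (conv_lin_l k (compact_sections_defined (c := u) Cd) (compact_sections_defined (c := v) Cd)).2.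
    exact: compact_sections_lin.
  + move=> K c bK cK; apply: compact_sections1 (conv_continuous_on bK bL cK dL).
    exact: bicompactM.
Qed.

Lemma compact_sections_conv_cont c m : CS c -> continuous (sect_val m) ->
  continuous (sect_val (conv c m)).
Proof.
move=> Cc cm; move: c Cc; apply: (compact_sections_ind
  (P := fun c => continuous (sect_val (conv c m)))).
- by rewrite (conv0l m).2; exact: cont0.
- move=> k u v /compact_sections_row_finite ru hu /compact_sections_row_finite rv hv.
  rewrite (conv_lin_l k (row_finite_defined (m := m) ru) (row_finite_defined (m := m) rv)).2 => g.
  by apply: contD (hv g); apply: contZ; exact: hu.
- by move=> K c bK cK; exact: conv_cont cK cm.
Qed.

Local Notation RA := (@reduced_algebra R G B).
Local Notation BC := (@bounded_continuous_sections R G B).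

(** Replaces the strict bound on [normb] by the weak one in [Ble]; approximating within e/2 restores
    strictness. *)
Lemma reduced_algebraP a : RA a <-> approx CS a.
Proof.
split=> H e e0.
  have [c Cc ac] := H e e0; exists c => //.
  have h : Ble (a - c) (bnorm (a - c)).
    by apply: normb_fin; apply: lt_trans ac _; exact: ltry.
  by apply: (BleW _ h); rewrite -lee_fin -(normbE h); exact: ltW.
have e2 : 0 < e / 2 by rewrite divr_gt0.
have [c Cc ac] := H _ e2; exists c => //.
apply: (@le_lt_trans _ _ (e / 2)%:E); first exact: (normb_leP _ (ltW e2)).2.
by rewrite lte_fin; lra.
Qed.

Lemma reduced_Ble a : RA a -> exists M, Ble a M.
Proof.
move=> /reduced_algebraP/(_ 1 ltr01)[c /compact_sections_Ble[M cM] ac].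
by exists (1 + M); rewrite -(subrK c a); exact: BleD.
Qed.

Lemma reduced_bnorm a : RA a -> Ble a (bnorm a).
Proof. by move=> /reduced_Ble[M]; exact: Ble_bnorm. Qed.

Lemma reduced_row a : RA a -> approx (@row_finite R G B) a.
Proof.
move=> /reduced_algebraP H e e0; have [c Cc ac] := H e e0.
by exists c => //; exact: compact_sections_row_finite.
Qed.

Lemma reduced_col a : RA a -> approx (@col_finite R G B) a.
Proof.
move=> /reduced_algebraP H e e0; have [c Cc ac] := H e e0.
by exists c => //; exact: compact_sections_col_finite.
Qed.

Lemma reduced0 : RA 0.
Proof.
apply/reduced_algebraP => e e0; exists 0; first exact: compact_sections0.
by rewrite subrr; apply: BleW (Ble0 _); exact: ltW.
Qed.

Lemma reduced_lin (k : R[i]) a b : RA a -> RA b -> RA (k *: a + b).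
Proof.
move=> /reduced_algebraP Ha /reduced_algebraP Hb; apply/reduced_algebraP => e e0.
set n := complex.Re `|k|; have n0 : 0 <= n by exact: cabs_ge0.
have e1 : 0 < e / (2 * (n + 1)) by rewrite divr_gt0//; lra.
have e2 : 0 < e / 2 by rewrite divr_gt0.
have [c Cc ac] := Ha _ e1; have [d Cd bd] := Hb _ e2.
exists (k *: c + d); first exact: compact_sections_lin.
have -> : k *: a + b - (k *: c + d) = k *: (a - c) + (b - d).
  by rewrite scalerBr opprD addrACA.
apply: BleW (BleZD k ac bd); rewrite -/n.
have : n * (e / (2 * (n + 1))) <= e / 2.
  rewrite invfM mulrCA [X in _ * X]mulrCA mulrA ler_piMr ?ltW//.
  by rewrite ltr_pdivrMr ?mul1r; lra.
lra.
Qed.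

Lemma reduced_star a : RA a -> RA (sstar a).
Proof.
move=> /reduced_algebraP H; apply/reduced_algebraP => e e0.
have [c Cc ac] := H e e0; exists (sstar c); first exact: compact_sections_star.
by rewrite -sstarB; exact: Ble_star.
Qed.

Lemma reduced_defined_l a m M : RA a -> Ble m M -> conv_defined a m.
Proof.
move=> Ra mM; apply: conv_def_l; first exact: reduced_row.
by move=> x; exact: (Ble_l2 mM).
Qed.

Lemma reduced_defined_r m a M : RA a -> Ble m M -> conv_defined m a.
Proof. by move=> Ra mM; apply: (conv_def_r mM); exact: reduced_col. Qed.

Lemma conv_subr a b b' : conv_defined a b -> conv_defined a b' ->
  conv_defined a (b - b') /\ conv a (b - b') = conv a b - conv a b'.
Proof.
move=> h h'; have [k e] := conv_lin_r (-1) h' h.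
by rewrite !scaleN1r ![- _ + _]addrC in k e.
Qed.

Lemma reduced_conv a b : RA a -> RA b -> RA (conv a b).
Proof.
move=> Ra Rb; apply/reduced_algebraP => e e0.
have [N bN] := reduced_Ble Rb; have N0 := bN.1.
have e1 : 0 < e / (2 * (N + 1)) by rewrite divr_gt0//; lra.
have [c Cc ac] := (reduced_algebraP a).1 Ra _ e1.
have [M cM] := compact_sections_Ble Cc; have M0 := cM.1.
(* In a b - c d = (a - c) b + c (b - d) the second error involves the bound M of c, so d is chosen
   after c. *)
have e2 : 0 < e / (2 * (M + 1)) by rewrite divr_gt0//; lra.
have [d Cd bd] := (reduced_algebraP b).1 Rb _ e2.
exists (conv c d); first exact: compact_sections_conv.
have dab := reduced_defined_l Ra bN.
have dcb := row_finite_defined (m := b) (compact_sections_row_finite Cc).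
have dcd := row_finite_defined (m := d) (compact_sections_row_finite Cc).
have [h1 eq1] := conv_subl dab dcb.
have [h2 eq2] := conv_subr dcb dcd.
have -> : conv a b - conv c d = conv (a - c) b + conv c (b - d).
  by rewrite eq1 eq2 addrA subrK.
have half (t : R) : 0 <= t -> t * (e / (2 * (t + 1))) <= e / 2.
  move=> t0; rewrite invfM mulrCA [X in _ * X]mulrCA mulrA ler_piMr//; first lra.
  by rewrite ler_pdivrMr ?mul1r; lra.
apply: BleW (BleD (Ble_conv h1 ac bN) (Ble_conv h2 cM bd)).
by rewrite [_ * N]mulrC; have := half N N0; have := half M M0; lra.
Qed.

Lemma bounded_Ble m : BC m -> Ble m (bnorm m).
Proof. by case=> _; exact: normb_fin. Qed.

Lemma boundedP m M : continuous (sect_val m) -> Ble m M -> BC m.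
Proof. by move=> cm mM; split=> //; rewrite (normbE mM) ltry. Qed.

Lemma bounded0 : BC 0.
Proof. by apply: boundedP (Ble0 _); exact: cont0. Qed.

Lemma bounded_lin (k : R[i]) a b : BC a -> BC b -> BC (k *: a + b).
Proof.
move=> Ba Bb; apply: boundedP (BleZD k (bounded_Ble Ba) (bounded_Ble Bb)) => g.
by apply: contD; [apply: contZ; exact: Ba.1 | exact: Bb.1].
Qed.

Lemma bounded_star m : BC m -> BC (sstar m).
Proof.
move=> Bm; apply: boundedP (Ble_star (bounded_Ble Bm)) => g.
by apply: cont_star; exact: Bm.1.
Qed.

Lemma bounded_conv_l a m : RA a -> BC m -> BC (conv a m).
Proof.
move=> Ra Bm; have mM := bounded_Ble Bm; have M0 := mM.1.
have dam := reduced_defined_l Ra mM.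
apply: boundedP (Ble_conv dam (reduced_bnorm Ra) mM) => g.
apply: cont_unif => e e0.
have e1 : 0 < e / (bnorm m + 1) by rewrite divr_gt0//; lra.
have [c Cc ac] := (reduced_algebraP a).1 Ra _ e1.
exists (conv c m); first exact: compact_sections_conv_cont Cc Bm.1 g.
move=> h; have dcm := row_finite_defined (m := m) (compact_sections_row_finite Cc).
have [h1 eq1] := conv_subl dam dcm.
have := Ble_rnorm h (Ble_conv h1 ac mM); rewrite eq1 => /le_trans; apply.
by rewrite mulrAC ler_pdivrMr; [rewrite ler_wpM2l ?ltW//; lra | lra].
Qed.

(** m a is the adjoint of a* m*, which the left-handed case covers. *)
Lemma bounded_conv_r a m : RA a -> BC m -> BC (conv m a).
Proof.
move=> Ra Bm.
have Rs := reduced_star Ra; have Bs := bounded_star Bm.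
have := (conv_star (reduced_defined_l Rs (bounded_Ble Bs))).2.
by rewrite !sstarK => ->; apply: bounded_star; exact: bounded_conv_l.
Qed.

(** In the weak form [BleP] each inequality involves only finitely many values of the section. *)
Lemma Ble_cvg (T : Type) (F : set_system T) (a : T -> sect B) (l : sect B) (M : R) :
  ProperFilter F -> 0 <= M -> (forall g, (fun t => a t g) @ F --> (l g : fib g)) ->
  (\forall t \near F, Ble (a t) M) -> Ble l M.
Proof.
move=> FF M0 al aM; apply/BleP => // x X S h f ux oX oS.
apply: (@rnorm_cvg_le _ _ _ F _ (fun t => ip x X h (act (a t) f S))).
  apply: cvg_sum_seq => g gX; have gx := oX _ gX.
  apply: cvg_mulfr; [exact: comp_invl | by rewrite -[LHS]gx |].
  apply: cvg_sum_seq => b bS; have bx := oS _ bS.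
  apply: cvg_mulfl; [by apply: comp_div; rewrite gx | by rewrite mulgVK// gx |].
  exact: al.
by apply: filterS aM => t aM; exact: (BleP _ M0).1.
Qed.

(* Completeness of a space of sections closed under limits for [bnorm]: a Cauchy
   filter converges pointwise, and [Ble] passes to pointwise limits. *)
Lemma section_complete (V : set (sect B)) (F : set_system {a | V a}) :
  (forall a, V a -> Ble a (bnorm a)) ->
  (forall (k : R[i]) a b, V a -> V b -> V (k *: a + b)) ->
  (forall l, approx V l -> V l) -> ProperFilter F ->
  (forall e : R, 0 < e ->
    exists v : {a | V a}, \forall w \near F, bnorm (sval v - sval w) < e) ->
  exists l : {a | V a}, forall e : R, 0 < e ->
    \forall w \near F, bnorm (sval l - sval w) < e.
Proof.
move=> Vb Vl Vc FF cF.
have Vsub (v w : {a | V a}) : Ble (sval v - sval w) (bnorm (sval v - sval w)).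
  apply: Vb; have := Vl (-1) _ _ (svalP w) (svalP v).
  by rewrite scaleN1r addrC.
have pt g : cvg ((fun w : {a | V a} => sval w g) @ F).
  apply: rnorm_complete => e e0; have [v hv] := cF e e0.
  exists (sval v g); apply: filterS hv => w; apply: le_lt_trans.
  exact: Ble_rnorm g (Vsub v w).
pose l : sect B := fun g => lim ((fun w : {a | V a} => sval w g) @ F).
have hl g : (fun w : {a | V a} => sval w g) @ F --> (l g : fib g) by exact: pt.
have lB e : 0 < e -> forall v : {a | V a},
    (\forall w \near F, bnorm (sval v - sval w) < e) -> Ble (sval v - l) e.
  move=> e0 v hv.
  apply: (@Ble_cvg _ F (fun w : {a | V a} => sval v - sval w)) => //; first exact: ltW.
    by move=> g; apply: cvgB; [exact: cvg_cst | exact: hl].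
  by apply: filterS hv => w hw; apply: BleW (Vsub v w); exact: ltW.
have Vll : V l.
  apply: Vc => e e0; have [v hv] := cF e e0; exists (sval v); first exact: svalP.
  by rewrite -[_ - _]opprB -scaleN1r; have := BleZ (-1) (lB e e0 v hv); rewrite normrN1 mul1r.
exists (exist _ l Vll) => e e0 /=.
have e2 : 0 < e / 3 by rewrite divr_gt0.
have [v hv] := cF _ e2; apply: filterS (hv) => w hw.
have h1 := lB _ e2 v hv.
have h2 : Ble (sval v - sval w) (e / 3) by apply: BleW (Vsub v w); exact: ltW.
have := BleB h2 h1; rewrite opprB addrC addrA subrK => h3.
by apply: le_lt_trans (bnorm_le h3) _; lra.
Qed.

Section BnormFacts.
Variable V : set (sect B).
Hypothesis VB : forall a, V a -> Ble a (bnorm a).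

Lemma bnormD a b : V a -> V b -> bnorm (a + b) <= bnorm a + bnorm b.
Proof. by move=> /VB Ba /VB Bb; exact: bnorm_le (BleD Ba Bb). Qed.

Lemma bnormZ (k : R[i]) a : V a -> bnorm (k *: a) = complex.Re `|k| * bnorm a.
Proof.
have le (k' : R[i]) a' : Ble a' (bnorm a') -> bnorm (k' *: a') <= complex.Re `|k'| * bnorm a'.
  by move=> Ba; exact: bnorm_le (BleZ k' Ba).
move=> /VB Ba; apply/eqP; rewrite eq_le le// andTb.
have Bk := Ble_bnorm (BleZ k Ba).
have [->|k0] := eqVneq k 0.
  by rewrite normr0 mul0r; exact: (Ble_bnorm (BleZ 0 Ba)).1.
have kk : complex.Re `|k| * complex.Re `|k^-1| = 1.
  by rewrite -cabsM mulfV// normr1.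
have := le k^-1 _ Bk; rewrite scalerA mulVf// scale1r => h.
have := ler_wpM2l (cabs_ge0 k) h.
by rewrite mulrA kk mul1r.
Qed.

Lemma bnorm_eq0 a : V a -> bnorm a = 0 -> a = 0.
Proof.
move=> /VB Ba a0; apply/functional_extensionality_dep => g.
apply/eqP; rewrite -rnorm_eq0 eq_le rnorm_ge0 andbT -a0.
exact: Ble_rnorm.
Qed.

End BnormFacts.

Lemma reduced_closed l : approx RA l -> RA l.
Proof.
move=> H; apply/reduced_algebraP => e e0.
have e2 : 0 < e / 2 by rewrite divr_gt0.
have [a Ra la] := H _ e2; have [c Cc ac] := (reduced_algebraP a).1 Ra _ e2.
exists c => //; have := BleD la ac.
by rewrite addrA subrK -splitr.
Qed.

(** The b-norm dominates the supremum norm, so b-norm limits are uniform limits and [cont_unif]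
    applies. *)
Lemma bounded_closed l : approx BC l -> BC l.
Proof.
move=> H; have [m Bm lm] := H 1 ltr01.
have lM : Ble l (1 + bnorm m) by rewrite -(subrK m l); apply: BleD => //; exact: bounded_Ble.
apply: boundedP lM => g; apply: cont_unif => e e0.
have [c [cc _] lc] := H e e0; exists c; first exact: cc.
by move=> h; exact: Ble_rnorm h lc.
Qed.

Definition reduced_space : normed_subspace (sect B) :=
  NormedSubspace reduced0 reduced_lin (bnormD reduced_bnorm) (bnormZ reduced_bnorm)
    (bnorm_eq0 reduced_bnorm)
    (fun F FF => section_complete reduced_bnorm reduced_lin reduced_closed FF).

Definition bounded_space : normed_subspace (sect B) :=
  NormedSubspace bounded0 bounded_lin (bnormD bounded_Ble) (bnormZ bounded_Ble)
    (bnorm_eq0 bounded_Ble)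
    (fun F FF => section_complete bounded_Ble bounded_lin bounded_closed FF).

Local Notation A := (nspace reduced_space).
Local Notation M := (nspace bounded_space).
Local Notation va := (@nval R (sect B) reduced_space).
Local Notation vm := (@nval R (sect B) bounded_space).
Implicit Types (u v w : A) (p q : M).

Let uR u : RA (va u) := nvalP u.
Let pB p : BC (vm p) := nvalP p.

(* The operations are sealed by [Qed]: unification would otherwise unfold them
   down to the limits defining the convolution. *)
Fact alg_mul_spec : {op : A -> A -> A | forall u v, va (op u v) = conv (va u) (va v)}.
Proof. by exists (fun u v => @nmk R _ reduced_space _ (reduced_conv (uR u) (uR v))). Qed.
Fact mod_lact_spec : {op : A -> M -> M | forall u p, vm (op u p) = conv (va u) (vm p)}.
Proof. by exists (fun u p => @nmk R _ bounded_space _ (bounded_conv_l (uR u) (pB p))). Qed.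
Fact mod_ract_spec : {op : M -> A -> M | forall p u, vm (op p u) = conv (vm p) (va u)}.
Proof. by exists (fun p u => @nmk R _ bounded_space _ (bounded_conv_r (uR u) (pB p))). Qed.
Fact alg_star_spec : {op : A -> A | forall u, va (op u) = sstar (va u)}.
Proof. by exists (fun u => @nmk R _ reduced_space _ (reduced_star (uR u))). Qed.
Fact mod_star_spec : {op : M -> M | forall p, vm (op p) = sstar (vm p)}.
Proof. by exists (fun p => @nmk R _ bounded_space _ (bounded_star (pB p))). Qed.

Definition alg_mul := sval alg_mul_spec.
Definition mod_lact := sval mod_lact_spec.
Definition mod_ract := sval mod_ract_spec.
Definition alg_star := sval alg_star_spec.
Definition mod_star := sval mod_star_spec.

Lemma alg_mulE u v : va (alg_mul u v) = conv (va u) (va v).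
Proof. exact: (svalP alg_mul_spec). Qed.
Lemma mod_lactE u p : vm (mod_lact u p) = conv (va u) (vm p).
Proof. exact: (svalP mod_lact_spec). Qed.
Lemma mod_ractE p u : vm (mod_ract p u) = conv (vm p) (va u).
Proof. exact: (svalP mod_ract_spec). Qed.
Lemma alg_starE u : va (alg_star u) = sstar (va u).
Proof. exact: (svalP alg_star_spec). Qed.
Lemma mod_starE p : vm (mod_star p) = sstar (vm p).
Proof. exact: (svalP mod_star_spec). Qed.

Let dl a m : RA a -> BC m -> conv_defined a m.
Proof. by move=> Ra Bm; exact: reduced_defined_l Ra (bounded_Ble Bm). Qed.
Let dr a m : RA a -> BC m -> conv_defined m a.
Proof. by move=> Ra Bm; exact: reduced_defined_r Ra (bounded_Ble Bm). Qed.
Let dd a b : RA a -> RA b -> conv_defined a b.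
Proof. by move=> Ra Rb; exact: reduced_defined_l Ra (reduced_bnorm Rb). Qed.

Let assoc a b m : RA a -> Ble b (bnorm b) -> Ble m (bnorm m) -> conv_defined b m ->
  conv_defined (conv a b) m -> conv (conv a b) m = conv a (conv b m).
Proof.
by move=> Ra Bb Bm; exact: conv_assoc (reduced_row Ra) (reduced_bnorm Ra) Bb Bm.
Qed.

Let norm_redE u : `|u| = (bnorm (va u))%:C :> R[i]. Proof. by []. Qed.
Let norm_bndE p : `|p| = (bnorm (vm p))%:C :> R[i]. Proof. by []. Qed.
Let ns_set_redE : ns_set reduced_space = RA. Proof. by []. Qed.
Let ns_set_bndE : ns_set bounded_space = BC. Proof. by []. Qed.
Let ns_norm_redE : ns_norm reduced_space = @bnorm R G B. Proof. by []. Qed.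
Let ns_norm_bndE : ns_norm bounded_space = @bnorm R G B. Proof. by []. Qed.

Fact alg_mul_bilinear : bilinear_for *:%R *:%R alg_mul.
Proof.
split=> [v k u w|u k v w]; apply: nval_inj; rewrite nvalD nvalZ !alg_mulE nvalD nvalZ.
  by rewrite (conv_lin_l k (dd (uR u) (uR v)) (dd (uR w) (uR v))).2.
by rewrite (conv_lin_r k (dd (uR u) (uR v)) (dd (uR u) (uR w))).2.
Qed.

Fact mod_lact_bilinear : bilinear_for *:%R *:%R mod_lact.
Proof.
split=> [p k u w|u k p q]; apply: nval_inj; rewrite nvalD nvalZ !mod_lactE nvalD nvalZ.
  by rewrite (conv_lin_l k (dl (uR u) (pB p)) (dl (uR w) (pB p))).2.
by rewrite (conv_lin_r k (dl (uR u) (pB p)) (dl (uR u) (pB q))).2.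
Qed.

Fact mod_ract_bilinear : bilinear_for *:%R *:%R mod_ract.
Proof.
split=> [u k p q|p k u w]; apply: nval_inj; rewrite nvalD nvalZ !mod_ractE nvalD nvalZ.
  by rewrite (conv_lin_l k (dr (uR u) (pB p)) (dr (uR u) (pB q))).2.
by rewrite (conv_lin_r k (dr (uR u) (pB p)) (dr (uR w) (pB p))).2.
Qed.

Fact alg_mulA : associative alg_mul.
Proof.
move=> u v w; apply: nval_inj; rewrite !alg_mulE; apply/esym.
apply: (assoc (uR u) (reduced_bnorm (uR v)) (reduced_bnorm (uR w))).
  exact: dd.
exact: dd (reduced_conv (uR u) (uR v)) (uR w).
Qed.

Fact mod_lactA u v p : mod_lact (alg_mul u v) p = mod_lact u (mod_lact v p).
Proof.
apply: nval_inj; rewrite !mod_lactE alg_mulE.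
apply: (assoc (uR u) (reduced_bnorm (uR v)) (bounded_Ble (pB p))).
  exact: dl.
exact: dl (reduced_conv (uR u) (uR v)) (pB p).
Qed.

Fact mod_lractA u p v : mod_ract (mod_lact u p) v = mod_lact u (mod_ract p v).
Proof.
apply: nval_inj; rewrite !mod_ractE !mod_lactE mod_ractE.
apply: (assoc (uR u) (bounded_Ble (pB p)) (reduced_bnorm (uR v))).
  exact: dr.
exact: dr (uR v) (bounded_conv_l (uR u) (pB p)).
Qed.

Fact alg_starM u v : alg_star (alg_mul u v) = alg_mul (alg_star v) (alg_star u).
Proof.
apply: nval_inj; rewrite alg_starE !alg_mulE !alg_starE.
by rewrite (conv_star (dd (uR u) (uR v))).2.
Qed.

Fact mod_star_lact u p : mod_star (mod_lact u p) = mod_ract (mod_star p) (alg_star u).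
Proof.
apply: nval_inj; rewrite mod_starE mod_lactE mod_ractE alg_starE mod_starE.
by rewrite (conv_star (dl (uR u) (pB p))).2.
Qed.

Fact mod_star_ract p u : mod_star (mod_ract p u) = mod_lact (alg_star u) (mod_star p).
Proof.
apply: nval_inj; rewrite mod_starE mod_ractE mod_lactE alg_starE mod_starE.
by rewrite (conv_star (dr (uR u) (pB p))).2.
Qed.

Fact alg_starK : involutive alg_star.
Proof. by move=> u; apply: nval_inj; rewrite !alg_starE sstarK. Qed.

Fact mod_starK : involutive mod_star.
Proof. by move=> p; apply: nval_inj; rewrite !mod_starE sstarK. Qed.

(** [conv_assoc] approximates its leftmost factor, which here is only a bounded section; the
    involution moves the algebra elements to the left. *)
Fact mod_ractA p u v : mod_ract p (alg_mul u v) = mod_ract (mod_ract p u) v.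
Proof.
apply: (can_inj mod_starK); rewrite !mod_star_ract alg_starM.
by rewrite mod_lactA.
Qed.

Fact alg_star_involution : is_involution alg_star.
Proof.
split=> [|k u v]; first exact: alg_starK.
by apply: nval_inj; rewrite nvalD nvalZ !alg_starE nvalD nvalZ sstar_lin.
Qed.

Fact mod_star_involution : is_involution mod_star.
Proof.
split=> [|k u v]; first exact: mod_starK.
by apply: nval_inj; rewrite nvalD nvalZ !mod_starE nvalD nvalZ sstar_lin.
Qed.

Let norm_le (a b c : sect B) : conv_defined a b -> Ble a (bnorm a) -> Ble b (bnorm b) ->
  c = conv a b -> (bnorm c)%:C <= (bnorm a)%:C * (bnorm b)%:C :> R[i].
Proof.
by move=> d Ba Bb ->; rewrite -rmorphM lecR; exact: bnorm_le (Ble_conv d Ba Bb).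
Qed.

Fact norm_alg_mul u v : `|alg_mul u v| <= `|u| * `|v|.
Proof. rewrite ?norm_redE ?norm_bndE; exact: norm_le (dd (uR u) (uR v)) (reduced_bnorm (uR u)) (reduced_bnorm (uR v)) (alg_mulE u v). Qed.

Fact norm_mod_lact u p : `|mod_lact u p| <= `|u| * `|p|.
Proof. rewrite ?norm_redE ?norm_bndE; exact: norm_le (dl (uR u) (pB p)) (reduced_bnorm (uR u)) (bounded_Ble (pB p)) (mod_lactE u p). Qed.

Fact norm_mod_ract p u : `|mod_ract p u| <= `|p| * `|u|.
Proof. rewrite ?norm_redE ?norm_bndE; exact: norm_le (dr (uR u) (pB p)) (bounded_Ble (pB p)) (reduced_bnorm (uR u)) (mod_ractE p u). Qed.

Lemma bnorm_star a : Ble a (bnorm a) -> bnorm (sstar a) = bnorm a.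
Proof.
move=> Ba; have Bs := Ble_star Ba; have h := bnorm_le Bs.
have := bnorm_le (Ble_star (Ble_bnorm Bs)); rewrite sstarK => h'.
apply: le_anti; apply/andP; split; [exact h | exact h'].
Qed.

Fact norm_alg_star u : `|alg_star u| = `|u|.
Proof. by rewrite !norm_redE alg_starE bnorm_star//; exact: reduced_bnorm (uR u). Qed.

Fact norm_mod_star p : `|mod_star p| = `|p|.
Proof. by rewrite !norm_bndE mod_starE bnorm_star//; exact: bounded_Ble (pB p). Qed.

Definition section_bimodule : banach_bimodule R :=
  @BanachBimodule R A M alg_mul mod_lact mod_ract alg_mul_bilinear
    mod_lact_bilinear mod_ract_bilinear alg_mulA mod_lactA mod_lractA mod_ractA
    norm_alg_mul norm_mod_lact norm_mod_ract.

Definition section_star_bimodule : banach_star_bimodule R :=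
  @BanachStarBimodule R section_bimodule alg_star mod_star alg_star_involution
    mod_star_involution norm_alg_star norm_mod_star alg_starM mod_star_lact
    mod_star_ract.

Lemma nspace_realises (V : normed_subspace (sect B)) :
  (forall a, ns_set V a -> Ble a (ns_norm V a) /\ ns_norm V a = bnorm a) ->
  realises (@normb R G B) (ns_set V) (@nval R _ V : {linear nspace V -> sect B}).
Proof.
move=> VB; split.
- exact: nval_inj.
- apply/seteqP; split=> [_ [u _ <-]|a Va]; first exact: nvalP.
  by exists (nmk Va).
- move=> u; have [Bu e] := VB _ (nvalP u).
  by rewrite (normbE Bu) nspace_rnorm e.
Qed.

Lemma section_bimodule_over :
  is_banach_star_bimodule_over RA BC.
Proof.
exists section_star_bimodule, (va : {linear A -> sect B}), (vm : {linear M -> sect B}).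
split.
- rewrite -ns_set_redE; apply: nspace_realises => a.
  by rewrite ns_set_redE ns_norm_redE => Ra; split=> //; exact: reduced_bnorm.
- rewrite -ns_set_bndE; apply: nspace_realises => a.
  by rewrite ns_set_bndE ns_norm_bndE => Ba; split=> //; exact: bounded_Ble.
- split=> [u v|u p|p u]; split.
  + exact: dd (uR u) (uR v).
  + by rewrite -alg_mulE.
  + exact: dl (uR u) (pB p).
  + by rewrite -mod_lactE.
  + exact: dr (uR u) (pB p).
  + by rewrite -mod_ractE.
- by split=> [u|p]; [rewrite -alg_starE | rewrite -mod_starE].
Qed.

End ReducedAlgebra.

Theorem theorem3p11 (R : realType) (G : etale_groupoid) (B : fell_bundle R G) :
  is_banach_star_bimodule_over
    (reduced_algebra B) (bounded_continuous_sections B).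
Proof. exact: section_bimodule_over. Qed.
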